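(* Let $h\ge 1$ and let $G$ be a graph that excludes $K_h$ as a topological subgraph. Then there is an isomorphism-invariant tree decomposition $(T,\beta)$ of $G$ such that (1) the adhesion-width of $(T,\beta)$ is at most $h-1$, and (2) for every $t \in V(T)$ there is some $v \in \beta(t)$ such that $(\mathrm{Aut}(G))_v[\beta(t)] \in \Gamma_d$ for $d := 144 a_{\mathsf{deg}}^2 h^5$.
   Context: $H$ is a topological subgraph of $G$ if a subdivision of $H$ is a subgraph of $G$. $a_{\mathsf{deg}}$ is an absolute constant with $a_{\mathsf{deg}}\ge 2$ such that for every $h\ge1$ every graph excluding $K_h$ as a topological subgraph has average degree at most $a_{\mathsf{deg}}h^2$. A tree decomposition of $G$ is a pair $(T,\beta)$ with $T$ a rooted tree and $\beta\colon V(T)\to 2^{V(G)}$ such that every edge of $G$ is contained in some $\beta(t)$ and for every $v\in V(G)$ the set $\{t \mid v\in\beta(t)\}$ induces a non-empty connected subtree of $T$. Its adhesion-width is $\max_{t_1t_2\in E(T)}|\beta(t_1)\cap\beta(t_2)|$. Isomorphism-invariant means the decomposition is defined canonically, i.e., isomorphisms between graphs map the decomposition of one to the decomposition of the other. $(\mathrm{Aut}(G))_v$ is the stabilizer of $v$ in the automorphism group of $G$, and for a set $B$ of vertices, $\Gamma[B]=\{\gamma|_B\mid \gamma\in\Gamma\}$ denotes the restriction. For $d\ge 2$, $\Gamma_d$ is the class of finite groups all of whose composition factors are isomorphic to subgroups of the symmetric group $S_d$.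
   Formalization: Condition (2) fails for some disconnected graphs (the graph without vertices, or many isolated vertices); when G is not connected, the root is exempted from (2) if its bag is empty. For connected G the claim is unchanged. *)

(* Defs.v *)
From mathcomp Require Import all_boot all_order all_algebra.
From mathcomp Require Import all_fingroup all_solvable.
From mathcomp Require Import reals.

Set Implicit Arguments.
Unset Strict Implicit.
Unset Printing Implicit Defensive.

(* Graphs are finite, simple and undirected; the graph without vertices is
   allowed. *)
Record sgraph := SGraph {
  vert :> finType;
  adj : rel vert;
  adj_sym : symmetric adj;
  adj_irr : irreflexive adj }.

Definition graph_iso (G H : sgraph) (f : G -> H) : Prop :=
  bijective f /\ forall x y, adj (f x) (f y) = adj x y.

Definition subgraph (H G : sgraph) : Prop :=
  exists2 f : H -> G, injective f & forall x y, adj x y -> adj (f x) (f y).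

Definition complete_rel (h : nat) : rel 'I_h := fun i j => i != j.

Lemma complete_sym h : symmetric (@complete_rel h).
Proof. by move=> i j; rewrite /complete_rel eq_sym. Qed.

Lemma complete_irr h : irreflexive (@complete_rel h).
Proof. by move=> i; rewrite /complete_rel eqxx. Qed.

Definition complete (h : nat) : sgraph :=
  SGraph (@complete_sym h) (@complete_irr h).

(* [subdivide G x y] replaces the edge xy by the path x - None - y. *)
Section Subdivide.
Variables (G : sgraph) (x y : G).

Definition subdivide_rel : rel (option G) := fun u v =>
  match u, v with
  | Some a, Some b =>
      adj a b && ~~ ((a == x) && (b == y) || (a == y) && (b == x))
  | Some a, None | None, Some a => (a == x) || (a == y)
  | None, None => false
  end.

Lemma subdivide_sym : symmetric subdivide_rel.
Proof.
move=> [a|] [b|] //=; rewrite adj_sym; congr (_ && ~~ _).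
by rewrite orbC; congr (_ || _); rewrite andbC.
Qed.

Lemma subdivide_irr : irreflexive subdivide_rel.
Proof. by move=> [a|] //=; rewrite adj_irr. Qed.

Definition subdivide : sgraph := SGraph subdivide_sym subdivide_irr.
End Subdivide.

Inductive subdivision (H : sgraph) : sgraph -> Prop :=
| subdivision_refl : subdivision H H
| subdivision_edge (K : sgraph) (x y : K) :
    subdivision H K -> adj x y -> subdivision H (subdivide x y).

Definition topological_subgraph (H G : sgraph) : Prop :=
  exists2 K : sgraph, subdivision H K & subgraph K G.

(* For the graph without vertices the value is 0, as 0^-1 = 0. *)
Definition average_degree (R : realType) (G : sgraph) : R :=
  ((\sum_(x : G) #|[set y : G | adj x y]|)%:R / #|G|%:R)%R.

(* The subgraph induced by A is non-empty and connected. *)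
Definition connected_set (G : sgraph) (A : {set G}) : Prop :=
  A != set0 /\
  forall x y, x \in A -> y \in A ->
    connect [rel u v : G | [&& adj u v, u \in A & v \in A]] x y.

(* The graph without vertices is not connected. Connectedness matters for
   isomorphism-invariant decompositions: if G is disconnected, the root bag may
   have to be empty. For m isolated vertices, for example, a non-empty root bag
   is invariant under 'S_m, hence contains all vertices, and the stabiliser of
   a vertex then acts on it as 'S_(m-1). *)
Definition connected_graph (G : sgraph) : Prop := connected_set [set: G].

(* The bound on the size matters: a single edge is a cycle of length 2 in the
   sense of [ucycle]. *)
Definition acyclic (G : sgraph) : Prop :=
  forall c : seq G, ucycle (@adj G) c -> size c <= 2.

Definition is_tree (G : sgraph) : Prop := connected_graph G /\ acyclic G.

Record tree_decomposition (G : sgraph) := TreeDecomposition {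
  td_tree : sgraph;
  td_root : td_tree;
  bag : td_tree -> {set G};
  td_is_tree : is_tree td_tree;
  td_edge : forall x y : G, adj x y -> exists t, (x \in bag t) && (y \in bag t);
  td_vertex : forall x : G, connected_set [set t | x \in bag t] }.

Definition adhesion_width (G : sgraph) (D : tree_decomposition G) : nat :=
  \max_(e : td_tree D * td_tree D | adj e.1 e.2)
    #|bag (t := D) e.1 :&: bag (t := D) e.2|.

(* A canonical choice of a rooted tree decomposition of every graph: every
   isomorphism between graphs extends to an isomorphism between the chosen
   rooted decompositions. *)
Definition isomorphism_invariant
    (D : forall G : sgraph, tree_decomposition G) : Prop :=
  forall (G H : sgraph) (f : G -> H), graph_iso f ->
  exists g : td_tree (D G) -> td_tree (D H),
    [/\ graph_iso g,
        g (td_root (D G)) = td_root (D H) &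
        forall t, bag (g t) = f @: bag t].

Section GraphAut.
Variable G : sgraph.

Definition graph_aut : {set {perm G}} :=
  [set p : {perm G} | [forall x, forall y, adj (p x) (p y) == adj x y]].

Lemma graph_aut_group_set : group_set graph_aut.
Proof.
apply/group_setP; split=> [|p q].
  by rewrite inE; apply/forallP=> x; apply/forallP=> y; rewrite !perm1.
rewrite !inE => /forallP ap /forallP aq.
apply/forallP=> x; apply/forallP=> y; rewrite !permM.
by rewrite (eqP (forallP (aq _) _)) (eqP (forallP (ap _) _)).
Qed.

Canonical graph_aut_group := Group graph_aut_group_set.
End GraphAut.

(* The class Gamma_d. *)
Definition in_Gamma (d : nat) (gT : finGroupType) (G : {group gT}) : Prop :=
  forall s : seq {group gT}, comps G s ->
  forall F : section gT, F \in pairmap (@mkSec gT) G s ->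
  exists P : {group 'S_d}, F \isog P.

(* The restriction of the permutation group A to B is a permutation group only
   if A leaves B invariant, which is therefore part of the definition. Then
   [restr_perm B @* A] consists of the restrictions to B of the elements of A,
   each extended by the identity outside B. *)
Definition restriction_in_Gamma (d : nat) (T : finType)
    (A : {group {perm T}}) (B : {set T}) : Prop :=
  ([acts A, on B | 'P])%g /\ in_Gamma d [group of (restr_perm B @* A)%g].

(* Main.v *)
(* Call a set with fewer than h vertices a clique if no two of its vertices can be
   separated by fewer than h vertices. The decomposition is built from the root:
   a node is a connected set Z whose neighbourhood S is a clique, and its bag is
   obtained from Z and S by splitting repeatedly along the minimum cliques that
   separate it. Minimum separators are nested, so each of them can be oriented
   towards S or towards the majority of the bag; one keeps the side to which all
   of them point, or the unique separator without a preferred side. All this is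
   canonical and ends in an atom X: no clique separates X, and every component of
   G - X has a clique as neighbourhood. The components of Z - X are the next nodes.

   The torso of X, restricted to the edges realised by pairwise disjoint paths, is
   a topological subgraph of G and hence sparse, so some vertex a of X and Z has at
   most a_deg h^5 <= d torso neighbours. Let C be the largest set on which every
   subgroup of Aut(G)_a that acts non-trivially has an orbit of length between 2
   and d. Restrictions of Aut(G)_a to invariant subsets of C are in Gamma_d, C
   contains a and its torso neighbours, and the orbits of the pointwise stabiliser
   Gam of C outside C have more than d elements.

   Let Q be a component of G - C. If k <= h vertices are fixed by Gam and adjacent
   to Q, then at least d / (4 k^2) disjoint connected sets are adjacent to all of
   them: contracting orbits to points, a tree in the quotient graph is followed
   from its leaves to its root while carrying connected classes of vertices whose
   collision probability on the current orbit stays small; an optimal solution of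
   a convex transportation problem passes the classes from an orbit to the next.
   With k = h this would give a subdivision of K_h, and with k = 2 it shows that
   the neighbourhood of Q cannot be separated. So N(Q) is a clique. If Q meets the
   atom X, then X is contained in Q and N(Q), and the clique that consists of the
   vertices of N(Q) in X other than a separates a from X meet Q, which is
   impossible. Hence X is contained in C. *)
Require Import Defs.
From mathcomp Require Import all_boot all_order all_algebra.
From mathcomp Require Import all_fingroup all_solvable.
From mathcomp Require Import reals.
From mathcomp Require Import zify ring lra.

Set Implicit Arguments.
Unset Strict Implicit.
Unset Printing Implicit Defensive.

Import Order.TTheory GRing.Theory Num.Theory.

(** * Connectivity in induced subgraphs *)

Definition induced (G : sgraph) (A : {set G}) : rel G :=
  [rel u v : G | [&& adj u v, u \in A & v \in A]].

(** For x outside A this is the singleton of x, because [connect] is reflexive. *)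
Definition component (G : sgraph) (A : {set G}) (x : G) : {set G} :=
  [set y | connect (induced A) x y].

Definition nb (G : sgraph) (Z : {set G}) : {set G} :=
  [set y | (y \notin Z) && [exists z in Z, adj z y]].

Definition connectb (G : sgraph) (Z : {set G}) : bool :=
  (Z != set0) && [forall x in Z, forall y in Z, connect (induced Z) x y].

Section Connectivity.
Variable G : sgraph.
Implicit Types (A B K X Z : {set G}) (x y z : G).

Lemma induced_sym A : symmetric (induced A).
Proof. by move=> x y; rewrite /induced /= adj_sym; congr (_ && _); rewrite andbC. Qed.

Lemma connect_inducedC A x y : connect (induced A) x y = connect (induced A) y x.
Proof. exact/sym_connect_sym/induced_sym. Qed.

Lemma connect_inducedS A B x y :
  A \subset B -> connect (induced A) x y -> connect (induced B) x y.
Proof.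
move=> sAB; apply: connect_sub => u v /and3P[uv uA vA].
by apply: connect1; rewrite /induced /= uv !(subsetP sAB).
Qed.

Lemma connect_induced_in A x y : connect (induced A) x y -> x \in A -> y \in A.
Proof.
move=> /connectP[p]; elim: p x => [|z p IH] x /=; first by move=> _ ->.
by move=> /andP[/and3P[_ _ zA] pth] yl _; apply: IH pth yl zA.
Qed.

Lemma connect_induced_inr A x y : connect (induced A) x y -> y \in A -> x \in A.
Proof. by rewrite connect_inducedC; apply: connect_induced_in. Qed.

Lemma connectbP A : reflect (connected_set A) (connectb A).
Proof.
apply: (iffP andP) => [[A0 /forall_inP cA]|[A0 cA]]; split=> //.
  by move=> x y xA yA; move/forall_inP: (cA x xA); apply.
by apply/forall_inP => x xA; apply/forall_inP => y yA; apply: cA.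
Qed.

Lemma comp_refl A x : x \in component A x.
Proof. by rewrite inE. Qed.

Lemma comp_sub A x : x \in A -> component A x \subset A.
Proof. by move=> xA; apply/subsetP => y; rewrite inE => /connect_induced_in; apply. Qed.

Lemma comp_eq A x y : y \in component A x -> component A x = component A y.
Proof.
rewrite inE => xy; apply/setP => z; rewrite !inE.
exact: same_connect (sym_connect_sym (induced_sym A)) _ _ xy z.
Qed.

Lemma comp_sym A x y : (y \in component A x) = (x \in component A y).
Proof. by rewrite !inE connect_inducedC. Qed.

Lemma connect_comp A x y z : x \in A ->
  y \in component A x -> z \in component A x -> connect (induced (component A x)) y z.
Proof.
move=> xA.
have main w : w \in component A x -> connect (induced (component A x)) x w.
  rewrite inE => /connectP[p pth ->]; elim/last_ind: p pth => [|p u IH] //=.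
  rewrite rcons_path last_rcons => /andP[pth /and3P[e lA uA]].
  have cl: connect (induced A) x (last x p) by apply/connectP; exists p.
  apply: connect_trans (IH pth) _; apply: connect1.
  rewrite /induced /= e !inE cl /=; apply: connect_trans cl _.
  by apply: connect1; rewrite /induced /= e lA.
by move=> /main cy /main cz; apply: connect_trans cz; rewrite connect_inducedC.
Qed.

Lemma comp_connectb A x : x \in A -> connectb (component A x).
Proof.
move=> xA; apply/andP; split; first by apply/set0Pn; exists x; apply: comp_refl.
by apply/forall_inP => y yc; apply/forall_inP => z; apply: connect_comp.
Qed.

Lemma connectb_connect Z x y :
  connectb Z -> x \in Z -> y \in Z -> connect (induced Z) x y.
Proof. by move=> /connectbP[_]; apply. Qed.

Lemma connectb_n0 Z : connectb Z -> exists x, x \in Z.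
Proof. by move=> /andP[/set0Pn]. Qed.

Lemma connectb_sub_comp A Z x :
  connectb Z -> Z \subset A -> x \in Z -> Z \subset component A x.
Proof.
move=> cZ sZA xZ; apply/subsetP => y yZ; rewrite inE.
by apply: connect_inducedS sZA _; apply: connectb_connect.
Qed.

Lemma comp_disjoint A x y z : y \notin component A x -> z \in component A x -> z \notin component A y.
Proof.
move=> yx zx; apply: contra yx => zy.
by rewrite (comp_eq zx) -(comp_eq zy) comp_refl.
Qed.

Lemma in_nb Z x y : x \in Z -> adj x y -> y \notin Z -> y \in nb Z.
Proof. by move=> xZ xy yZ; rewrite inE yZ; apply/exists_inP; exists x. Qed.

Lemma nbP Z y : reflect (y \notin Z /\ exists2 x, x \in Z & adj x y) (y \in nb Z).
Proof. by rewrite inE; apply: (iffP andP) => -[? /exists_inP]. Qed.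

Lemma nb_comp A x : x \in A -> nb (component A x) \subset ~: A.
Proof.
move=> xA; apply/subsetP => y /nbP[yc [z zc zy]]; rewrite inE.
apply: contra yc => yA; have zA := subsetP (comp_sub xA) z zc.
move: zc; rewrite !inE => zc; apply: connect_trans zc _.
by apply: connect1; rewrite /induced /= zy zA.
Qed.

Lemma nb_compl_comp K x : x \notin K -> nb (component (~: K) x) \subset K.
Proof. by move=> xK; rewrite -{2}(setCK K); apply: nb_comp; rewrite inE. Qed.

Lemma nb_disjoint Z x : x \in nb Z -> x \notin Z.
Proof. by case/nbP. Qed.

(* A path leaving Z passes through nb Z. *)
Lemma connect_stay A Z x y : x \in Z -> nb Z \subset ~: A ->
  connect (induced A) x y -> y \in Z.
Proof.
move=> xZ sN /connectP[p]; elim: p x xZ => [|u p IH] x xZ /=; first by move=> _ ->.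
move=> /andP[/and3P[e xA uA] pth]; apply: IH => //.
apply: contraT => uZ; have /(subsetP sN) := in_nb xZ e uZ.
by rewrite inE uA.
Qed.

Lemma connect_nb Z x : connectb Z -> x \in nb Z ->
  forall z, z \in Z -> connect (induced (x |: Z)) x z.
Proof.
move=> cZ /nbP[_ [u uZ ux]] z zZ; apply: (@connect_trans _ _ u).
  by apply: connect1; rewrite /induced /= adj_sym ux !inE eqxx uZ orbT.
by apply: connect_inducedS (subsetUr _ _) _; apply: connectb_connect.
Qed.

Lemma connect_nb2 Z x y : connectb Z -> x \in nb Z -> y \in nb Z ->
  connect (induced (x |: (y |: Z))) x y.
Proof.
move=> cZ xN yN; have [z zZ] := connectb_n0 cZ.
apply: (@connect_trans _ _ z).
  apply: connect_inducedS (connect_nb cZ xN zZ).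
  by rewrite setUS ?subsetUr.
rewrite connect_inducedC; apply: connect_inducedS (connect_nb cZ yN zZ).
exact: subsetUr.
Qed.

(** A duplicate-free path from x never returns to x, so the rest of it avoids x. *)
Lemma connect_first_step A x y : connect (induced A) x y -> x != y ->
  exists2 u, adj x u & (u \in A) && connect (induced (A :\ x)) u y.
Proof.
move=> /connectP[p pth yl]; case/shortenP: pth yl => p' pth up _ {p} ->.
case: p' pth up => [|u p] /=; first by rewrite eqxx.
move=> /andP[/and3P[e xA uA] pth] /andP[xp _] _; exists u => //.
rewrite uA; apply/connectP; exists p => //.
move: xp; rewrite inE negb_or => /andP[xu xp].
elim: p u xu uA xp pth {e} => [|v p IH] u xu uA //=.
rewrite inE negb_or => /andP[xv xp] /andP[/and3P[e _ vA] pth].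
apply/andP; split; last exact: IH.
by rewrite /induced /= e !inE uA vA ![_ == x]eq_sym xu xv.
Qed.

End Connectivity.

(** * Topological subgraphs *)

Lemma subdivision_trans (H K L : sgraph) :
  subdivision H K -> subdivision K L -> subdivision H L.
Proof. by move=> HK; elim=> // M x y _ IH xy; apply: subdivision_edge. Qed.

(** If xy is the image of an edge of the subdivision M, that edge is subdivided as well; otherwise M
    still embeds, avoiding the new vertex. *)
Lemma topological_subgraph_subdivide (F K : sgraph) (x y : K) :
  topological_subgraph F K -> topological_subgraph F (subdivide x y).
Proof.
move=> [M FM [f finj fhom]].
have [[a [b [ab fa fb]]]|nab] :
  (exists a, exists b, [/\ adj a b, f a = x & f b = y]) \/
  ~ (exists a, exists b, [/\ adj a b, f a = x & f b = y]).
- have [/existsP[a /existsP[b /and3P[ab /eqP fa /eqP fb]]]|/negP n] :=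
    boolP [exists a, exists b, [&& adj a b, f a == x & f b == y]].
    by left; exists a, b.
  right=> -[a [b [ab fa fb]]]; apply: n.
  by apply/existsP; exists a; apply/existsP; exists b; rewrite ab fa fb !eqxx.
- exists (subdivide a b); first exact: subdivision_edge.
  exists (omap f) => [[u|] [v|] //= [/finj ->] //|[u|] [v|] //=].
  + by rewrite -fa -fb !(inj_eq finj) => /andP[/fhom -> ->].
  + by rewrite -fa -fb !(inj_eq finj).
  + by rewrite -fa -fb !(inj_eq finj).
- exists M => //; exists (Some \o f) => [u v [/finj]|u v uv] //=.
  rewrite (fhom _ _ uv) /=; apply/negP => /orP[]/andP[/eqP fu /eqP fv]; apply: nab.
    by exists u, v.
  by exists v, u; rewrite adj_sym.
Qed.

Lemma topological_subgraph_subdivision (F K L : sgraph) :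
  subdivision K L -> topological_subgraph F K -> topological_subgraph F L.
Proof.
move=> KL FK; elim: KL => // M x y _ IH _.
exact: topological_subgraph_subdivide.
Qed.

Lemma topological_subgraph_trans (F H G : sgraph) :
  topological_subgraph F H -> topological_subgraph H G -> topological_subgraph F G.
Proof.
move=> FH [K HK [g ginj ghom]].
have [M FM [f finj fhom]] := topological_subgraph_subdivision HK FH.
exists M => //; exists (g \o f); first exact: inj_comp.
by move=> x y xy; apply/ghom/fhom.
Qed.

Lemma preim_Some_inj (T : finType) (A B : {set option T}) :
  None \notin A -> None \notin B -> Some @^-1: A = Some @^-1: B -> A = B.
Proof.
move=> nA nB /setP eqAB; apply/setP => -[x|]; last by rewrite (negPf nA) (negPf nB).
by have := eqAB x; rewrite !inE.
Qed.

Lemma preim_Some_set2 (T : finType) (x y : T) :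
  Some @^-1: [set Some x; Some y] = [set x; y].
Proof. by apply/setP => z; rewrite !inE. Qed.

(* The sets [D e] contain the inner vertices of the paths that replace the edges
   e of H; the induction subdivides an edge whenever its path is not a single
   edge of G. *)
Lemma topological_model (G H : sgraph) (b : H -> G) (D : {set H} -> {set G})
    (U : {set G}) :
  injective b -> (forall x, b x \notin U) -> (forall e, D e \subset U) ->
  (forall e e' u, u \in D e -> u \in D e' -> e = e') ->
  (forall x y, adj x y ->
     connect (induced (b x |: (b y |: D [set x; y]))) (b x) (b y)) ->
  topological_subgraph H G.
Proof.
have [n leUn] := ubnP #|U|.
elim: n => // n IH in H b D U leUn * => binj bU DU Ddisj Dcon.
have [/forallP hom|] := boolP [forall x, forall y, adj x y ==> adj (b x) (b y)].
  exists H; first exact: subdivision_refl.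
  by exists b => // x y; move/forallP/(_ y)/implyP: (hom x); apply.
rewrite negb_forall => /existsP[x]; rewrite negb_forall => /existsP[y].
rewrite negb_imply => /andP[xy nbxy].
have nxy : x != y by apply: contraTneq xy => ->; rewrite adj_irr.
have nbb : b x != b y by rewrite (inj_eq binj).
have [u bu /andP[uA ucon]] := connect_first_step (Dcon x y xy) nbb.
have uD : u \in D [set x; y].
  move: uA; rewrite !inE => /or3P[/eqP ub|/eqP ub|//].
    by rewrite ub adj_irr in bu.
  by rewrite ub (negPf nbxy) in bu.
have uU := subsetP (DU _) u uD.
have bnu z : b z != u by apply: contraTneq uU => <-; apply: bU.
pose K := subdivide x y.
pose b' (o : K) := if o is Some z then b z else u.
(* The half from x to [None] becomes an edge of G, and the half from [None] to y inherits the rest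
   of the path of xy. The pair xy, no longer an edge, gets the empty set, which keeps the sets
   disjoint. *)
pose D' (e : {set K}) : {set G} :=
  if None \in e then
    if e == [set None; Some y] then D [set x; y] :\ u else set0
  else if e == [set Some x; Some y] then set0 else D (Some @^-1: e).
have D'sub e : D' e \subset U :\ u.
  rewrite /D'; case: ifP => nE; case: ifP => eE; rewrite ?sub0set //.
    by rewrite setSD.
  rewrite subsetD1 DU /=; apply/negP => /(Ddisj _ _ _ uD) E; move/negP: eE; apply.
  apply/eqP/preim_Some_inj; rewrite ?nE // ?preim_Some_set2 //.
  by rewrite !inE.
have HK : subdivision H K by apply: subdivision_edge xy; apply: subdivision_refl.
suff [M KM sM] : topological_subgraph K G by exists M => //; apply: subdivision_trans KM.
apply: (IH K b' D' (U :\ u)) => //.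
- by rewrite (cardsD1 u U) uU in leUn.
- by move=> [z|] [z'|] //= E; [rewrite (binj _ _ E)|move: (bnu z)|move: (bnu z')];
    rewrite ?E ?eqxx // -E eqxx.
- by move=> [z|]; rewrite !inE /= ?eqxx // negb_and bU orbT.
- move=> e e' v; rewrite /D'.
  have [ne|ne] := boolP (None \in e); have [ne'|ne'] := boolP (None \in e').
  + by case: eqP => [->|_]; case: eqP => [->|_]; rewrite ?inE.
  + case: eqP => [->|_]; case: eqP => [_|nE]; rewrite ?inE // => /andP[_ vD] vD'.
    case: nE; apply: preim_Some_inj => //; first by rewrite !inE.
    by rewrite preim_Some_set2; apply: Ddisj vD' vD.
  + case: eqP => [_|nE]; case: eqP => [->|_]; rewrite ?inE // => vD' /andP[_ vD].
    case: nE; apply: preim_Some_inj => //; first by rewrite !inE.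
    by rewrite preim_Some_set2; apply: Ddisj vD' vD.
  + case: eqP => [_|nE]; case: eqP => [_|nE']; rewrite ?inE // => vD vD'.
    by apply: preim_Some_inj => //; apply: Ddisj vD vD'.
- have main : connect (induced (u |: (b y |: D' [set None; Some y]))) u (b y).
    rewrite /D' !inE !eqxx /=; apply: connect_inducedS ucon.
    apply/subsetP => v; rewrite !inE => /andP[/negPf-> /=] /orP[->|->]; rewrite ?orbT //.
    by case: (v == u); rewrite ?orbT.
  have bxu : adj (b' (Some x)) (b' None) by [].
  move=> [p|] [q|] //= pq.
  + move: pq => /andP[pq npq].
    have -> : D' [set Some p; Some q] = D [set p; q]; last exact: Dcon.
    rewrite /D' !inE /= preim_Some_set2; case: eqP => // E.
    move/setP: E => E; have := E (Some x); have := E (Some y).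
    rewrite !inE !eqxx ?orbT /= => /orP[]/eqP[Ey] /orP[]/eqP[Ex];
      move: nxy npq; by rewrite Ex Ey !eqxx ?orbT.
  + case/orP: pq => /eqP ->; last by rewrite setUCA setUC connect_inducedC setUC
      [[set Some _; _]]setUC.
    by apply: connect1; rewrite /induced /= bu !inE !eqxx orbT.
  + case/orP: pq => /eqP ->; last exact: main.
    by apply: connect1; rewrite /induced /= adj_sym bu !inE !eqxx orbT.
Qed.

Lemma set2_ord_inj n (i j i' j' : 'I_n) : i < j -> i' < j' ->
  [set i; j] = [set i'; j'] -> (i, j) = (i', j').
Proof.
move=> ij ij' /setP E; have := E i'; have := E j'; rewrite !inE !eqxx ?orbT /=.
move=> /orP[]/eqP Ej /orP[]/eqP Ei; subst=> //; move: ij ij'; lia.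
Qed.

(** Every set touches every branch vertex; the one with index (i, j), i < j, carries the path that
    replaces the edge between i and j. *)
Lemma complete_topological (G : sgraph) (h : nat) (v : 'I_h -> G)
    (Q : 'I_h * 'I_h -> {set G}) :
  injective v -> (forall p, connectb (Q p)) -> (forall i p, v i \in nb (Q p)) ->
  (forall p q u, u \in Q p -> u \in Q q -> p = q) ->
  topological_subgraph (complete h) G.
Proof.
move=> vinj cQ vQ Qdisj.
pose D (e : {set complete h}) : {set G} :=
  if [pick p : 'I_h * 'I_h | (p.1 < p.2) && (e == [set p.1; p.2])] is Some p
  then Q p else set0.
have DE (i j : 'I_h) : i < j -> D [set i; j] = Q (i, j).
  move=> ij; rewrite /D; case: pickP => [[i' j'] /= /andP[ij' /eqP E]|/(_ (i, j))].
    by rewrite (set2_ord_inj ij ij' E).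
  by rewrite /= ij eqxx.
apply: (@topological_model G (complete h) v D (\bigcup_p Q p)) => //.
- by move=> i; apply/bigcupP => -[p _]; apply/negP/nb_disjoint/vQ.
- move=> e; rewrite /D; case: pickP => [p _|_]; rewrite ?sub0set //.
  exact: bigcup_sup.
- move=> e e' u; rewrite /D; case: pickP => [p /andP[_ /eqP ->]|]; rewrite ?inE //.
  case: pickP => [q /andP[_ /eqP ->]|]; rewrite ?inE // => up uq.
  by rewrite (Qdisj _ _ _ up uq).
- move=> i j /= ij; have /orP[lt|lt] : (i < j) || (j < i).
    by move: ij; rewrite /complete_rel -(inj_eq val_inj) /= neq_ltn.
  + by rewrite DE //; apply: connect_nb2.
  + rewrite [[set i; j]]setUC DE // connect_inducedC setUCA.
    exact: connect_nb2.
Qed.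

(** * Composition factors of groups with small orbits *)

Section PermutationGroups.
Local Open Scope group_scope.

Section CosetEmbedding.
Variables (gT : finGroupType) (S P : {group gT}) (d : nat).
Hypothesis indexP : #|S : P| <= d.

Let r := enum (rcosets P S).
Let size_r : size r <= d. Proof. by rewrite -cardE. Qed.

Let memr x (i : 'I_d) : x \in S -> i < size r -> nth set0 r i :* x \in r.
Proof.
move=> Sx ir; rewrite mem_enum; have: nth set0 r i \in r by apply: mem_nth.
rewrite mem_enum => /rcosetsP[y Sy ->]; rewrite -rcosetM.
by apply/rcosetsP; exists (y * x); rewrite ?groupM.
Qed.

(** Right multiplication by x on the numbered cosets of P, extended by the identity to the indices
    beyond their number. *)
Let F (x : gT) : {ffun 'I_d -> 'I_d} :=
  [ffun i : 'I_d => if i < size r then insubd i (index (nth set0 r i :* x) r) else i].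

Let F_val x (i : 'I_d) : x \in S -> i < size r ->
  F x i = index (nth set0 r i :* x) r :> nat.
Proof.
move=> Sx ir; rewrite ffunE ir val_insubd.
by rewrite (leq_trans _ size_r) // index_mem memr.
Qed.

Let F_out x (i : 'I_d) : ~~ (i < size r) -> F x i = i.
Proof. by move=> /negPf ir; rewrite ffunE ir. Qed.

Let F_lt x (i : 'I_d) : x \in S -> (F x i < size r) = (i < size r).
Proof.
move=> Sx; have [ir|ir] := boolP (i < size r); last by rewrite F_out // (negPf ir).
by rewrite F_val // index_mem memr.
Qed.

Let nthF x (i : 'I_d) : x \in S -> i < size r ->
  nth set0 r (F x i) = nth set0 r i :* x.
Proof. by move=> Sx ir; rewrite F_val // nth_index // memr. Qed.

Let F_inj x : x \in S -> injectiveb (F x).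
Proof.
move=> Sx; apply/injectiveP => i j E.
have ijr : (i < size r) = (j < size r) by rewrite -(F_lt i Sx) E F_lt.
have [ir|ir] := boolP (i < size r); last first.
  by rewrite -(F_out x ir) E F_out // -ijr.
have jr : j < size r by rewrite -ijr.
apply: val_inj => /=; apply/eqP; rewrite -(nth_uniq set0 ir jr (enum_uniq _)).
by apply/eqP/(rcoset_inj (x := x)); rewrite -!nthF // E.
Qed.

Let f (x : gT) : 'S_d := insubd (1 : 'S_d) (F x).

Let fE x i : x \in S -> f x i = F x i.
Proof. by move=> Sx; rewrite -pvalE val_insubd F_inj. Qed.

Let fM : {in S &, {morph f : x y / x * y}}.
Proof.
move=> x y Sx Sy /=; apply/permP => i; rewrite permM !fE ?groupM //.
have [ir|ir] := boolP (i < size r); last by rewrite !F_out.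
have xr : F x i < size r by rewrite F_lt.
have yr : F y (F x i) < size r by rewrite F_lt.
have xyr : F (x * y) i < size r by rewrite F_lt ?groupM.
apply: val_inj => /=; apply/eqP; rewrite -(nth_uniq set0 xyr yr (enum_uniq _)).
by rewrite !nthF ?groupM // rcosetM.
Qed.

Canonical coset_embedding := Morphism fM.

(** The kernel of the action on the cosets of P is normal in the simple group S. If it were all of
    S, then S would fix the coset P and be contained in P; so it is trivial. *)
Lemma simple_embeds : simple S -> P \proper S ->
  exists Q : {group 'S_d}, S \isog Q.
Proof.
move=> simS /andP[sPS nSP]; exists (coset_embedding @* S)%G; apply/isogP.
exists coset_embedding => //.
have /simpleP[_ /(_ _ (ker_normal coset_embedding))[//|kS]] := simS.
  by move/trivgP.
case/negP: nSP; apply/subsetP => x Sx.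
have Pr : (P : {set gT}) \in r.
  by rewrite mem_enum; apply/rcosetsP; exists 1; rewrite ?rcoset1.
have lt_i : index (P : {set gT}) r < d by apply: leq_trans size_r; rewrite index_mem.
pose i := Ordinal lt_i; have ir : i < size r by rewrite index_mem.
have: x \in 'ker coset_embedding by rewrite kS.
move/mker => /permP/(_ i); rewrite perm1 /= fE // => Fi.
have := nthF Sx ir; rewrite Fi nth_index // => ->; exact: rcoset_refl.
Qed.

End CosetEmbedding.

Lemma comps_factor (gT : finGroupType) (G : {group gT}) (s : seq {group gT})
    (F : section gT) : comps G s -> F \in pairmap (@mkSec gT) G s ->
  exists K L : {group gT}, [/\ F = mkSec K L, K \subset G, L <| K & simple (K / L)].
Proof.
move=> /andP[_]; elim: s G => [//|L s IH] G /=; rewrite inE.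
move=> /andP[maxL cs] /orP[/eqP ->|/(IH _ cs)].
  by exists G, L; rewrite quotient_simple ?maxnormal_normal.
move=> [K [M [-> sK nM simK]]]; exists K, M; split=> //.
exact: subset_trans sK (normal_sub (maxnormal_normal maxL)).
Qed.

Section SmallOrbits.
Variables (T : finType) (d : nat) (A : {group {perm T}}).
Implicit Types (C X : {set T}) (H : {group {perm T}}).

(** The condition is imposed on all subgroups because a composition factor of a restriction of A is
    a quotient of some subgroup, and it is there that the condition gets applied. *)
Definition small_orbits C : bool :=
  [forall H : {group {perm T}}, (H \subset A) && ~~ (H \subset 'C(C | 'P)) ==>
    [exists x in C, 1 < #|orbit 'P H x| <= d]].

Lemma small_orbitsP C : reflect
  (forall H, H \subset A -> ~~ (H \subset 'C(C | 'P)) ->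
     exists2 x, x \in C & 1 < #|orbit 'P H x| <= d) (small_orbits C).
Proof.
apply: (iffP forallP) => [so H HA HC|so H].
  by move: (so H); rewrite HA HC /= => /exists_inP.
by apply/implyP => /andP[HA HC]; apply/exists_inP/so.
Qed.

(* A composition factor of the restriction of A to X is a quotient of a subgroup
   H of A. A subgroup of minimal order with this quotient moves a point of C, and
   the stabiliser in H of a point x of a small orbit is mapped onto a proper
   subgroup whose index in the factor is at most the length of the orbit. *)
Lemma small_orbits_in_Gamma C X : small_orbits C -> X \subset C ->
  [acts A, on X | 'P] -> restriction_in_Gamma d A X.
Proof.
move=> /small_orbitsP soC sXC actX; split=> // s cs F Fs.
have [K [L [-> sK nL simKL]]] := comps_factor cs Fs.
pose onto (H : {group {perm T}}) :=
  [&& H \subset A, restr_perm X @* H \subset K & (restr_perm X @* H) / L == K / L].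
have onto0 : onto (A :&: restr_perm X @*^-1 K)%G.
  rewrite /onto subsetIl /= setIC morphimGI ?ker_sub_pre //=.
    have -> : restr_perm X @* (restr_perm X @*^-1 K) = K.
      by rewrite morphpreK //; apply: subset_trans sK (morphimS _ _).
    by rewrite (setIidPl sK) subxx eqxx.
have [H /mingroupP[/and3P[sHA sHK /eqP HL] minH] _] := mingroup_exists onto0.
have sHD : H \subset 'dom (restr_perm X) by apply: subset_trans sHA actX.
have nHC : ~~ (H \subset 'C(C | 'P)).
  apply: contraTN simKL => HC; rewrite -HL.
  have -> : restr_perm X @* H = 1.
    apply/trivgP; rewrite -(morphim_ker (restr_perm_morphism X)).
    by apply: morphimS; rewrite ker_restr_perm; apply: subset_trans HC (astabS _ _).
  by rewrite quotient1; apply/negP => /simpleP[]; rewrite eqxx.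
have [x xC /andP[o1 od]] := soC H sHA nHC.
pose Hx := ('C_H[x | 'P])%G.
have sHx : Hx \subset H by apply: subsetIl.
have ind : #|H : Hx| = #|orbit 'P H x| by rewrite card_orbit.
have sHxK : restr_perm X @* Hx \subset K by apply: subset_trans (morphimS _ sHx) sHK.
apply: (@simple_embeds _ (K / L)%G (restr_perm X @* Hx / L)%G) => //=.
- apply: leq_trans od; rewrite -ind dvdn_leq // -HL.
  have i1 : #|restr_perm X @* H : restr_perm X @* Hx| %| #|H : Hx|.
    by apply: index_morphim; rewrite subIset // sHD.
  apply: dvdn_trans i1; apply: (@index_quotient _ (restr_perm X @* H)%G).
  by rewrite subIset // (subset_trans sHK) // normal_norm.
- rewrite properEneq quotientS // andbT; apply/eqP => E.
  have /minH/(_ sHx) eH : onto Hx by rewrite /onto (subset_trans sHx) // sHxK E eqxx.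
  by move: o1; rewrite -ind eH indexgg.
Qed.

End SmallOrbits.

Lemma orbit_conj (T : finType) (H : {group {perm T}}) (p : {perm T}) x :
  orbit 'P (H :^ p) ('P%act x p) = 'P^*%act (orbit 'P H x) p.
Proof.
apply/setP => y; rewrite -[y in LHS](actKV 'P p) orbit_conjsg.
apply/idP/imsetP => [yo|[z zo ->]]; last by rewrite actK.
by exists ('P%act y p^-1) => //; rewrite actKV.
Qed.

Lemma orbit_gt1 (T : finType) (H : {group {perm T}}) x :
  ~~ (H \subset 'C[x | 'P]) -> 1 < #|orbit 'P H x|.
Proof.
rewrite ltnNge; apply: contra => le1; apply/subsetP => p Hp; apply/astab1P.
have o1 : #|orbit 'P H x| = 1%N.
  by apply/eqP; rewrite eqn_leq le1; apply/card_gt0P; exists x; apply: orbit_refl.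
have : 'P%act x p \in orbit 'P H x by apply: mem_orbit.
by rewrite (card_orbit1 o1) inE => /eqP.
Qed.

Section SmallOrbitClosure.
Variables (T : finType) (d : nat) (A : {group {perm T}}).
Implicit Types (C X : {set T}) (H : {group {perm T}}).

(** As [small_orbits] is closed under unions, this is the largest set with the property. *)
Definition small_closure : {set T} := \bigcup_(C | small_orbits d A C) C.

Lemma astab_sub1 H C : reflect (exists2 x, x \in C & ~~ (H \subset 'C[x | 'P]))
  (~~ (H \subset 'C(C | 'P))).
Proof.
apply: (iffP idP) => [nHC|[x xC]]; last first.
  by apply: contra => /subset_trans; apply; apply: astabS; rewrite sub1set.
apply/exists_inP; apply: contraR nHC; rewrite negb_exists_in => /forall_inP allC.
apply/subsetP => p Hp; apply/astabP => x xC.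
by have /negbNE/subsetP/(_ p Hp)/astab1P := allC x xC.
Qed.

Lemma small_closure_small : small_orbits d A small_closure.
Proof.
apply/small_orbitsP => H HA /astab_sub1[x /bigcupP[C soC xC] nHx].
have /small_orbitsP/(_ H HA)[] := soC; first by apply/astab_sub1; exists x.
by move=> y yC oy; exists y => //; apply/bigcupP; exists C.
Qed.

Lemma small_closure_max C : small_orbits d A C -> C \subset small_closure.
Proof. by move=> soC; apply: bigcup_sup. Qed.

(** This puts a and its torso neighbours into the closure: inside an invariant set of at most d
    points no orbit is longer than d. *)
Lemma sub_small_closure C :
  [acts A, on C | 'P] -> #|C| <= d -> C \subset small_closure.
Proof.
move=> actC leC; apply/small_closure_max/small_orbitsP => H HA.
move=> /astab_sub1[x xC nHx]; exists x; rewrite // orbit_gt1 //=.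
apply: leq_trans leC; apply: subset_leq_card.
by rewrite acts_sub_orbit ?xC //; apply: subset_trans actC.
Qed.

Lemma small_orbits_conj C p :
  p \in A -> small_orbits d A C -> small_orbits d A ('P^*%act C p).
Proof.
move=> Ap /small_orbitsP so; apply/small_orbitsP => H HA nHC.
have [||x xC] := so (H :^ p^-1)%G; first by rewrite sub_conjgV conjGid.
  by apply: contra nHC; rewrite sub_conjgV astab_setact //= ?inE.
move=> o; exists ('P%act x p); first by apply: imset_f.
suff <- : #|orbit 'P (H :^ p^-1)%G x| = #|orbit 'P H ('P%act x p)| by [].
by rewrite -(card_setact 'P _ p) -orbit_conj -conjsgM mulVg conjsg1.
Qed.

Lemma small_closure_acts : [acts A, on small_closure | 'P].
Proof.
apply/actsP => p Ap x; apply/idP/idP => /bigcupP[C soC xC]; apply/bigcupP.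
  exists ('P^*%act C p^-1); first by rewrite small_orbits_conj // groupV.
  by rewrite -[x](actK 'P p); apply: imset_f.
by exists ('P^*%act C p); [apply: small_orbits_conj|apply: imset_f].
Qed.

(* Otherwise the A-orbit of x could be added to the closure. *)
Lemma orbit_outside_small_closure x : x \notin small_closure ->
  d < #|orbit 'P 'C_A(small_closure | 'P) x|.
Proof.
set G := 'C_A(_ | _) => nx; rewrite ltnNge; apply: contra nx => led.
suff so : small_orbits d A (small_closure :|: orbit 'P A x).
  by apply: (subsetP (small_closure_max so)); rewrite inE orbit_refl orbT.
(* A normalises G, so the G-orbits inside a single A-orbit are conjugate and have equal length. *)
have nG : A \subset 'N(G).
  by apply: normsI (normG A) _; apply: subset_trans small_closure_acts (astab_norm _ _).
apply/small_orbitsP => H HA nH.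
have [HC|nHC] := boolP (H \subset 'C(small_closure | 'P)); last first.
  have /small_orbitsP/(_ H HA nHC)[y yC oy] := small_closure_small.
  by exists y => //; rewrite inE yC.
have HG : H \subset G by rewrite subsetI HA.
have /astab_sub1[y yC nHy] := nH.
have {yC} yC : y \in orbit 'P A x.
  move: yC; rewrite inE => /orP[yC|//]; case/negP: nHy.
  by apply: subset_trans HC (astabS _ _); rewrite sub1set.
exists y; first by rewrite inE yC orbT.
rewrite orbit_gt1 //=; have /imsetP[p Ap ->] := yC.
apply: (@leq_trans #|orbit 'P G ('P%act x p)|).
  by apply: subset_leq_card; apply: imsetS.
rewrite -[X in orbit _ X](normP (subsetP nG p Ap)) orbit_conj.
by rewrite card_setact.
Qed.

End SmallOrbitClosure.

End PermutationGroups.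

(** * Rounding along layers of orbits *)

Section Assignment.
Variables (V R : finType) (E : V -> pred R) (Delta : R -> nat -> nat).
Implicit Types (s : {ffun V -> R}) (r : R) (v : V).

Definition load s r : nat := \sum_v (s v == r).
Definition admissible s : bool := [forall v, E v (s v)].
(** [Delta r i] is the marginal cost of raising the load of r from i to i + 1; monotone marginal
    costs make the problem convex. *)
Definition assignment_cost s : nat := \sum_r \sum_(0 <= i < load s r) Delta r i.
Definition residual s : rel R := [rel r1 r2 | [exists v, (s v == r1) && E v r2]].

Lemma load_update s v r0 r1 r : s v = r0 ->
  load [ffun w => if w == v then r1 else s w] r + (r == r0) = load s r + (r == r1).
Proof.
move=> sv; rewrite /load (bigD1 v) //= [in RHS](bigD1 v) //= ffunE eqxx sv.
rewrite (eq_bigr (fun w => (s w == r) : nat)); last first.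
  by move=> w /negPf nw; rewrite ffunE nw.
by rewrite (eq_sym r r0) (eq_sym r r1) addnAC [RHS]addnAC; congr (_ + _); rewrite addnC.
Qed.

(** One item is moved along every arc of the path, so that only the loads of its ends change. Since
    the path does not return to r0, the item moved first is not the witness of a later arc. *)
Lemma residual_shift s r0 p : admissible s -> path (residual s) r0 p ->
  uniq (r0 :: p) -> exists2 s', admissible s' &
    forall r, load s' r + (r == r0) = load s r + (r == last r0 p).
Proof.
elim: p s r0 => [|r1 p IH] s r0 adm; first by move=> _ _; exists s.
move=> /andP[/existsP[v /andP[/eqP sv Ev]] pth] /andP[r0p up].
pose s1 := [ffun w => if w == v then r1 else s w].
have adm1 : admissible s1.
  apply/forallP => w; rewrite ffunE; case: eqP => [->//|_].
  exact: (forallP adm).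
have pth1 : path (residual s1) r1 p.
  apply: (sub_in_path (P := predC1 r0)) pth; last first.
    by apply/allP => r rp; apply: contraNneq r0p => <-.
  move=> r2 r3 r20 _ /existsP[w /andP[/eqP sw Ew]]; apply/existsP; exists w.
  have /negPf wv : w != v by apply: contraNneq r20 => wv; rewrite -sw wv sv.
  by rewrite ffunE wv sw eqxx.
have [s' adm' loads'] := IH s1 r1 adm1 pth1 up.
exists s' => // r; have := loads' r; have := load_update r1 r sv.
rewrite -/s1 /=; move: (load s' r) (load s1 r) (load s r) => a b c.
by clear; lia.
Qed.

Hypothesis Delta_mono : forall r, {homo Delta r : m n / m <= n}.
Hypothesis E_total : forall v, exists r, E v r.

(* Complementary slackness for the convex transportation problem: [price r] is
   the largest marginal cost from which r can be reached in the residual graph. *)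
Lemma optimal_assignment : exists s : {ffun V -> R}, exists price : R -> nat,
  [/\ forall v, E v (s v), forall v r, E v r -> price (s v) <= price r,
      forall r, 0 < load s r -> Delta r (load s r).-1 <= price r &
      forall r, price r <= Delta r (load s r)].
Proof.
have [s0 adm0] : exists s, admissible s.
  exists [ffun v => xchoose (E_total v)]; apply/forallP => v; rewrite ffunE.
  exact: xchooseP.
have [s adm opt] : exists2 s, admissible s &
    forall s', admissible s' -> assignment_cost s <= assignment_cost s'.
  by case: (arg_minnP assignment_cost adm0) => s; exists s.
exists s, (fun r => \max_(r0 | (0 < load s r0) && connect (residual s) r0 r)
                      Delta r0 (load s r0).-1).
split=> [v||r lr|r].
- exact: (forallP adm).
- move=> v r Evr; apply/bigmax_leqP => r0 /andP[l0 c0].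
  apply: leq_bigmax_cond; rewrite l0 /=; apply: connect_trans c0 (connect1 _).
  by apply/existsP; exists v; rewrite eqxx.
- by apply: leq_bigmax_cond; rewrite lr connect0.
- apply/bigmax_leqP => r0 /andP[l0 /connectP[p pth rl]].
  have [->|nr] := eqVneq r0 r; first by apply: Delta_mono; rewrite leq_pred.
  case/shortenP: pth rl => p' pth up _ rl.
  have [s' adm' ls'] := residual_shift adm pth up.
  (* Compared with s, the assignment s' saves the last marginal cost at r0 and pays the next one at
     r. *)
  have := opt s' adm'; rewrite /assignment_cost.
  rewrite (bigD1 r0) //= (bigD1 r) 1?eq_sym //= [X in _ <= X](bigD1 r0) //=.
  rewrite [X in _ <= _ + X](bigD1 r) 1?eq_sym //=.
  have -> : load s' r = (load s r).+1.
    by have := ls' r; rewrite -rl eqxx eq_sym (negPf nr); lia.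
  have e0 : load s r0 = (load s' r0).+1.
    by have := ls' r0; rewrite -rl eqxx (negPf nr); lia.
  rewrite e0 !big_nat_recr //=.
  rewrite (eq_bigr (fun r1 => \sum_(0 <= i < load s' r1) Delta r1 i)); last first.
    by move=> r1 /andP[/negPf n0 /negPf n1]; have := ls' r1; rewrite -rl n0 n1 !addn0 => ->.
  by rewrite -addnA leq_add2l -addnA addnCA leq_add2l leq_add2r.
Qed.

End Assignment.

(** The price p lies between the marginal costs 2l - 1 and 2l + 1 of the square of l. With p = 2l +
    e, the right side exceeds the left one by (l - q)(l - q + e) + (q - z). The product is negative
    only if q lies strictly between l and l + e; then the integer z is at most the smaller of the
    two, and q - z makes up for it. *)
Lemma price_square (q : rat) (l z p : nat) : (z%:R <= q)%R ->
  (0 < l -> (l.-1.*2).+1 <= p) -> p <= (l.*2).+1 ->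
  (l%:R ^+ 2 - q ^+ 2 - (q - z%:R) <= p%:R * (l%:R - q))%R.
Proof.
move=> zq lo hi.
have lt_z (m : nat) : (q < m%:R)%R -> z < m.
  by move=> qm; rewrite -(ltr_nat rat); apply: le_lt_trans zq qm.
have : [|| p == l.*2, p == (l.*2).+1 | (0 < l) && (p == (l.-1.*2).+1)].
  by move: lo hi; clear; case: l => [|l] /=; lia.
case/or3P => [/eqP ->|/eqP ->|/andP[l0 /eqP ->]].
- rewrite -mul2n natrM -subr_ge0.
  have -> : (2%:R * l%:R * (l%:R - q) - (l%:R ^+ 2 - q ^+ 2 - (q - z%:R)) =
    (l%:R - q) ^+ 2 + (q - z%:R) :> rat)%R by ring.
  by rewrite addr_ge0 ?sqr_ge0 // subr_ge0.
- rewrite -(natr1 l.*2) -mul2n natrM.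
  have [ql|lq] := lerP q l%:R; first by nra.
  have [ql1|ql1] := lerP (l%:R + 1) q; first by nra.
  have /lt_z : (q < l.+1%:R)%R by rewrite -natr1.
  by rewrite ltnS -(ler_nat rat) => zl; nra.
- case: l l0 {lo hi} => // l _ /=; rewrite -(natr1 l.*2) -mul2n natrM -(natr1 l).
  have [ql|lq] := lerP q l%:R; first by nra.
  have [ql1|ql1] := lerP (l%:R + 1) q; first by nra.
  have /lt_z : (q < l.+1%:R)%R by rewrite -natr1.
  by rewrite ltnS -(ler_nat rat) => zl; nra.
Qed.

(** * Averaging over a group of automorphisms *)

Section Orbits.
Variables (G : sgraph) (Gam : {group {perm G}}).
Hypothesis GamAut : Gam \subset graph_aut G.

Definition orb (x : G) : {set G} := orbit 'P%act Gam x.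
Definition is_orb (A : {set G}) : bool := [exists x, A == orb x].
Definition linked : rel {set G} :=
  [rel A B | [&& is_orb A, is_orb B & [exists x in A, exists y in B, adj x y]]].

Lemma is_orb_orb x : is_orb (orb x).
Proof. by apply/existsP; exists x. Qed.

Lemma orb_refl x : x \in orb x.
Proof. exact: orbit_refl. Qed.

Lemma is_orbE A x : is_orb A -> (x \in A) = (orb x == A).
Proof. by case/existsP => y /eqP ->; rewrite [RHS]orbit_eq_mem. Qed.

Lemma orb_perm p x : p \in Gam -> p x \in orb x.
Proof. by move=> Gp; apply/orbitP; exists p. Qed.

Lemma is_orb_gt0 A : is_orb A -> 0 < #|A|.
Proof. by case/existsP => x /eqP ->; apply/card_gt0P; exists x; apply: orb_refl. Qed.

Lemma linked_sym : symmetric linked.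
Proof.
move=> A B; rewrite /linked /= andbCA; congr [&& _, _ & _].
by apply/exists_inP/exists_inP => -[x xA /exists_inP[y yB e]];
  exists y => //; apply/exists_inP; exists x; rewrite // adj_sym.
Qed.

Lemma adj_perm p x y : p \in Gam -> adj (p x) (p y) = adj x y.
Proof.
by move=> /(subsetP GamAut); rewrite inE => /forallP/(_ x)/forallP/(_ y)/eqP.
Qed.

Lemma linked_orb x y : adj x y -> linked (orb x) (orb y).
Proof.
move=> xy; rewrite /linked /= !is_orb_orb /=; apply/exists_inP.
by exists x; rewrite ?orb_refl //; apply/exists_inP; exists y; rewrite ?orb_refl.
Qed.

Lemma linked_adj A B y : linked A B -> y \in B -> exists2 x, x \in A & adj x y.
Proof.
case/and3P => oA oB /exists_inP[u uA /exists_inP[v vB uv]] yB.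
have /orbitP[p Gp pv] : y \in orb v.
  by move: yB vB; rewrite !(is_orbE _ oB) => /eqP yB /eqP vB; rewrite -/(orb v) vB -yB orb_refl.
exists (p u); last by rewrite -pv /= adj_perm.
by move: uA; rewrite (is_orbE _ oA) => /eqP <-; apply: orb_perm.
Qed.

Lemma sum_orb (g : G -> nat) x :
  \sum_(p in Gam) g (p x) = #|('C_(Gam)[x | 'P])%g| * \sum_(y in orb x) g y.
Proof.
rewrite (partition_big (fun p : {perm G} => p x) (mem (orb x))) => [|p]; last first.
  exact: orb_perm.
rewrite big_distrr /=; apply: eq_bigr => y /orbitP[p Gp py].
rewrite (eq_bigr (fun=> g y)) => [|q /andP[_ /eqP -> //]]; rewrite sum_nat_const.
congr (_ * _); rewrite -(card_rcoset ('C_(Gam)[x | 'P])%g p) -amove_act ?subsetT //.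
by apply: eq_card => q; rewrite !inE py.
Qed.

(* Averaging over Gam an inequality between the two ends of a single edge. *)
Lemma linked_average (g f : G -> nat) A B : linked A B ->
  (forall x y, x \in A -> y \in B -> adj x y -> g y <= f x) ->
  #|A| * \sum_(y in B) g y <= #|B| * \sum_(x in A) f x.
Proof.
case/and3P => oA oB /exists_inP[u uA /exists_inP[v vB uv]] gf.
have /eqP eA : orb u == A by rewrite -is_orbE.
have /eqP eB : orb v == B by rewrite -is_orbE.
have : \sum_(p in Gam) g (p v) <= \sum_(p in Gam) f (p u).
  apply: leq_sum => p Gp; apply: gf; rewrite -?eA -?eB ?orb_perm //.
  by rewrite adj_perm.
rewrite !sum_orb eA eB => le.
have cA := card_orbit_stab 'P Gam u; have cB := card_orbit_stab 'P Gam v.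
rewrite -/(orb u) eA in cA; rewrite -/(orb v) eB in cB.
rewrite -(leq_pmul2l (cardG_gt0 Gam)) -{1}cB -cA.
by rewrite mulnACA [X in _ <= X]mulnACA (mulnC #|A|) leq_mul2l le orbT.
Qed.

(** The right side is the value of a fractional transport: a vertex of a layer L sends the fraction
    |Y| / |L| of itself down to the previous layer and keeps the rest in place, which is why L must
    not be smaller than Y. The part that moves is bounded by the averaged inequality, the part that
    stays by g <= f. *)
Lemma linked_flow (g : G -> nat) (f : {set G} -> G -> nat) A s Y :
  path linked A (rcons s Y) ->
  path (fun B C : {set G} => [forall x in B, forall y in C, adj x y ==> (g y <= f B x)])
    A (rcons s Y) ->
  {in s, forall L : {set G}, #|Y| <= #|L|} ->
  {in s, forall (L : {set G}) x, x \in L -> g x <= f L x} ->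
  ((\sum_(L <- rcons s Y) \sum_(x in L) g x)%:R <=
   #|Y|%:R / #|A|%:R * (\sum_(x in A) f A x)%:R +
   (\sum_(L <- s) \sum_(x in L) f L x)%:R :> rat)%R.
Proof.
have avg B C : linked B C ->
    [forall x in B, forall y in C, adj x y ==> (g y <= f B x)] ->
    ((\sum_(y in C) g y)%:R <= #|C|%:R / #|B|%:R * (\sum_(x in B) f B x)%:R :> rat)%R.
  move=> lBC /forall_inP gf; have /and3P[oB _ _] := lBC.
  rewrite mulrAC ler_pdivlMr ?ltr0n ?is_orb_gt0 // -!natrM ler_nat mulnC.
  apply: (linked_average lBC) => x y xB yC xy.
  by have /forall_inP/(_ y yC)/implyP := gf x xB; apply.
elim: s A => [|L s IH] A /=.
  by move=> /andP[lk _] /andP[gf _] _ _; rewrite big_seq1 big_nil addr0 avg.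
move=> /andP[lk pth] /andP[gf pgf] leY leg; rewrite !big_cons !natrD.
have /(IH L pth pgf) := fun M Ms => leY M (mem_behead (s := L :: s) Ms).
have leg' : {in s, forall (L : {set G}) x, x \in L -> g x <= f L x}.
  by move=> M Ms; apply: leg; rewrite inE Ms orbT.
move=> /(_ leg').
have := avg _ _ lk gf.
have oL : 0 < #|L| by case/and3P: lk => _ /is_orb_gt0.
have : ((\sum_(x in L) g x)%:R <= (\sum_(x in L) f L x)%:R :> rat)%R.
  by rewrite ler_nat; apply: leq_sum; apply: leg; rewrite inE eqxx.
have := leY L (mem_head _ _).
set gL := (\sum_(x in L) g x)%:R%R; set fL := (\sum_(x in L) f L x)%:R%R.
set fA := (\sum_(x in A) f A x)%:R%R; set gs := (\sum_(M <- rcons s Y) _)%:R%R; set fs := (\sum_(M <- s) _)%:R%R.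
rewrite -(ltr_nat rat) in oL; rewrite -(ler_nat rat).
have y0 : (0 <= #|Y|%:R :> rat)%R by rewrite ler0n.
move: (#|L|%:R : rat)%R (#|Y|%:R : rat)%R (#|A|%:R : rat)%R oL y0 => l y a l0 y0 yl h1 h2 h3.
have t0 : (0 <= y / l)%R by rewrite divr_ge0 // ltW.
have t1 : (y / l <= 1)%R by rewrite ler_pdivrMr // mul1r.
have : (y / l * gL <= y / a * fA)%R.
  have -> : (y / a * fA = y / l * (l / a * fA))%R.
    by rewrite !mulrA; congr (_ / _ * _)%R; rewrite mulfVK // gt_eqF.
  exact: (ler_wpM2l t0 h2).
by nra.
Qed.

End Orbits.

Lemma sum_load (V R : finType) (s : {ffun V -> R}) (p : R -> nat) :
  \sum_v p (s v) = \sum_r p r * load s r.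
Proof.
under [RHS]eq_bigr => r _ do rewrite /load big_distrr /=.
rewrite exchange_big /=; apply: eq_bigr => v _.
rewrite (bigD1 (s v)) //= eqxx muln1 big1 ?addn0 // => r.
by rewrite eq_sym => /negPf ->; rewrite muln0.
Qed.

(** * Integral transport along a chain of orbits *)

Section Transport.
Variables (G : sgraph) (Gam : {group {perm G}}).
Hypothesis GamAut : Gam \subset graph_aut G.
Local Notation orb := (orb Gam).
Local Notation linked := (linked Gam).

Lemma sum_layers (g : G -> nat) (t : seq {set G}) : uniq t -> all (is_orb Gam) t ->
  \sum_(v | orb v \in t) g v = \sum_(L <- t) \sum_(v in L) g v.
Proof.
elim: t => [|L t IH] /=; first by rewrite big_nil big_pred0.
move=> /andP[Lt ut] /andP[oL ot]; rewrite big_cons -IH // (bigID (mem L)) /=.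
congr (_ + _); apply: eq_bigl => v; rewrite inE (is_orbE _ oL).
  by case: eqP; rewrite ?andbF.
by case: eqP => [->|]; rewrite ?andbT //= (negPf Lt).
Qed.

Lemma path_linked_orb A t : path linked A t -> all (is_orb Gam) t.
Proof.
elim: t A => //= L t IH A /andP[lk pth]; have /and3P[_ -> _] := lk.
exact: IH pth.
Qed.

Variables (X Y : {set G}) (s : seq {set G}) (col : G -> G).
Hypothesis pth : path linked X (rcons s Y).
Hypothesis uq : uniq (X :: rcons s Y).
Hypothesis sizeY : {in s, forall L : {set G}, #|Y| <= #|L|}.

(** X is layer 0, Y is layer [(size s).+1], and orbits off the chain get a larger number. *)
Definition layer (v : G) : nat := index (orb v) (X :: rcons s Y).

(* A vertex of a layer goes to itself, to a neighbour in the next lower layer or,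
   from the lowest layer, to the colour of a neighbour in X. *)
Definition moves (v : G) : pred (G + G) := fun r =>
  if orb v \in rcons s Y then
    match r with
    | inl u => (u == v) && (orb v != Y) ||
               [&& adj u v, orb u \in rcons s Y & layer v == (layer u).+1]
    | inr c => (layer v == 1) && [exists u in X, adj u v && (col u == c)]
    end
  else r == inl v.

Definition color_size (c : G) : nat := #|[set u in X | col u == c]|.
(** The load of c in the fractional transport, in which every vertex of X receives the amount |Y| /
    |X|. *)
Definition color_share (c : G) : rat := (#|Y|%:R / #|X|%:R * (color_size c)%:R)%R.

Let orbX : is_orb Gam X.
Proof. by move: pth; case: (s) => [|L t] /= /andP[/and3P[]]. Qed.

Lemma layerY v : orb v = Y -> layer v = (size s).+1.
Proof.
move=> vY; rewrite /layer vY -[RHS](@index_uniq _ set0 (size s).+1 (X :: rcons s Y)) //.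
  by rewrite /= nth_rcons ltnn eqxx.
by rewrite /= size_rcons.
Qed.

Lemma layer_gt0 v : orb v \in rcons s Y -> 0 < layer v.
Proof.
rewrite /layer /=; case: eqP => // <- Xs.
by move: uq => /= /andP[]; rewrite Xs.
Qed.

Lemma layer_le v : orb v \in rcons s Y -> layer v <= (size s).+1.
Proof.
move=> vs; rewrite -ltnS -(size_rcons s Y); have : orb v \in X :: rcons s Y.
  by rewrite inE vs orbT.
by rewrite -index_mem.
Qed.

Lemma moves_nth i x y : i < (size s).+1 ->
  x \in nth set0 (X :: rcons s Y) i -> y \in nth set0 (rcons s Y) i -> adj x y ->
  moves y (if i == 0 then inr (col x) else inl x).
Proof.
move=> ilt xL yL xy.
have iLs : i < size (rcons s Y) by rewrite size_rcons.
have oall : all (is_orb Gam) (X :: rcons s Y) by rewrite /= orbX (path_linked_orb pth).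
have ox : orb x = nth set0 (X :: rcons s Y) i.
  apply/eqP; rewrite -is_orbE //; apply: (allP oall); rewrite mem_nth //=.
  exact: ltnW.
have oy : orb y = nth set0 (rcons s Y) i.
  apply/eqP; rewrite -is_orbE //; apply: (allP (path_linked_orb pth)).
  exact: mem_nth.
have lx : layer x = i by rewrite /layer ox index_uniq //= ltnW.
have ly : layer y = i.+1.
  by rewrite /layer oy -[nth _ _ i]/(nth set0 (X :: rcons s Y) i.+1) index_uniq.
rewrite /moves oy mem_nth //.
case: i ilt xL yL iLs ox oy lx ly => [|i] ilt xL yL iLs ox oy lx ly /=; rewrite ly.
  by apply/exists_inP; exists x; rewrite ?xy /=.
by rewrite lx xy eqxx ox /= mem_nth ?orbT // ltnW.
Qed.

Lemma moves_total v : exists r, moves v r.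
Proof.
have [vs|nvs] := boolP (orb v \in rcons s Y); last first.
  by exists (inl v); rewrite /moves (negPf nvs) eqxx.
have [vY|nvY] := eqVneq (orb v) Y; last first.
  by exists (inl v); rewrite /moves vs eqxx nvY.
have [i ilt vi] : exists2 i, i < (size s).+1 & v \in nth set0 (rcons s Y) i.
  by exists (size s); rewrite // nth_rcons ltnn eqxx -vY orb_refl.
have /(pathP set0)/(_ i) := pth; rewrite size_rcons => /(_ ilt) lk.
have [u uL uv] := linked_adj GamAut lk vi.
by eexists; apply: moves_nth ilt uL vi uv.
Qed.

(** An optimal integral assignment is compared with the fractional transport by means of its prices.
    As the marginal costs of a colour are those of a square, this bounds the sum of the squared
    loads; [price_square] accounts for the rounding error, which shrinks as z approaches the
    shares. *)
Lemma transport (z : G -> nat) : (forall c, z c * #|X| <= color_size c * #|Y|) ->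
  exists sg : {ffun G -> G + G},
  [/\ forall v, moves v (sg v),
      forall v v' u, sg v = inl u -> sg v' = inl u -> v = v' &
      (\sum_c (load sg (inr c))%:R ^+ 2 <=
       \sum_c (color_share c ^+ 2 + (color_share c - (z c)%:R)))%R].
Proof.
move=> zle.
(* K exceeds the right side of the claim. A vertex accepts one item for free and every further one
   at cost K, while the odd marginal costs of a colour add up to the square of its load. *)
pose K := (\sum_c ((color_size c * #|Y|) ^ 2 + color_size c * #|Y|)).+1.
pose Delta (r : G + G) n := match r with inl _ => if n is 0 then 0 else K
  | inr _ => (n.*2).+1 end.
have Dmono r : {homo Delta r : m n / m <= n}.
  by case: r => c [|m] [|n] //=; rewrite !ltnS leq_double.
have [sg [p [adm mono lo hi]]] := optimal_assignment Dmono moves_total.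
pose t : rat := (#|Y|%:R / #|X|%:R)%R.
pose f (A : {set G}) u := if A == X then p (inr (col u)) else p (inl u).
have X0 : (0 < #|X|%:R :> rat)%R by rewrite ltr0n (is_orb_gt0 orbX).
have flow : ((\sum_v p (sg v))%:R <=
    (\sum_(v | orb v != Y) p (inl v))%:R +
    t * (\sum_c p (inr c) * color_size c)%:R :> rat)%R.
  have := @linked_flow G Gam GamAut (fun v => p (sg v)) f X s Y pth _ sizeY _.
  have -> : \sum_(x in X) f X x = \sum_c p (inr c) * color_size c.
    rewrite (partition_big col predT) //=; apply: eq_bigr => c _.
    rewrite (eq_bigr (fun=> p (inr c))) => [|u /andP[_ /eqP uc]]; last by rewrite /f eqxx uc.
    by rewrite sum_nat_const mulnC; congr (_ * _); apply: eq_card => u; rewrite !inE.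
  have -> : \sum_(L <- s) \sum_(x in L) f L x = \sum_(v | orb v \in s) p (inl v).
    rewrite sum_layers.
    - rewrite !big_seq; apply: eq_bigr => L Ls; apply: eq_bigr => x _; rewrite /f.
      case: eqP => // LX; move: uq => /= /andP[/negP[]].
      by rewrite mem_rcons inE -LX Ls orbT.
    - by move: uq => /= /andP[_]; rewrite rcons_uniq => /andP[].
    - by have := path_linked_orb pth; rewrite all_rcons => /andP[].
  rewrite -sum_layers; first last.
  - exact: path_linked_orb pth.
  - by move: uq => /= /andP[].
  move=> fl; rewrite (bigID (fun v => orb v \in rcons s Y)) /=.
  rewrite [X in (_ <= X%:R + _)%R](bigID (fun v => orb v \in rcons s Y)) /=.
  rewrite !natrD -addrA [X in (_ <= _ + X)%R]addrC addrA.
  have -> : \sum_(v | orb v \notin rcons s Y) p (sg v) =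
            \sum_(v | (orb v != Y) && (orb v \notin rcons s Y)) p (inl v).
    apply: eq_big => v; first by rewrite mem_rcons inE negb_or andbA andbb.
    by move=> nv; have := adm v; rewrite /moves (negPf nv) => /eqP ->.
  rewrite lerD2r addrC.
  rewrite [X in (_ <= _ + X%:R)%R](eq_bigl (fun v => orb v \in s)); last first.
    have nYs : Y \notin s.
      by move: uq => /= /andP[_]; rewrite rcons_uniq => /andP[].
    by move=> v; rewrite mem_rcons inE; case: eqP => //= ->; rewrite (negPf nYs).
  apply: fl.
  - apply/(pathP set0) => i; rewrite size_rcons => ilt.
    apply/forall_inP => x xL; apply/forall_inP => y yL; apply/implyP => xy.
    have := mono _ _ (moves_nth ilt xL yL xy).
    rewrite /f; case: i ilt xL yL => [|i] ilt xL yL /=; first by rewrite eqxx.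
    case: eqP => // E; move: uq => /= /andP[/negP[]].
    by rewrite -E mem_nth // size_rcons ltnW.
  - move=> L Ls x xL; have oL : is_orb Gam L.
      by have /allP := path_linked_orb pth; apply; rewrite mem_rcons inE Ls orbT.
    have LY : L != Y.
      apply: contraTneq Ls => ->; move: uq => /= /andP[_]; rewrite rcons_uniq.
      by case/andP.
    have LX : L != X.
      apply: contraTneq Ls => ->; move: uq => /= /andP[]; rewrite mem_rcons inE.
      by rewrite negb_or => /andP[].
    rewrite /f (negPf LX); apply: mono.
    have /eqP xE : orb x == L by rewrite -is_orbE.
    by rewrite /moves xE mem_rcons inE Ls orbT eqxx LY.
(* No vertex of Y may stay and no layer lies above Y, so nothing moves to Y. *)
have lY u : orb u = Y -> load sg (inl u) = 0.
  move=> uY; apply/eqP; rewrite sum_nat_eq0; apply/forallP => v /=.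
  rewrite eqb0; apply/negP => /eqP vu; have := adm v; rewrite vu /moves.
  case: ifP => [vs|vs /eqP[uv]]; last first.
    by rewrite -uv uY mem_rcons mem_head in vs.
  case/orP => [/andP[/eqP <-]|/and3P[_ _ /eqP lv]]; first by rewrite uY eqxx.
  by have := layer_le vs; rewrite lv (layerY uY) ltnn.
pose ex := \sum_(u | orb u != Y) (load sg (inl u)).-1.
(* A vertex without load has price 0 by [hi], and an overloaded one has price at least K by [lo]. *)
have hK : (K%:R * ex%:R + (\sum_(v | orb v != Y) p (inl v))%:R <=
           (\sum_u p (inl u) * load sg (inl u))%:R :> rat)%R.
  rewrite -natrM -natrD ler_nat [X in _ <= X](bigID (fun u => orb u != Y)) /=.
  apply: leq_trans (leq_addr _ _); rewrite /ex big_distrr -big_split /=.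
  apply: leq_sum => u _; have := hi (inl u); have := lo (inl u); rewrite /Delta /=.
  by case: (load sg (inl u)) => [|[|l]] /=; [|rewrite !muln0 muln1|]; nia.
have col_ineq : (\sum_c ((load sg (inr c))%:R ^+ 2 - color_share c ^+ 2 -
      (color_share c - (z c)%:R)) <=
      \sum_c (p (inr c))%:R * ((load sg (inr c))%:R - color_share c))%R.
  apply: ler_sum => c _; apply: price_square.
  - rewrite /color_share mulrAC ler_pdivlMr // -!natrM ler_nat [X in _ <= X]mulnC.
    exact: zle.
  - exact: (lo (inr c)).
  - exact: (hi (inr c)).
have total : (K%:R * ex%:R + \sum_c (load sg (inr c))%:R ^+ 2 <=
    \sum_c (color_share c ^+ 2 + (color_share c - (z c)%:R)))%R.
  move: flow; rewrite sum_load big_sumType /= natrD.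
  have -> : (t * (\sum_c p (inr c) * color_size c)%:R =
             \sum_c (p (inr c))%:R * color_share c)%R.
    rewrite natr_sum mulr_sumr; apply: eq_bigr => c _.
    by rewrite natrM mulrCA.
  have e1 : (\sum_c (p (inr c))%:R * ((load sg (inr c))%:R - color_share c) =
      (\sum_c p (inr c) * load sg (inr c))%:R - \sum_c (p (inr c))%:R * color_share c)%R.
    by rewrite natr_sum -sumrB; apply: eq_bigr => c _; rewrite natrM mulrBr.
  have e2 : (\sum_c ((load sg (inr c))%:R ^+ 2 - color_share c ^+ 2 -
        (color_share c - (z c)%:R)) = \sum_c (load sg (inr c))%:R ^+ 2 -
      \sum_c (color_share c ^+ 2 + (color_share c - (z c)%:R)))%R.
    by rewrite -sumrB; apply: eq_bigr => c _; ring.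
  move: col_ineq hK; rewrite e1 e2; lra.
(* A single collision would cost K, more than the bound [total] allows. *)
have ex0 : ex = 0.
  apply/eqP; rewrite -leqn0 leqNgt; apply/negP => ex1.
  have : (\sum_c (color_share c ^+ 2 + (color_share c - (z c)%:R)) < K%:R)%R.
    rewrite /K -natr1 natr_sum; rewrite -[X in (X < _)%R]addr0; apply: ler_ltD => //.
    apply: ler_sum => c _; rewrite natrD natrX natrM.
    have s0 : (0 <= color_share c)%R by rewrite /color_share mulr_ge0 ?divr_ge0 ?ler0n.
    have s1 : (color_share c <= (color_size c)%:R * #|Y|%:R)%R.
      rewrite /color_share mulrC ler_wpM2l // ler_pdivrMr // ler_peMr ?ler0n //.
      by rewrite ler1n (is_orb_gt0 orbX).
    have z0 : (0 <= (z c)%:R :> rat)%R by [].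
    by nra.
  have sq0 : (0 <= \sum_c (load sg (inr c))%:R ^+ 2 :> rat)%R.
    by apply: sumr_ge0 => c _; apply: sqr_ge0.
  have K0 : (0 <= K%:R :> rat)%R by [].
  have ex1' : (1 <= ex%:R :> rat)%R by rewrite ler1n.
  by move: total; nra.
exists sg; split=> //; last first.
  by move: total; rewrite ex0 mulr0 add0r.
move=> v v' u vu v'u; apply/eqP; apply: contraT => nv.
have l2 : 1 < load sg (inl u).
  rewrite /load (bigD1 v) //= vu eqxx (bigD1 v') 1?eq_sym //= v'u eqxx.
  by rewrite addnA ltn_addr.
have [uY|nuY] := eqVneq (orb u) Y; first by rewrite lY in l2.
move/eqP: ex0; rewrite sum_nat_eq0 => /forallP/(_ u)/implyP/(_ nuY).
by move: l2; clear; case: (load _ _) => [|[]].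
Qed.
End Transport.

(** * Coverings by connected classes *)

Lemma loadE (V R : finType) (s : {ffun V -> R}) r : load s r = #|[set v | s v == r]|.
Proof.
rewrite /load -sum1_card [RHS]big_mkcond /=; apply: eq_bigr => v _.
by rewrite inE; case: (s v == r).
Qed.

Section States.
Variable G : sgraph.
Implicit Types (M R X Y B : {set G}) (col : G -> G).

Definition color_class M col (c : G) : {set G} := [set u in M | col u == c].

Definition classes_connected M col : Prop := forall x y, x \in M -> y \in M ->
  col x = col y -> connect (induced (color_class M col (col x))) x y.

Definition touches M col (c b : G) : Prop := exists2 u, u \in color_class M col c & adj u b.

(** The number of ordered pairs of vertices of X with equal colours. *)
Definition energy X col : nat := \sum_c #|color_class X col c| ^ 2.

(* phi bounds the probability that two random vertices of X have the same colour. *)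
Definition covering R X B (phi : rat) : Prop := exists M, exists col,
  [/\ M \subset R /\ X \subset M, classes_connected M col,
      forall x b, x \in X -> b \in B -> touches M col (col x) b &
      ((energy X col)%:R <= phi * #|X|%:R ^+ 2)%R].

(* Used for Y disjoint from R: the vertices of Y border their classes only. *)
Definition attachment R Y B (phi : rat) : Prop := exists M, exists col,
  [/\ M \subset R, classes_connected M col,
      forall y, y \in Y -> exists2 u, u \in M & adj y u /\ col u = col y,
      forall y b, y \in Y -> b \in B -> touches M col (col y) b &
      ((energy Y col)%:R <= phi * #|Y|%:R ^+ 2)%R].

Lemma attachment_covering R Y B phi :
  attachment R Y B phi -> covering (R :|: Y) Y B phi.
Proof.
move=> [M [col [sMR cM att tch en]]]; exists (M :|: Y), col; split=> //.
- by rewrite subsetUr; split=> //; apply: setSU.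
- have sub c : color_class M col c \subset color_class (M :|: Y) col c.
    by apply/subsetP => u; rewrite !inE => /andP[-> ->].
  have down x : x \in M :|: Y -> exists2 u, u \in M &
      col u = col x /\ connect (induced (color_class (M :|: Y) col (col x))) x u.
    rewrite inE => /orP[xM|xY]; first by exists x.
    have [u uM [xu ux]] := att x xY; exists u => //; split=> //.
    by apply: connect1; rewrite /induced /= xu !inE uM xY orbT ux eqxx.
  move=> x y /down[u uM [ux cx]] /down[v vM [vy cy]] xy.
  apply: connect_trans cx _; rewrite connect_inducedC; rewrite -xy in cy.
  apply: connect_trans cy _; apply: connect_inducedS (sub _) _.
  by rewrite xy -vy; apply: cM; rewrite // ux vy xy.
- move=> y b yY bB; have [u] := tch y b yY bB; rewrite inE => /andP[uM uc] ub.
  by exists u; rewrite // inE uc inE uM.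
Qed.

Lemma coveringS R R' X B phi : R \subset R' -> covering R X B phi -> covering R' X B phi.
Proof.
move=> sRR [M [col [[sMR sXM] cM tch en]]]; exists M, col; split=> //; split=> //.
exact: subset_trans sRR.
Qed.

Lemma attachmentS R R' X B phi :
  R \subset R' -> attachment R X B phi -> attachment R' X B phi.
Proof.
move=> sRR [M [col [sMR cM tch en]]]; exists M, col; split=> //.
exact: subset_trans sRR.
Qed.

Lemma sum_color_class M col : \sum_c #|color_class M col c| = #|M|.
Proof.
rewrite -[RHS]sum1_card [RHS](partition_big col predT) //=; apply: eq_bigr => c _.
by rewrite -sum1_card; apply: eq_bigl => u; rewrite !inE.
Qed.

End States.

(** * Passing the classes on along a chain *)

Section Step.
Variables (G : sgraph) (Gam : {group {perm G}}).
Hypothesis GamAut : Gam \subset graph_aut G.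
Local Notation orb := (orb Gam).
Local Notation linked := (linked Gam).
Variables (X Y : {set G}) (s : seq {set G}).
Hypothesis pth : path linked X (rcons s Y).
Hypothesis uq : uniq (X :: rcons s Y).
Hypothesis sizeY : {in s, forall L : {set G}, #|Y| <= #|L|}.
Local Notation layer := (layer Gam X Y s).

Section Trace.
Variables (col : G -> G) (sg : {ffun G -> G + G}).
Hypothesis sg_moves : forall v, moves Gam X Y s col v (sg v).
Hypothesis sg_inj : forall v v' u, sg v = inl u -> sg v' = inl u -> v = v'.

Let step (r : G + G) : G + G := if r is inl v then sg v else r.

(** The colour in which the moves starting at v end. A proper move lowers the layer, so
    [(size s).+1] of them suffice; the default v is the value for a vertex that stays where it
    is. *)
Definition trace_color (v : G) : G :=
  if iter (size s).+1 step (inl v) is inr c then c else v.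

Let iter_inr n c : iter n step (inr c) = inr c.
Proof. by elim: n => //= n ->. Qed.

(** A trace that has left its first vertex cannot get stuck: by [sg_inj], a vertex that stays in
    place receives no other one. So the trace descends layer by layer until it reaches a colour. *)
Lemma trace_step v : orb v \in rcons s Y -> sg v != inl v ->
  (exists2 x, x \in X & [/\ adj v x, trace_color v = col x & sg v = inr (col x)]) \/
  (exists u, [/\ sg v = inl u, adj v u /\ orb u \in s, sg u != inl u,
                 layer v = (layer u).+1 & trace_color v = trace_color u]).
Proof.
have key n : forall v, layer v <= n -> orb v \in rcons s Y -> sg v != inl v ->
    (exists c, iter (layer v) step (inl v) = inr c) /\
    ((exists2 x, x \in X & [/\ adj v x, layer v = 1 & sg v = inr (col x)]) \/
     (exists u, [/\ sg v = inl u, adj v u /\ orb u \in s, sg u != inl u &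
                    layer v = (layer u).+1])).
  elim: n => [|n IH] {}v; first by move=> lv vs; move: lv; rewrite leqNgt (layer_gt0 uq vs).
  move=> lv vs nv; have := sg_moves v; rewrite /moves vs; case E: (sg v) => [u|c].
    have nuv : u != v by apply: contra nv => /eqP uv; rewrite E uv.
    rewrite (negPf nuv) /= => /and3P[uv us /eqP luv].
    have nuY : orb u != Y.
      apply/eqP => /(layerY uq) lu; have := layer_le X vs.
      by rewrite luv lu ltnn.
    have us' : orb u \in s by move: us; rewrite mem_rcons inE (negPf nuY).
    have nu : sg u != inl u.
      by apply: contra nuv => /eqP su; rewrite (sg_inj E su).
    have [|[c ic] _] := IH u _ us nu; first by rewrite -ltnS -luv.
    split; first by exists c; rewrite luv iterSr /= E.
    by right; exists u; rewrite adj_sym.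
  move=> /andP[/eqP l1 /existsP[x /and3P[xX xv /eqP xc]]].
  split; first by exists c; rewrite l1 /= E.
  by left; exists x; rewrite // adj_sym xc.
move=> vs nv; have [[c ic] alt] := key _ v (leqnn _) vs nv.
have traceE w d : layer w <= (size s).+1 -> iter (layer w) step (inl w) = inr d ->
    trace_color w = d.
  by move=> /subnK lw iw; rewrite /trace_color -lw iterD iw iter_inr.
have tv := traceE _ _ (layer_le X vs) ic.
case: alt => [[x xX [vx l1 sx]]|[u [su vu nu lv]]].
  left; exists x => //; split=> //; rewrite tv.
  by move: ic; rewrite l1 /= sx => -[].
right; exists u; split=> //; rewrite tv; apply/esym/traceE.
  by have := layer_le X vs; rewrite lv; apply: ltnW.
by move: ic; rewrite lv iterSr /= su.
Qed.

Lemma trace_Y y : orb y = Y -> sg y != inl y.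
Proof.
move=> yY; apply/eqP => sy; have := sg_moves y.
by rewrite sy /moves yY mem_rcons mem_head eqxx adj_irr eqxx.
Qed.

Definition walkers (i : nat) (c : G) : {set G} :=
  [set v | [&& layer v == i, orb v \in rcons s Y, sg v != inl v & trace_color v == c]].

(** Traces never merge, so those of colour c pass injectively from each layer to the one below, and
    in layer 1 their vertices move to c itself. *)
Lemma card_walkers i c : #|walkers i.+1 c| <= load sg (inr c).
Proof.
elim: i => [|i IH]; last apply: leq_trans IH.
  rewrite loadE; apply: subset_leq_card.
  apply/subsetP => v; rewrite !inE => /and4P[/eqP l1 vs nv /eqP tc].
  have [[x xX [_ xc ->]]|[u [_ [_ us] _ luv _]]] := trace_step vs nv.
    by rewrite -xc tc.
  have us' : orb u \in rcons s Y by rewrite mem_rcons inE us orbT.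
  by have := layer_gt0 uq us'; move: luv; rewrite l1 => -[<-].
pose nx v := if sg v is inl u then u else v.
have nxE v : v \in walkers i.+2 c -> sg v = inl (nx v) /\ nx v \in walkers i.+1 c.
  rewrite !inE => /and4P[/eqP lv vs nv /eqP tc].
  have [[x xX [_ _ sx]]|[u [su [_ us] nu luv tu]]] := trace_step vs nv.
    have := sg_moves v; rewrite sx /moves vs lv.
    by [].
  rewrite /nx su nu mem_rcons inE us orbT -tu tc eqxx !andbT; split=> //.
  by move: luv; rewrite lv => -[->].
rewrite -(@card_in_imset _ _ nx).
  by apply/subset_leq_card/subsetP => _ /imsetP[v /nxE[_ nv] ->].
by move=> v w /nxE[sv _] /nxE[sw _] E; apply: sg_inj sv _; rewrite E.
Qed.

End Trace.

(** A moving vertex takes the colour of its trace, and the trace is a path inside the enlarged class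
    down to X. By [card_walkers] the load of a colour bounds the number of vertices of Y that obtain
    it. *)
Lemma energy_attach (M R B : {set G}) (col : G -> G) (sg : {ffun G -> G + G}) :
  M \subset R -> X \subset M -> classes_connected M col ->
  (forall x b, x \in X -> b \in B -> touches M col (col x) b) ->
  {in rcons s Y, forall L : {set G}, [disjoint L & R]} ->
  (forall v, moves Gam X Y s col v (sg v)) ->
  (forall v v' u, sg v = inl u -> sg v' = inl u -> v = v') ->
  forall phi, ((\sum_c (load sg (inr c))%:R ^+ 2 <= phi * #|Y|%:R ^+ 2 :> rat))%R ->
  attachment (R :|: \bigcup_(L <- s) L) Y B phi.
Proof.
move=> sMR sXM cM tch dis adm inj phi en.
have orbs := path_linked_orb pth.
have orbE v L : L \in rcons s Y -> (v \in L) = (orb v == L).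
  by move=> Ls; apply: is_orbE; apply: (allP orbs).
have nM v : orb v \in rcons s Y -> v \notin M.
  move=> vs; apply: contraL (orb_refl Gam v) => vM.
  have /disjointFl -> // := dis _ vs.
  exact: (subsetP sMR).
pose tc := trace_color sg.
pose col' v := if v \in M then col v else tc v.
(* Vertices of the intermediate layers that stay in place join no class. *)
pose M' := M :|: [set v | (orb v \in s) && (sg v != inl v)].
have sub c : color_class M col c \subset color_class M' col' c.
  by apply/subsetP => u; rewrite !inE /col' => /andP[-> ->].
have one v : orb v \in rcons s Y -> sg v != inl v ->
    exists u, [/\ u \in M', adj v u, col' u = col' v &
      (u \in X) || ((layer u < layer v) && (orb u \in s) && (sg u != inl u))].
  move=> vs nv; have [[x xX [vx tx _]]|[u [su [vu us] nu luv tu]]] := trace_step adm inj vs nv.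
    exists x; rewrite xX; split=> //; first by rewrite inE (subsetP sXM).
    by rewrite /col' (subsetP sXM) // (negPf (nM v vs)) /tc tx.
  have us' : orb u \in rcons s Y by rewrite mem_rcons inE us orbT.
  exists u; split=> //; first by rewrite !inE us nu orbT.
    by rewrite /col' !(negPf (nM _ _)) // /tc tu.
  by rewrite luv ltnSn us nu orbT.
have root v : orb v \in s -> sg v != inl v -> exists2 x, x \in X &
    col' x = col' v /\ connect (induced (color_class M' col' (col' v))) v x.
  have [n] := ubnP (layer v); elim: n v => // n IH v ltn vs nv.
  have vs' : orb v \in rcons s Y by rewrite mem_rcons inE vs orbT.
  have vM' : v \in M' by rewrite !inE vs nv orbT.
  have [u [uM' vu cu alt]] := one v vs' nv.
  have c1 : connect (induced (color_class M' col' (col' v))) v u.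
    apply: connect1; rewrite /induced /= vu [v \in _]inE [u \in _]inE.
    by rewrite vM' uM' cu eqxx.
  case/orP: alt => [uX|/andP[/andP[lu us] nu]]; first by exists u.
  have [x xX [cx c2]] := IH u (leq_trans lu ltn) us nu.
  by exists x; rewrite // -cu; split=> //; apply: connect_trans c2; rewrite cu.
have down v : v \in M' -> exists2 x, x \in M &
    col' x = col' v /\ connect (induced (color_class M' col' (col' v))) v x.
  rewrite inE => /orP[vM|]; first by exists v.
  rewrite inE => /andP[vs nv]; have [x xX cx] := root v vs nv.
  by exists x; rewrite // (subsetP sXM).
have colM v : v \in M -> col' v = col v by rewrite /col' => ->.
have oY y : y \in Y -> orb y = Y.
  by rewrite (orbE y Y) ?mem_rcons ?mem_head // => /eqP.
have Ys y : y \in Y -> orb y \in rcons s Y by move/oY ->; rewrite mem_rcons mem_head.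
exists M', col'; split.
- rewrite subUset (subset_trans sMR) ?subsetUl //=; apply/subsetP => v.
  rewrite !inE => /andP[vs _]; apply/orP; right.
  by rewrite (big_rem _ vs) inE (orb_refl Gam v).
- move=> x y /down[u uM [ux cx]] /down[v vM [vy cy]] xy.
  apply: connect_trans cx _; rewrite connect_inducedC; rewrite -xy in cy.
  apply: connect_trans cy _; apply: connect_inducedS (sub _) _.
  by rewrite xy -vy colM //; apply: cM; rewrite // -!colM // ux vy xy.
- move=> y yY; have [u [uM' yu cu _]] := one y (Ys y yY) (trace_Y adm (oY y yY)).
  by exists u.
- move=> y b yY bB; have [u [uM' yu cu alt]] := one y (Ys y yY) (trace_Y adm (oY y yY)).
  have [x xX cx] : exists2 x, x \in X & col' x = col' y.
    case/orP: alt => [uX|/andP[/andP[_ us] nu]]; first by exists u.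
    by have [x xX [cx _]] := root u us nu; exists x; rewrite ?cx.
  have [w wc wb] := tch x b xX bB; exists w => //.
  by rewrite -cx colM ?(subsetP sXM) // (subsetP (sub _)).
- apply: le_trans en; rewrite /energy natr_sum; apply: ler_sum => c _.
  rewrite natrX lerXn2r ?nnegrE ?ler0n // ler_nat.
  apply: leq_trans (card_walkers adm inj (size s) c); apply: subset_leq_card.
  apply/subsetP => y; rewrite !inE => /andP[yY]; rewrite /col' (negPf (nM _ (Ys y yY))).
  by move=> ->; rewrite (layerY uq (oY y yY)) eqxx Ys // (trace_Y adm (oY y yY)).
Qed.

(** The two bounds are [transport] with z = 0 and with z = [color_size]. The first one costs 1 /
    |Y|. The second one adds |Y| - |X| to the energy, which is at most |Y|^2 (1 / |X| - 1 / |Y|), a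
    bound that telescopes along growing layers. *)
Lemma covering_attachment (R B : {set G}) (phi : rat) :
  {in rcons s Y, forall L : {set G}, [disjoint L & R]} ->
  covering R X B phi ->
  attachment (R :|: \bigcup_(L <- s) L) Y B (phi + #|Y|%:R^-1)%R /\
  (#|X| <= #|Y| ->
   attachment (R :|: \bigcup_(L <- s) L) Y B (phi + #|X|%:R^-1 - #|Y|%:R^-1)%R).
Proof.
move=> dis [M [col [[sMR sXM] cM tch en]]].
have orbs := path_linked_orb pth.
have Y0 : 0 < #|Y| by apply: (@is_orb_gt0 _ Gam); apply: (allP orbs); rewrite mem_rcons mem_head.
have X0 : 0 < #|X|.
  by apply: (@is_orb_gt0 _ Gam); move: pth; case: (s) => [|L t] /= /andP[/and3P[]].
have [x0 y0] : (0 < #|X|%:R :> rat)%R /\ (0 < #|Y|%:R :> rat)%R by rewrite !ltr0n.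
have share1 : (\sum_c color_share X Y col c = #|Y|%:R)%R.
  rewrite -mulr_sumr -natr_sum.
  have -> : \sum_c color_size X col c = #|X| by apply: sum_color_class.
  by rewrite mulfVK // gt_eqF.
have share2 : (\sum_c color_share X Y col c ^+ 2 <= phi * #|Y|%:R ^+ 2)%R.
  under eq_bigr => c _ do rewrite exprMn; rewrite -mulr_sumr.
  have -> : (\sum_c (color_size X col c)%:R ^+ 2 = (energy X col)%:R :> rat)%R.
    by rewrite natr_sum; apply: eq_bigr => c _; rewrite natrX.
  have -> : (phi * #|Y|%:R ^+ 2 = (#|Y|%:R / #|X|%:R) ^+ 2 * (phi * #|X|%:R ^+ 2))%R.
    by field; rewrite gt_eqF.
  by rewrite ler_wpM2l // sqr_ge0.
split=> [|leXY].
- have [c|sg [adm inj ens]] := transport GamAut pth uq sizeY (col := col) (z := fun=> 0).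
    by rewrite mul0n.
  apply: (energy_attach sMR sXM cM tch dis adm inj); apply: le_trans ens _.
  rewrite big_split /= sumrB share1 [X in (_ - X)%R]big1 // subr0.
  have -> : ((phi + #|Y|%:R^-1) * #|Y|%:R ^+ 2 = phi * #|Y|%:R ^+ 2 + #|Y|%:R)%R.
    by field; rewrite gt_eqF.
  by rewrite lerD2r.
- have [c|sg [adm inj ens]] := transport GamAut pth uq sizeY (col := col) (z := color_size X col).
    by rewrite leq_mul2l leXY orbT.
  apply: (energy_attach sMR sXM cM tch dis adm inj); apply: le_trans ens _.
  rewrite big_split /= sumrB share1 -natr_sum.
  have -> : \sum_c color_size X col c = #|X| by apply: sum_color_class.
  apply: (@le_trans _ _ (phi * #|Y|%:R ^+ 2 + (#|Y|%:R - #|X|%:R))%R).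
    by rewrite lerD2r.
  rewrite -(ler_nat rat) in leXY.
  have -> : ((phi + #|X|%:R^-1 - #|Y|%:R^-1) * #|Y|%:R ^+ 2 =
      phi * #|Y|%:R ^+ 2 + #|Y|%:R / #|X|%:R * (#|Y|%:R - #|X|%:R))%R.
    by field; rewrite !gt_eqF.
  by rewrite lerD2l ler_peMl ?subr_ge0 // ler_pdivlMr // mul1r.
Qed.

End Step.

Lemma split_min (T : eqType) (f : T -> nat) x s : exists s1 y s2,
  x :: s = s1 ++ y :: s2 /\ {in x :: s, forall z, f y <= f z}.
Proof.
elim: s x => [|z s IH] x.
  by exists [::], x, [::]; split=> // y; rewrite inE => /eqP ->.
have [s1 [y [s2 [E ymin]]]] := IH z.
have [xy|yx] := leqP (f x) (f y).
  exists [::], x, (z :: s); split=> // w; rewrite inE => /orP[/eqP ->//|ws].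
  exact: leq_trans xy (ymin w ws).
exists (x :: s1), y, s2; rewrite E; split=> // w; rewrite inE => /orP[/eqP ->|].
  exact: ltnW.
by rewrite -E; apply: ymin.
Qed.

Lemma ffun_pick_sub (T : finType) (f : T -> T) (S : {set T}) (u s : T) :
  {in S &, injective f} -> s \in S -> f s = f u ->
  odflt u [pick w in S | f w == f u] = s.
Proof.
move=> finj sS su; case: pickP => [w /andP[wS /eqP wu]|/(_ s)] /=.
  by apply: finj; rewrite // wu su.
by rewrite sS su eqxx.
Qed.

Lemma weighted_square (a b x y : rat) : (0 < a)%R -> (0 < b)%R ->
  ((x + y) ^+ 2 <= (a + b) * (x ^+ 2 / a + y ^+ 2 / b))%R.
Proof.
move=> a0 b0; rewrite -subr_ge0.
have -> : ((a + b) * (x ^+ 2 / a + y ^+ 2 / b) - (x + y) ^+ 2 =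
    (b * x - a * y) ^+ 2 / (a * b))%R by field; rewrite !gt_eqF.
by rewrite divr_ge0 ?sqr_ge0 // ltW // mulr_gt0.
Qed.

(** * Merging two coverings of the same orbit *)

Section Merge.
Variable G : sgraph.
Implicit Types (R Y B : {set G}).

(** A vertex y of Y is viewed as an edge between the colours [c1 y] and [c2 y], and S is a maximal
    matching. Each s in S becomes the colour of a new class that unites its two old classes, joined
    at s. By maximality every vertex of Y shares a colour with some s. The weights k1 and k2 enter
    through Cauchy-Schwarz. *)
Lemma merge_coverings R1 R2 Y B1 B2 (phi1 phi2 : rat) (k1 k2 : nat) :
  [disjoint R1 & R2] -> [disjoint Y & R2] -> 0 < k1 -> 0 < k2 ->
  covering R1 Y B1 phi1 -> attachment R2 Y B2 phi2 ->
  covering (R1 :|: R2) Y (B1 :|: B2)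
    ((k1 + k2)%:R * (phi1 / k1%:R + phi2 / k2%:R))%R.
Proof.
move=> dR dY k1_gt0 k2_gt0 [M1 [c1 [[sM1 sY] cM1 t1 e1]]] [M2 [c2 [sM2 cM2 att t2 e2]]].
pose ok (S : {set G}) := [&& S \subset Y, dinjectiveb c1 S & dinjectiveb c2 S].
have ok0 : ok set0.
  by rewrite /ok sub0set /=; apply/andP; split; apply/dinjectiveP => x y; rewrite inE.
have [S /maxsetP[/and3P[sSY /dinjectiveP i1 /dinjectiveP i2] maxS] _] := maxset_exists ok0.
have cover y : y \in Y -> [exists s in S, c1 s == c1 y] || [exists s in S, c2 s == c2 y].
  move=> yY; apply: contraT; rewrite negb_or !negb_exists_in => /andP[/forall_inP n1 /forall_inP n2].
  have yS : y \in S.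
    rewrite -(maxS (y |: S)) ?subsetUr ?setU11 //.
    apply/and3P; split; first by rewrite subUset sub1set yY.
      apply/dinjectiveP => u v; rewrite !inE => /orP[/eqP ->|uS] /orP[/eqP ->|vS] //.
      - by move=> E; have := n1 v vS; rewrite E eqxx.
      - by move=> E; have := n1 u uS; rewrite E eqxx.
      - exact: i1.
    apply/dinjectiveP => u v; rewrite !inE => /orP[/eqP ->|uS] /orP[/eqP ->|vS] //.
    - by move=> E; have := n2 v vS; rewrite E eqxx.
    - by move=> E; have := n2 u uS; rewrite E eqxx.
    - exact: i2.
  by have := n1 y yS; rewrite eqxx.
pose has1 u := (u \in M1) && [exists s in S, c1 s == c1 u].
(* Unlike [has1], this does not ask for membership in a class set: the vertices of Y lie outside M2
   but may take a colour through [c2]. *)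
pose has2 u := [exists s in S, c2 s == c2 u].
pose rep1 u := odflt u [pick w in S | c1 w == c1 u].
pose rep2 u := odflt u [pick w in S | c2 w == c2 u].
pose col u := if has1 u then rep1 u else rep2 u.
pose M := [set u in M1 | has1 u] :|: [set u in M2 | has2 u] :|: Y.
have nM12 u : u \in M2 -> u \notin M1.
  move=> uM2; apply/negP => /(subsetP sM1) uR1.
  by have := disjointFr dR uR1; rewrite (subsetP sM2).
have SM1 s : s \in S -> s \in M1 by move=> sS; rewrite (subsetP sY) // (subsetP sSY).
have col1 u s : u \in M1 -> s \in S -> c1 s = c1 u -> col u = s.
  move=> uM1 sS su; rewrite /col /has1 uM1 /=.
  have -> : [exists s in S, c1 s == c1 u] by apply/exists_inP; exists s; rewrite ?su.
  exact: ffun_pick_sub.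
have col2 u s : ~~ has1 u -> s \in S -> c2 s = c2 u -> col u = s.
  by move=> /negPf n1 sS su; rewrite /col n1; apply: ffun_pick_sub.
have colS s : s \in S -> col s = s by move=> sS; apply: col1; rewrite ?SM1.
have cl1 s : s \in S -> color_class M1 c1 (c1 s) \subset color_class M col s.
  move=> sS; apply/subsetP => u; rewrite !inE => /andP[uM1 /eqP us].
  rewrite (col1 u s) ?us // eqxx andbT uM1 /has1 uM1 /=.
  by have -> : [exists s in S, c1 s == c1 u] by apply/exists_inP; exists s; rewrite ?us.
have cl2 s : s \in S -> color_class M2 c2 (c2 s) \subset color_class M col s.
  move=> sS; apply/subsetP => u; rewrite !inE => /andP[uM2 /eqP us].
  rewrite (col2 u s) ?us ?/has1 ?(negPf (nM12 u uM2)) // eqxx andbT uM2 /has2 /=.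
  by have -> : [exists s in S, c2 s == c2 u] by apply/exists_inP; exists s; rewrite ?us.
have MY y : y \in Y -> y \in M by move=> yY; rewrite !inE yY orbT.
have toS2 u s : u \in M2 -> s \in S -> c2 s = c2 u ->
    connect (induced (color_class M col s)) u s.
  move=> uM2 sS su; have sYs := subsetP sSY s sS.
  have [w wM2 [sw ws]] := att s sYs.
  apply: (@connect_trans _ _ w).
    by apply: connect_inducedS (cl2 s sS) _; rewrite su; apply: cM2; rewrite // ws.
  apply: connect1; rewrite /induced /= adj_sym sw (subsetP (cl2 s sS)).
    by rewrite inE MY // colS ?eqxx.
  by rewrite inE wM2 ws /=.
have toS u : u \in M -> exists2 s, s \in S &
    col u = s /\ connect (induced (color_class M col s)) u s.
  move=> uM; have [/andP[uM1 /exists_inP[s sS /eqP su]]|n1] := boolP (has1 u).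
    exists s => //; split; first exact: col1.
    by apply: connect_inducedS (cl1 s sS) _; rewrite su; apply: cM1 => //; apply: SM1.
  have {}uM : (u \in M2) && has2 u || (u \in Y).
    by move: uM; rewrite !inE (negPf n1) andbF.
  have /exists_inP[s sS /eqP su] : has2 u.
    case/orP: uM => [/andP[]//|uY]; case/orP: (cover u uY) => // h1.
    by rewrite /has1 h1 (subsetP sY) in n1.
  exists s => //; have cu := col2 u s n1 sS su; split=> //.
  case/orP: uM => [/andP[uM2 _]|uY]; first exact: toS2.
  have [w wM2 [uw wu]] := att u uY.
  apply: (@connect_trans _ _ w); last by apply: toS2; rewrite // wu.
  apply: connect1; rewrite /induced /= uw inE MY // cu eqxx /=.
  by apply: (subsetP (cl2 s sS)); rewrite inE wM2 wu su /=.
exists M, col; split.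
- split; last by apply/subsetP => y; apply: MY.
  apply/subsetP => u; rewrite !inE => /orP[/orP[]/andP[uM _]|uY].
  + by rewrite (subsetP sM1).
  + by rewrite (subsetP sM2) ?orbT.
  + by rewrite (subsetP sM1) // (subsetP sY).
- move=> u v /toS[s sS [-> cu]] /toS[s' sS' [-> cv]] ss.
  by apply: connect_trans cu _; rewrite connect_inducedC ss.
- move=> y b yY; have [s sS [-> _]] := toS y (MY y yY).
  have sYs := subsetP sSY s sS.
  rewrite inE => /orP[bB|bB].
    by have [u uc ub] := t1 s b sYs bB; exists u; rewrite ?(subsetP (cl1 s sS)).
  by have [u uc ub] := t2 s b sYs bB; exists u; rewrite ?(subsetP (cl2 s sS)).
pose x1 c := #|color_class Y c1 c|; pose x2 c := #|color_class Y c2 c|.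
(* A vertex of Y with new colour s agrees with s under [c1] or under [c2]. *)
have en : energy Y col <= \sum_(s in S) (x1 (c1 s) + x2 (c2 s)) ^ 2.
  rewrite /energy (bigID (mem S)) /= [X in _ + X]big1 ?addn0 => [|c ncS]; last first.
    apply/eqP; rewrite expn_eq0 cards_eq0 andbT; apply: contraT => /set0Pn[y].
    rewrite inE => /andP[yY /eqP yc]; have [s sS [ys _]] := toS y (MY y yY).
    by rewrite -yc ys sS in ncS.
  apply: leq_sum => s sS; rewrite leq_exp2r //; apply: leq_trans (leq_card_setU _ _).
  apply/subset_leq_card/subsetP => y; rewrite !inE => /andP[yY]; rewrite yY /=.
  rewrite /col; case: ifP => [/andP[_ /exists_inP[s' sS' /eqP s'y]]|n1].
    by rewrite /rep1 (ffun_pick_sub i1 sS' s'y) => /eqP <-; rewrite s'y eqxx.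
  have /exists_inP[s' sS' /eqP s'y] : has2 y.
    by case/orP: (cover y yY) => // h1; rewrite /has1 h1 (subsetP sY) in n1.
  by rewrite /rep2 (ffun_pick_sub i2 sS' s'y) => /eqP <-; rewrite s'y eqxx orbT.
have imE (c : G -> G) (x : G -> nat) : {in S &, injective c} ->
    \sum_(s in S) x (c s) ^ 2 <= \sum_c x c ^ 2.
  move=> ci; rewrite -(big_imset (fun d => x d ^ 2) ci) /=.
  by rewrite [X in _ <= X](bigID (mem (c @: S))) /= leq_addr.
have E1 := imE c1 x1 i1; have E2 := imE c2 x2 i2.
have {}e1 : ((\sum_(s in S) x1 (c1 s) ^ 2)%:R <= phi1 * #|Y|%:R ^+ 2)%R.
  by apply: le_trans e1; rewrite ler_nat.
have {}e2 : ((\sum_(s in S) x2 (c2 s) ^ 2)%:R <= phi2 * #|Y|%:R ^+ 2)%R.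
  by apply: le_trans e2; rewrite ler_nat.
have [p1 p2] : (0 < k1%:R :> rat)%R /\ (0 < k2%:R :> rat)%R by rewrite !ltr0n.
apply: (@le_trans _ _ ((k1 + k2)%:R *
   ((\sum_(s in S) x1 (c1 s) ^ 2)%:R / k1%:R + (\sum_(s in S) x2 (c2 s) ^ 2)%:R / k2%:R))%R).
  apply: (@le_trans _ _ ((\sum_(s in S) (x1 (c1 s) + x2 (c2 s)) ^ 2)%:R)%R).
    by rewrite ler_nat.
  rewrite !natr_sum !mulr_suml -big_split mulr_sumr /=; apply: ler_sum => s _.
  by rewrite !natrX !natrD; apply: weighted_square.
rewrite -mulrA ler_wpM2l ?ler0n // mulrDl ![(_ / _ * _ ^+ 2)%R]mulrAC.
by rewrite lerD // ler_wpM2r // invr_ge0 ltW.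
Qed.

End Merge.

Lemma disjoint_setUr (T : finType) (L A C : {set T}) :
  [disjoint L & A :|: C] = [disjoint L & A] && [disjoint L & C].
Proof. by rewrite -!setI_eq0 setIUr setU_eq0. Qed.

(** * Chains of orbits of varying sizes *)

Section Packing.
Variables (G : sgraph) (Gam : {group {perm G}}).
Hypothesis GamAut : Gam \subset graph_aut G.
Local Notation orb := (orb Gam).
Local Notation linked := (linked Gam).
Local Notation is_orb := (is_orb Gam).

Lemma orb_disjoint A C : is_orb A -> is_orb C -> A != C -> [disjoint A & C].
Proof.
move=> oA oC; apply: contraR; rewrite -setI_eq0 => /set0Pn[x].
by rewrite inE (is_orbE _ oA) (is_orbE _ oC) => /andP[/eqP <- /eqP ->].
Qed.

Lemma covering_le (R X B : {set G}) (phi psi : rat) :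
  (phi <= psi)%R -> covering R X B phi -> covering R X B psi.
Proof.
move=> le [M [col [sMR cM tch en]]]; exists M, col; split=> //.
by apply: le_trans en _; rewrite ler_wpM2r ?sqr_ge0.
Qed.

Lemma bigcup_seq_disjoint (s : seq {set G}) (L : {set G}) :
  is_orb L -> all is_orb s -> L \notin s -> [disjoint L & \bigcup_(A <- s) A].
Proof.
move=> oL; elim: s => [|A s IH] /=; first by rewrite big_nil -setI_eq0 setI0.
move=> /andP[oA os]; rewrite inE negb_or => /andP[LA Ls].
by rewrite big_cons disjoint_setUr orb_disjoint ?IH.
Qed.

(** One hops from X to a smallest layer L among the remaining ones and continues from L. The layers
    skipped by a hop are at least as large as its end, and the errors 1 / |X| - 1 / |L| of the hops
    telescope. *)
Lemma chain_up (R X Y B : {set G}) (s : seq {set G}) (phi : rat) :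
  path linked X (rcons s Y) -> uniq (X :: rcons s Y) ->
  {in rcons s Y, forall L : {set G}, #|X| <= #|L|} ->
  {in rcons s Y, forall L : {set G}, [disjoint L & R]} ->
  covering R X B phi ->
  attachment (R :|: \bigcup_(L <- s) L) Y B (phi + #|X|%:R^-1 - #|Y|%:R^-1)%R.
Proof.
have [n] := ubnP (size s); elim: n R X s phi => // n IH R X s phi ltn pth uq szX dis cov.
have [L0 [s0 E0]] : exists L0 s0, rcons s Y = L0 :: s0.
  by case: (s) => [|L t]; [exists Y, [::]|exists L, (rcons t Y)].
have [s1 [L [s2 [E minL]]]] := split_min (fun L : {set G} => #|L|) L0 s0.
rewrite -E0 in E minL.
case/lastP: s2 => [|t Y'] in E *.
  rewrite cats1 in E; have [es eY] := rcons_inj E; move: minL; rewrite -eY => minL.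
  have [|_] := covering_attachment GamAut pth uq _ dis cov.
    by move=> A As; apply: minL; rewrite mem_rcons inE As orbT.
  by apply; apply: szX; rewrite mem_rcons mem_head.
have [es eY] : s = s1 ++ L :: t /\ Y = Y'.
  have /rcons_inj[-> ->] // : rcons s Y = rcons (s1 ++ L :: t) Y'.
  by rewrite E -rcons_cons -rcons_cat.
have oall := path_linked_orb pth.
have LY : L \in rcons s Y by rewrite E mem_cat mem_head orbT.
have s1Y A : A \in s1 -> A \in rcons s Y by move=> As; rewrite E mem_cat As.
have tY A : A \in rcons t Y -> A \in rcons s Y.
  by move=> At; rewrite E -eY mem_cat inE At !orbT.
move: pth uq; rewrite E -cat_rcons -eY cat_path last_rcons => /andP[pth1 pth2].
rewrite -cat_cons cat_uniq => /and3P[uq1 /hasPn nuq uq2].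
have [||_] := @covering_attachment _ _ GamAut X L s1 pth1 uq1 _ R B phi _ cov.
- by move=> A As; apply: minL; apply: s1Y.
- by move=> A; rewrite mem_rcons inE => /orP[/eqP ->|/s1Y]; apply: dis.
move=> /(_ (szX L LY)) /attachment_covering cov1.
have nuq' A : A \in rcons t Y -> A \notin s1 /\ A != L.
  by move/nuq; rewrite inE mem_rcons inE !negb_or => /and3P[].
have -> : (phi + #|X|%:R^-1 - #|Y|%:R^-1 =
           (phi + #|X|%:R^-1 - #|L|%:R^-1) + #|L|%:R^-1 - #|Y|%:R^-1 :> rat)%R by ring.
apply: attachmentS (IH _ L t _ _ pth2 _ _ _ cov1).
- rewrite es -cat_rcons big_cat big_rcons /=.
  by apply/subsetP => x; rewrite !inE -!orbA (orbC (x \in L)) .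
- by move: ltn; rewrite es size_cat /= addnS ltnS => /(leq_trans _); apply; rewrite ltnS leq_addl.
- by rewrite /= uq2 andbT; apply/negP => /nuq'[_]; rewrite eqxx.
- by move=> A /tY; apply: minL.
- move=> A At; have [As AL] := nuq' A At; have oA := allP oall A (tY A At).
  rewrite !disjoint_setUr dis ?tY // (orb_disjoint oA (allP oall L LY) AL) andbT.
  by rewrite bigcup_seq_disjoint //; apply/allP => C /s1Y /(allP oall).
Qed.

(** The first hop goes to a smallest layer L after X and costs 1 / |L|. From there [chain_up] costs
    1 / |L| - 1 / |Y|, so the total is at most 2 / d, however long the chain is. *)
Lemma chain (R X Y B : {set G}) (s : seq {set G}) (phi : rat) (d : nat) :
  0 < d -> path linked X (rcons s Y) -> uniq (X :: rcons s Y) ->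
  {in rcons s Y, forall L : {set G}, d <= #|L|} ->
  {in rcons s Y, forall L : {set G}, [disjoint L & R]} ->
  covering R X B phi ->
  attachment (R :|: \bigcup_(L <- s) L) Y B (phi + 2 / d%:R)%R.
Proof.
move=> d0 pth uq szd dis cov.
have dV (L : {set G}) : L \in rcons s Y -> (#|L|%:R^-1 <= d%:R^-1 :> rat)%R.
  by move=> /szd dL; rewrite lef_pV2 ?posrE ?ltr0n ?ler_nat // (leq_trans d0).
have two_d : (2 / d%:R = d%:R^-1 + d%:R^-1 :> rat)%R by ring.
have [L0 [s0 E0]] : exists L0 s0, rcons s Y = L0 :: s0.
  by case: (s) => [|L t]; [exists Y, [::]|exists L, (rcons t Y)].
have [s1 [L [s2 [E minL]]]] := split_min (fun L : {set G} => #|L|) L0 s0.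
rewrite -E0 in E minL.
case/lastP: s2 => [|t Y'] in E *.
  rewrite cats1 in E; have [es eY] := rcons_inj E; move: minL; rewrite -eY => minL.
  have [|att _] := covering_attachment GamAut pth uq _ dis cov.
    by move=> A As; apply: minL; rewrite mem_rcons inE As orbT.
  move: att => [M [col [sMR cM at1 tch en]]]; exists M, col; split=> //.
  apply: le_trans en _; rewrite ler_wpM2r ?sqr_ge0 // lerD2l two_d.
  by rewrite -[X in (X <= _)%R]addr0 lerD ?dV ?mem_rcons ?mem_head // invr_ge0 ler0n.
have [es eY] : s = s1 ++ L :: t /\ Y = Y'.
  have /rcons_inj[-> ->] // : rcons s Y = rcons (s1 ++ L :: t) Y'.
  by rewrite E -rcons_cons -rcons_cat.
have oall := path_linked_orb pth.
have LY : L \in rcons s Y by rewrite E mem_cat mem_head orbT.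
have s1Y A : A \in s1 -> A \in rcons s Y by move=> As; rewrite E mem_cat As.
have tY A : A \in rcons t Y -> A \in rcons s Y.
  by move=> At; rewrite E -eY mem_cat inE At !orbT.
move: pth uq; rewrite E -cat_rcons -eY cat_path last_rcons => /andP[pth1 pth2].
rewrite -cat_cons cat_uniq => /and3P[uq1 /hasPn nuq uq2].
have [||/attachment_covering cov1 _] :=
  @covering_attachment _ _ GamAut X L s1 pth1 uq1 _ R B phi _ cov.
- by move=> A As; apply: minL; apply: s1Y.
- by move=> A; rewrite mem_rcons inE => /orP[/eqP ->|/s1Y]; apply: dis.
have nuq' A : A \in rcons t Y -> A \notin s1 /\ A != L.
  by move/nuq; rewrite inE mem_rcons inE !negb_or => /and3P[].
have [|||M [col [sMR cM at1 tch en]]] := @chain_up _ L Y B t _ pth2 _ _ _ cov1.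
- by rewrite /= uq2 andbT; apply/negP => /nuq'[_]; rewrite eqxx.
- by move=> A /tY; apply: minL.
- move=> A At; have [As AL] := nuq' A At; have oA := allP oall A (tY A At).
  rewrite !disjoint_setUr dis ?tY // (orb_disjoint oA (allP oall L LY) AL) andbT.
  by rewrite bigcup_seq_disjoint //; apply/allP => C /s1Y /(allP oall).
exists M, col; split=> //.
  apply: subset_trans sMR _; rewrite es -cat_rcons big_cat big_rcons /=.
  by apply/subsetP => x; rewrite !inE -!orbA (orbC (x \in L)).
apply: le_trans en _; rewrite ler_wpM2r ?sqr_ge0 //.
have y0 : (0 <= #|Y|%:R^-1 :> rat)%R by rewrite invr_ge0.
by have := dV L LY; rewrite two_d; lra.
Qed.

End Packing.

(** * Packing connected sets *)

Section Packing.
Variables (G : sgraph) (Gam : {group {perm G}}).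
Hypothesis GamAut : Gam \subset graph_aut G.
Local Notation orb := (orb Gam).
Local Notation linked := (linked Gam).
Local Notation is_orb := (is_orb Gam).

(** Edges inside an orbit are dropped, as an [sgraph] has no loops. *)
Definition quotient_rel : rel {set G} := [rel A C | linked A C && (A != C)].

Lemma quotient_rel_sym : symmetric quotient_rel.
Proof. by move=> A C; rewrite /quotient_rel /= linked_sym eq_sym. Qed.

Lemma quotient_rel_irr : irreflexive quotient_rel.
Proof. by move=> A; rewrite /quotient_rel /= eqxx andbF. Qed.

Definition quotient_graph : sgraph := SGraph quotient_rel_sym quotient_rel_irr.
Local Notation Q := quotient_graph.

Implicit Types (O K : {set Q}).

Lemma cover_disjoint O K : {in O :|: K, forall A, is_orb A} ->
  [disjoint O & K] -> [disjoint cover O & cover K].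
Proof.
move=> orbs dis; rewrite -setI_eq0; apply: contraT => /set0Pn[x].
rewrite inE => /andP[/bigcupP[A AO xA] /bigcupP[C CK xC]].
have oA : is_orb A by apply: orbs; rewrite inE AO.
have oC : is_orb C by apply: orbs; rewrite inE CK orbT.
move: xA xC; rewrite (is_orbE _ oA) (is_orbE _ oC) => /eqP xA /eqP xC.
by move: CK; rewrite -xC xA (disjointFr dis AO).
Qed.

Lemma coverS O K : O \subset K -> cover O \subset cover K.
Proof. by move=> sOK; apply/bigcupsP => A AO; apply: bigcup_sup; apply: (subsetP sOK). Qed.

Lemma cover_bigcup (s : seq {set G}) O : {subset s <= O} ->
  \bigcup_(A <- s) A \subset cover O.
Proof.
elim: s => [|A s IH] sO; first by rewrite big_nil sub0set.
rewrite big_cons subUset IH ?andbT => [|C Cs]; last by apply: sO; rewrite inE Cs orbT.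
by apply: (bigcup_sup A); rewrite // sO ?mem_head.
Qed.

(* The bound on phi allows for an error 2 / d per chain and is stable under merging:
   if k = k1 + k2, then k ((4 k1^2 - 1) / k1 + (4 k2^2 - 1) / k2) <= 4 k^2 - 4. *)
Definition reaches (d : nat) O (Y B : {set G}) : Prop :=
  exists (X : {set G}) (s : seq {set G}) (P : {set Q}) (phi : rat),
    [/\ path linked X s /\ last X s = Y, uniq (X :: s) /\ X \in O,
        {subset s <= O} /\ {in s, forall L, L \notin P}, P \subset O &
        covering (cover P) X B phi /\ (phi <= (4 * #|B|%:R ^+ 2 - 3) / d%:R :> rat)%R].

(** Running the pending chain costs 2 / d, which turns the -3 of [reaches] into -1. *)
Lemma reaches_covering d O Y B : 0 < d ->
  {in O, forall A, is_orb A /\ d <= #|A|} -> reaches d O Y B ->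
  covering (cover O) Y B ((4 * #|B|%:R ^+ 2 - 1) / d%:R :> rat)%R.
Proof.
move=> d0 orbs [X [s [P [phi [[pth lst] [uq XO] [sO sP] sPO [cov le]]]]]].
have d0' : (0 < d%:R :> rat)%R by rewrite ltr0n.
have le' : (phi + 2 / d%:R <= (4 * #|B|%:R ^+ 2 - 1) / d%:R)%R.
  apply: le_trans (lerD le (lexx _)) _; rewrite -mulrDl ler_pM2r ?invr_gt0 //.
  by lra.
have phi' : (phi <= phi + 2 / d%:R)%R by rewrite lerDl divr_ge0.
case/lastP: s pth lst uq sO sP => [|s Y'] /=.
  move=> _ <- _ _ _; apply: coveringS (coverS sPO) _.
  by apply: covering_le cov; apply: le_trans phi' le'.
rewrite last_rcons => pth <- uq sO sP.
have szd : {in rcons s Y', forall L : {set G}, d <= #|L|} by move=> L /sO/orbs[].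
have dis : {in rcons s Y', forall L : {set G}, [disjoint L & cover P]}.
  move=> L Ls; have [oL _] := orbs L (sO L Ls).
  rewrite -[L](@cover1 _ L); apply: cover_disjoint.
    by move=> A; rewrite !inE => /orP[/eqP ->//|/(subsetP sPO)/orbs[]].
  by rewrite disjoints1 sP.
have /attachment_covering cY := chain GamAut d0 pth uq szd dis cov.
apply: covering_le le' _; apply: coveringS cY.
rewrite !subUset coverS //= cover_bigcup; last by move=> A As; apply: sO; rewrite mem_rcons inE As orbT.
by apply: (bigcup_sup Y'); rewrite // sO // mem_rcons mem_head.
Qed.

(** The pending chain is first prolonged from C to Y and only then run, so that the way to Y costs 2
    / d only once. *)
Lemma reaches_attachment d O K Y (C : Q) B : 0 < d ->
  {in O, forall A, is_orb A /\ d <= #|A|} -> Y \in O -> K \subset O -> Y \notin K ->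
  linked C Y -> reaches d K C B ->
  attachment (cover K) Y B ((4 * #|B|%:R ^+ 2 - 1) / d%:R :> rat)%R.
Proof.
move=> d0 orbs YO sKO YK CY [X [s [P [phi [[pth lst] [uq XK] [sK sP] sPK [cov le]]]]]].
have d0' : (0 < d%:R :> rat)%R by rewrite ltr0n.
have le' : (phi + 2 / d%:R <= (4 * #|B|%:R ^+ 2 - 1) / d%:R)%R.
  apply: le_trans (lerD le (lexx _)) _; rewrite -mulrDl ler_pM2r ?invr_gt0 //.
  by lra.
have inO L : L \in rcons s Y -> L \in O.
  by rewrite mem_rcons inE => /orP[/eqP ->//|/sK]; apply: (subsetP sKO).
have pth' : path linked X (rcons s Y) by rewrite rcons_path pth lst.
have uq' : uniq (X :: rcons s Y).
  rewrite -rcons_cons rcons_uniq uq andbT inE negb_or.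
  rewrite (contraNneq _ YK) => [|->//] /=; apply: contra YK; exact: sK.
have szd : {in rcons s Y, forall L : {set G}, d <= #|L|} by move=> L /inO/orbs[].
have dis : {in rcons s Y, forall L : {set G}, [disjoint L & cover P]}.
  move=> L Ls; have [oL _] := orbs L (inO L Ls).
  rewrite -[L](@cover1 _ L); apply: cover_disjoint.
    by move=> A; rewrite !inE => /orP[/eqP ->//|/(subsetP sPK)/(subsetP sKO)/orbs[]].
  rewrite disjoints1; move: Ls; rewrite mem_rcons inE => /orP[/eqP ->|/sP //].
  by apply: contra YK; apply: (subsetP sPK).
have [M [col [sMR cM att tch en]]] := chain GamAut d0 pth' uq' szd dis cov.
exists M, col; split=> //.
  by apply: subset_trans sMR _; rewrite subUset coverS //= cover_bigcup.
by apply: le_trans en _; rewrite ler_wpM2r ?sqr_ge0.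
Qed.

(** The induction takes a component K of [O :\ Y] to which some b is attached, and descends into K
    and into the remaining orbits, as along a tree with root Y. *)
Lemma reaches_all d O Y B (att : G -> Q) : 0 < d ->
  {in O, forall A, is_orb A /\ d <= #|A|} -> Y \in O -> B != set0 ->
  {in B, forall b, connect (induced O) (att b) Y /\ {in att b, forall u, adj u b}} ->
  reaches d O Y B.
Proof.
move=> d0; have [n] := ubnP #|O|; elim: n O Y B => // n IH O Y B ltn orbs YO B0 attB.
have d0' : (0 < d%:R :> rat)%R by rewrite ltr0n.
have cardB (D : {set G}) : D != set0 -> (1 <= #|D|%:R :> rat)%R.
  by rewrite -card_gt0 ler1n.
have [oY dY] := orbs Y YO.
have attO b : b \in B -> att b \in O.
  by move=> /attB[/connect_induced_inr cb _]; apply: cb.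
have [/forall_inP allY|] := boolP [forall b in B, att b == Y].
  (* Every vertex of Y is a class of its own, so two random ones agree with probability 1 / |Y|. *)
  exists Y, [::], O, (#|Y|%:R^-1)%R; split=> //; split; last first.
    apply: (@le_trans _ _ (1 / d%:R)%R).
      by rewrite div1r lef_pV2 ?posrE ?ltr0n ?ler_nat // (leq_trans d0).
    by rewrite ler_pM2r ?invr_gt0 //; have := cardB B B0; nra.
  exists Y, id; split=> //.
  - by split=> //; apply: (bigcup_sup Y).
  - by move=> x y _ _ ->; apply: connect0.
  - move=> x b xY bB; exists x; first by rewrite inE xY eqxx.
    by have [_ ] := attB b bB; apply; rewrite (eqP (allY b bB)).
  - have -> : energy Y id = #|Y|.
      rewrite /energy -[RHS](sum_color_class Y id); apply: eq_bigr => c _.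
      suff : #|color_class Y id c| <= 1 by case: #|_| => [|[]].
      rewrite -(cards1 c); apply/subset_leq_card/subsetP => u.
      by rewrite !inE => /andP[].
    rewrite expr2 mulrA mulVf ?mul1r // pnatr_eq0 -lt0n.
    exact: leq_trans d0 dY.
rewrite negb_forall_in => /exists_inP[b0 b0B nb0].
pose K := component (O :\ Y) (att b0).
have A0 : att b0 \in O :\ Y by rewrite !inE nb0 attO.
have sKO : K \subset O :\ Y := comp_sub A0.
have sKO' : K \subset O := subset_trans sKO (subsetDl _ _).
have YK : Y \notin K by apply/negP => /(subsetP sKO); rewrite !inE eqxx.
have [C YC CK] : exists2 C : Q, adj Y C & C \in K.
  have [cb _] := attB b0 b0B; rewrite connect_inducedC in cb.
  have nY : Y != att b0 by rewrite eq_sym.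
  have [C YC /andP[_ cC]] := connect_first_step cb nY.
  by exists C; rewrite // inE connect_inducedC.
have CY : linked C Y by rewrite linked_sym; case/andP: YC.
have ltK : #|K| < n.
  rewrite -ltnS; apply: leq_trans ltn; rewrite ltnS (cardsD1 Y O) YO ltnS.
  exact: subset_leq_card.
pose BK := [set b in B | att b \in K].
have BK0 : BK != set0 by apply/set0Pn; exists b0; rewrite inE b0B comp_refl.
have rK : reaches d K C BK.
  apply: IH => //; first by move=> A /(subsetP sKO')/orbs.
  move=> b; rewrite inE => /andP[bB bK]; have [_ ab] := attB b bB.
  by split=> //; apply: connect_comp.
(* If all of B is attached within K, the chain is only prolonged by Y and phi does not change.
   Otherwise the classes from K and those from the other orbits are merged on Y. *)
have [B'0|B'0] := eqVneq (B :\: BK) set0.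
  have eB : BK = B.
    apply/eqP; rewrite eqEsubset -[X in _ && X]setD_eq0 B'0 eqxx andbT.
    by apply/subsetP => b; rewrite inE => /andP[].
  rewrite -eB; have [X [s [P [phi [[pth lst] [uq XK] [sK sP] sPK cov]]]]] := rK.
  exists X, (rcons s Y), P, phi; split=> //.
  - by rewrite rcons_path pth lst last_rcons.
  - rewrite -rcons_cons rcons_uniq uq andbT inE negb_or (subsetP sKO') //; split=> //.
    rewrite (contraNneq _ YK) => [|->//] /=; apply: contra YK; exact: sK.
  - split=> L; rewrite mem_rcons inE => /orP[/eqP ->|Ls] //.
    + exact: (subsetP sKO') (sK _ Ls).
    + by apply: contra YK; apply: (subsetP sPK).
    + exact: sP.
  - exact: subset_trans sKO'.
have sub' : O :\: K \subset O := subsetDl _ _.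
have r' : reaches d (O :\: K) Y (B :\: BK).
  apply: IH => //.
  - rewrite -ltnS; apply: leq_trans ltn; rewrite ltnS; apply: proper_card.
    rewrite properEneq sub' andbT; apply/eqP => E.
    by have := attO b0 b0B; rewrite -E inE comp_refl.
  - by move=> A /(subsetP sub')/orbs.
  - by rewrite inE YK.
  move=> b; rewrite inE => /andP[nbK bB]; have [cb ab] := attB b bB; split=> //.
  rewrite inE bB /= in nbK.
  have [->|nbY] := eqVneq (att b) Y; first exact: connect0.
  have nY : Y != att b by rewrite eq_sym.
  rewrite connect_inducedC in cb.
  have [D YD /andP[DO cD]] := connect_first_step cb nY.
  have DOY : D \in O :\ Y by rewrite !inE DO andbT; apply: contraTneq YD => ->; rewrite adj_irr.
  have DK : component (O :\ Y) D \subset O :\: K.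
    apply/subsetP => E ED; rewrite inE (subsetP (subsetDl O [set Y])) ?andbT; last first.
      exact: (subsetP (comp_sub DOY)).
    apply: contra nbK => EK; rewrite /K (comp_eq EK) -(comp_eq ED).
    by rewrite inE.
  rewrite connect_inducedC; apply: (@connect_trans _ _ D).
    apply: connect1; apply/and3P; split; first exact: YD.
      by rewrite inE YK YO.
    by rewrite (subsetP DK) ?comp_refl.
  by apply: connect_inducedS DK _; apply: connect_comp; rewrite ?comp_refl // inE.
have cov1 := reaches_covering d0 (fun A AO => orbs A (subsetP sub' A AO)) r'.
have cov2 := reaches_attachment d0 orbs YO sKO' YK CY rK.
have orbOK : {in (O :\: K) :|: K, forall A, is_orb A}.
  by move=> A; rewrite inE => /orP[/(subsetP sub')|/(subsetP sKO')] /orbs[].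
have dis1 : [disjoint cover (O :\: K) & cover K].
  by apply: cover_disjoint => //; rewrite -setI_eq0 setDE -setIA [~: K :&: K]setIC setICr setI0.
have dis2 : [disjoint Y & cover K].
  rewrite -[Y](@cover1 _ Y); apply: cover_disjoint; last by rewrite disjoints1.
  by move=> A; rewrite inE in_set1 => /orP[/eqP ->//|/(subsetP sKO')/orbs[]].
have [k1 k2] : 0 < #|B :\: BK| /\ 0 < #|BK| by rewrite !card_gt0.
have := merge_coverings dis1 dis2 k1 k2 cov1 cov2.
have -> : (B :\: BK) :|: BK = B.
  apply/setP => b; rewrite inE [b \in B :\: BK]inE [b \in BK]inE.
  by case: (b \in B); case: (att b \in K).
have cBK : (#|B :\: BK| + #|BK|)%N = #|B|.
  rewrite addnC -(cardsID BK B); congr (_ + _); apply: eq_card => b.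
  by rewrite [RHS]inE [b \in BK]inE andbA andbb.
move=> cov; exists Y, [::], O, ((4 * #|B|%:R ^+ 2 - 3) / d%:R)%R; split=> //.
split=> //; apply: covering_le (coveringS _ cov); last first.
  by rewrite subUset !coverS.
move: (cardB _ B'0) (cardB _ BK0); rewrite -cBK natrD.
move: (#|B :\: BK|%:R : rat)%R (#|BK|%:R : rat)%R => x y x1 y1.
have [x0 y0] : (0 < x /\ 0 < y)%R by split; apply: lt_le_trans ltr01 _.
have -> : ((x + y) * ((4 * x ^+ 2 - 1) / d%:R / x + (4 * y ^+ 2 - 1) / d%:R / y) =
   (4 * (x + y) ^+ 2 - (x + y) ^+ 2 / (x * y)) / d%:R)%R.
  by field; rewrite !gt_eqF.
rewrite ler_pM2r ?invr_gt0 // lerD2l lerN2 ler_pdivlMr ?mulr_gt0 //.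
by have := sqr_ge0 (x - y)%R; nra.
Qed.

End Packing.

(* Cauchy-Schwarz *)
Lemma sum_square_le (I : finType) (C : {set I}) (x : I -> nat) :
  ((\sum_(i in C) x i)%:R ^+ 2 <= #|C|%:R * (\sum_(i in C) x i ^ 2)%:R :> rat)%R.
Proof.
have [C0|C0] := posnP #|C|.
  by rewrite (cards0_eq C0) !big_set0 cards0 mul0r expr0n.
set S : rat := (\sum_(i in C) x i)%:R%R; set n : rat := (#|C|%:R)%R.
have n0 : (0 < n)%R by rewrite ltr0n.
have : (0 <= \sum_(i in C) ((x i)%:R * n - S) ^+ 2)%R.
  by apply: sumr_ge0 => i _; apply: sqr_ge0.
have -> : (\sum_(i in C) ((x i)%:R * n - S) ^+ 2 =
    n * (n * (\sum_(i in C) x i ^ 2)%:R - S ^+ 2))%R.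
  transitivity (\sum_(i in C) (n ^+ 2 * ((x i)%:R ^+ 2) - 2 * n * S * (x i)%:R + S ^+ 2))%R.
    by apply: eq_bigr => i _; ring.
  rewrite big_split sumrB /= -!mulr_sumr sumr_const -(mulr_natr S) -/n.
  have -> : (\sum_(i in C) (x i)%:R ^+ 2 = (\sum_(i in C) x i ^ 2)%:R :> rat)%R.
    by rewrite natr_sum; apply: eq_bigr => i _; rewrite natrX.
  rewrite -natr_sum -/S; ring.
by rewrite pmulr_rge0 // subr_ge0.
Qed.

Section Packing.
Variables (G : sgraph) (Gam : {group {perm G}}).
Hypothesis GamAut : Gam \subset graph_aut G.
Local Notation orb := (orb Gam).

Lemma connect_orbits (Z : {set G}) x y : connect (induced Z) x y ->
  connect (induced ([set orb z | z in Z] : {set quotient_graph Gam})) (orb x) (orb y).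
Proof.
move=> /connectP[p]; elim: p x => [|u p IH] x /=; first by move=> _ ->; apply: connect0.
move=> /andP[/and3P[xu xZ uZ] pth] yl; apply: connect_trans (IH u pth yl).
have [->|nxu] := eqVneq (orb x) (orb u); first exact: connect0.
apply: connect1; apply/and3P; split; last 2 first.
- exact: imset_f.
- exact: imset_f.
by rewrite /= /quotient_rel /= nxu andbT; apply: linked_orb.
Qed.

(** A fixed vertex b is adjacent to the whole orbit of a neighbour, which makes [reaches_all]
    applicable. It yields an orbit X whose collision probability phi is at most 4 |B|^2 / d, and by
    Cauchy-Schwarz the number of classes that meet X is at least 1 / phi. *)
Lemma packing (B Z : {set G}) (d N : nat) :
  connectb Z -> B \subset nb Z -> B != set0 ->
  {in B, forall b, {in Gam, forall p : {perm G}, p b = b}} ->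
  0 < d -> {in Z, forall z, d <= #|orb z|} -> 4 * #|B| ^ 2 * N <= d ->
  exists Q : 'I_N -> {set G},
  [/\ forall i, connectb (Q i), forall b i, b \in B -> b \in nb (Q i) &
      forall i j u, u \in Q i -> u \in Q j -> i = j].
Proof.
move=> cZ sBZ B0 fixB d0 dZ leN.
pose O : {set quotient_graph Gam} := [set orb z | z in Z].
have [z0 z0Z] := connectb_n0 cZ.
have pickZ b : b \in B -> exists2 z, z \in Z & adj z b.
  by move=> /(subsetP sBZ)/nbP[].
pose att b : quotient_graph Gam := orb (odflt b [pick z in Z | adj z b]).
have attP b : b \in B -> exists2 z, z \in Z & adj z b /\ att b = orb z.
  move=> bB; rewrite /att; case: pickP => [z /andP[zZ zb]|n]; first by exists z.
  by have [z zZ zb] := pickZ b bB; have := n z; rewrite zZ zb.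
have orbO : {in O, forall A, is_orb Gam A /\ d <= #|A|}.
  by move=> _ /imsetP[z zZ ->]; rewrite is_orb_orb dZ.
have [|X [s [P [phi [_ [_ XO] _ sPO [[M [col [[sMP sXM] cM tch en]]] le]]]]]] :=
    @reaches_all G Gam GamAut d O (orb z0) B att d0 orbO (imset_f _ z0Z) B0.
  move=> b bB; have [z zZ [zb ->]] := attP b bB.
  split; first by apply: connect_orbits; apply: connectb_connect.
  by move=> u /orbitP[p Gp <-]; rewrite /= -(fixB b bB p Gp) (adj_perm GamAut).
have [oX dX] := orbO X XO.
have X0 : (0 < #|X|%:R :> rat)%R by rewrite ltr0n (is_orb_gt0 oX).
pose C := [set c | color_class X col c != set0].
have leC : N <= #|C|.
  have sumC (f : nat -> nat) : f 0 = 0 ->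
      \sum_c f #|color_class X col c| = \sum_(c in C) f #|color_class X col c|.
    move=> f0; rewrite (bigID (mem C)) /= [X in _ + X]big1 ?addn0 // => c.
    by rewrite inE negbK => /eqP ->; rewrite cards0.
  have := sum_square_le C (fun c => #|color_class X col c|).
  rewrite -(sumC id) // -(sumC (fun n => n ^ 2)) // sum_color_class => cs.
  have {}cs : (#|X|%:R ^+ 2 <= (#|C|%:R * phi) * #|X|%:R ^+ 2 :> rat)%R.
    by apply: le_trans cs _; rewrite -mulrA ler_wpM2l.
  have d0' : (0 < d%:R :> rat)%R by rewrite ltr0n.
  have : (1 <= #|C|%:R * phi :> rat)%R.
    by rewrite -(ler_pM2r (exprn_gt0 2 X0)) mul1r.
  have phile : (phi <= 4 * #|B|%:R ^+ 2 / d%:R)%R.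
    by apply: le_trans le _; rewrite ler_pM2r ?invr_gt0 //; lra.
  move=> /le_trans/(_ (ler_wpM2l (ler0n _ #|C|) phile)).
  rewrite mulrA ler_pdivlMr // mul1r -(natrX _ _ 2) -[4%R]/(4%:R)%R -!natrM ler_nat => dC.
  have B1 : 0 < 4 * #|B| ^ 2 by rewrite muln_gt0 expn_gt0 card_gt0 B0.
  by rewrite -(leq_pmul2l B1); apply: leq_trans leN _; rewrite mulnC.
pose c (i : 'I_N) := nth z0 (enum C) i.
have cC i : c i \in C by rewrite -mem_enum mem_nth // -cardE (leq_trans (ltn_ord i)).
have cinj : injective c.
  move=> i j /eqP; rewrite nth_uniq ?enum_uniq -?cardE ?(leq_trans (ltn_ord _)) //.
  by move/eqP/val_inj.
have inX i : exists2 x, x \in X & col x = c i.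
  by have := cC i; rewrite inE => /set0Pn[x]; rewrite inE => /andP[xX /eqP]; exists x.
exists (fun i => color_class M col (c i)); split.
- move=> i; have [x xX xc] := inX i; apply/andP; split.
    by apply/set0Pn; exists x; rewrite inE (subsetP sXM) // xc eqxx.
  apply/forall_inP => u; rewrite inE => /andP[uM /eqP uc].
  apply/forall_inP => v; rewrite inE => /andP[vM /eqP vc].
  by rewrite -uc; apply: cM; rewrite // uc vc.
- move=> b i bB; have [x xX xc] := inX i.
  have [u uc ub] := tch x b xX bB; rewrite xc in uc.
  apply: in_nb uc ub _; rewrite inE negb_and; apply/orP; left.
  apply/negP => /(subsetP sMP)/bigcupP[A /(subsetP sPO)/imsetP[z zZ ->]] bz.
  have /orbitP[p Gp pb] : z \in orb b by rewrite orbit_sym.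
  have /nbP[] := subsetP sBZ b bB.
  by move: pb; rewrite /= /aperm (fixB b bB p Gp) => ->; rewrite zZ.
- move=> i j u; rewrite !inE => /andP[_ /eqP uci] /andP[_ /eqP ucj].
  by apply: cinj; rewrite -uci.
Qed.

End Packing.

(** * Separators and the canonical tree decomposition *)

Definition inseparable (h : nat) (G : sgraph) (x y : G) : bool :=
  [forall S : {set G}, [&& #|S| < h, x \notin S & y \notin S] ==>
    connect (induced (~: S)) x y].

Definition clique (h : nat) (G : sgraph) (K : {set G}) : bool :=
  (#|K| < h) && [forall x in K, forall y in K, inseparable h x y].

Lemma cliqueP h (G : sgraph) (K : {set G}) :
  reflect (#|K| < h /\ {in K &, forall x y, inseparable h x y}) (clique h K).
Proof.
apply: (iffP andP) => -[cK iK]; split=> //.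
  by move=> x y xK yK; move/forall_inP: iK => /(_ x xK)/forall_inP; apply.
by apply/forall_inP => x xK; apply/forall_inP => y yK; apply: iK.
Qed.

Lemma inseparableP h (G : sgraph) (x y : G) :
  reflect (forall S : {set G}, #|S| < h -> x \notin S -> y \notin S ->
    connect (induced (~: S)) x y) (inseparable h x y).
Proof.
apply: (iffP forallP) => [ins S cS xS yS|ins S].
  by move/implyP: (ins S); apply; rewrite cS xS.
by apply/implyP => /and3P[]; apply: ins.
Qed.

(** [packing] is applied to subsets of [nb Z]. For h vertices it gives h^2 disjoint sets and thereby
    a subdivision of [complete h], which needs 4 h^4 <= d. For two vertices it gives h sets, one of
    which avoids any given set of fewer than h vertices, which needs 16 h <= d. *)
Lemma nb_closed_clique (G : sgraph) (h d : nat) (Gam : {group {perm G}}) (C Z : {set G}) :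
  Gam \subset graph_aut G -> {in C, forall b, {in Gam, forall p : {perm G}, p b = b}} ->
  {in ~: C, forall x, d <= #|orb Gam x|} -> 0 < h -> 16 * h ^ 4 <= d ->
  ~ topological_subgraph (complete h) G ->
  connectb Z -> Z \subset ~: C -> nb Z \subset C -> clique h (nb Z).
Proof.
move=> GamA fixC bigC h0 hd noK cZ sZC nZC.
have d0 : 0 < d by apply: leq_trans hd; rewrite muln_gt0 expn_gt0 h0.
have bigZ : {in Z, forall z, d <= #|orb Gam z|} by move=> z /(subsetP sZC)/bigC.
have pack := packing GamA cZ _ _ _ d0 bigZ.
have fixN (B : {set G}) : B \subset nb Z ->
    {in B, forall b, {in Gam, forall p : {perm G}, p b = b}}.
  by move=> sB b /(subsetP sB)/(subsetP nZC)/fixC.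
apply/cliqueP; split.
  rewrite ltnNge; apply/negP => hN; apply: noK.
  have [z0 _] := connectb_n0 cZ.
  pose v (i : 'I_h) := nth z0 (enum (nb Z)) i.
  have vN i : v i \in nb Z by rewrite -mem_enum mem_nth // -cardE (leq_trans _ hN).
  have vinj : injective v.
    move=> i j /eqP; rewrite nth_uniq ?enum_uniq -?cardE ?(leq_trans _ hN) //.
    by move/eqP/val_inj.
  pose B := v @: 'I_h.
  have sB : B \subset nb Z by apply/subsetP => _ /imsetP[i _ ->].
  have cB : #|B| = h by rewrite card_imset // card_ord.
  have B0 : B != set0 by rewrite -card_gt0 cB.
  have [|Q [cQ bQ dQ]] := pack B #|{: 'I_h * 'I_h}| sB B0 (fixN B sB).
    rewrite cB card_prod card_ord; apply: leq_trans hd.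
    by rewrite -mulnA leq_mul // -[4]/(2 + 2) expnD leq_mul2l mulnn leqnn orbT.
  apply: (@complete_topological G h v (fun p => Q (enum_rank p))) => //.
    by move=> i p; apply: bQ; apply: imset_f.
  by move=> p q u /dQ up /up /enum_rank_inj.
move=> x y xN yN; apply/inseparableP => S cS xS yS.
have [->|nxy] := eqVneq x y; first exact: connect0.
pose B := [set x; y].
have sB : B \subset nb Z by apply/subsetP => z; rewrite in_set2 => /orP[]/eqP ->.
have B0 : B != set0 by apply/set0Pn; exists x; rewrite !inE eqxx.
have [|Q [cQ bQ dQ]] := pack B h sB B0 (fixN B sB).
  rewrite cards2 nxy; apply: leq_trans hd; rewrite leq_mul2l /=.
  by rewrite -{1}(expn1 h) leq_pexp2l.
have [i iS] : exists i, [disjoint Q i & S].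
  apply/existsP; apply: contraLR cS; rewrite negb_exists => /forallP nd.
  rewrite -leqNgt.
  have pickS i : exists u, (u \in Q i) && (u \in S).
    by have := nd i; rewrite -setI_eq0 => /set0Pn[u]; rewrite inE; exists u.
  pose f i := xchoose (pickS i).
  have fP i : (f i \in Q i) && (f i \in S) := xchooseP (pickS i).
  rewrite -[h]card_ord -(@card_imset _ _ f).
    apply/subset_leq_card/subsetP => _ /imsetP[i _ ->].
    by have /andP[] := fP i.
  move=> i j E; have /andP[fi _] := fP i; have /andP[fj _] := fP j.
  by apply: dQ fi _; rewrite E.
have xB : x \in nb (Q i) by apply: bQ; rewrite !inE eqxx.
have yB : y \in nb (Q i) by apply: bQ; rewrite !inE eqxx orbT.
apply: connect_inducedS (connect_nb2 (cQ i) xB yB).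
apply/subsetP => u; rewrite !inE => /or3P[/eqP ->|/eqP ->|uQ] //.
by rewrite (disjointFr iS uQ).
Qed.

Section Definitions.
Variables (h : nat) (G : sgraph).
Implicit Types (K S X Y Z : {set G}).

Definition separates K X : bool :=
  [exists x in X :\: K, exists y in X :\: K, ~~ connect (induced (~: K)) x y].

Definition cliqueseps X : {set {set G}} :=
  [set K : {set G} | [&& K \subset X, clique h K & separates K X]].

Definition minseps X : {set {set G}} :=
  [set K in cliqueseps X | [forall K' in cliqueseps X, #|K| <= #|K'|]].

(* Y is the component of G - K towards which K is oriented. *)
Definition big S X K Y : bool :=
  if S \subset K then #|X :\: (K :|: Y)| < #|X :&: Y| else S :\: K \subset Y.

Definition balanced S X K : bool :=
  [forall x in X :\: K, ~~ big S X K (component (~: K) x)].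

Definition shrink S X : {set G} :=
  if [exists K in minseps X, balanced S X K] then
    \bigcup_(K in minseps X | balanced S X K) K
  else [set x in X | [forall K in minseps X,
                       (x \in K) || big S X K (component (~: K) x)]].

(** A round in which a separator is left removes a vertex, so #|G| rounds suffice. *)
Definition core S X : {set G} := iter #|G| (shrink S) X.

(** Among the nodes only the root can fail to be connected; its bag is then empty, and its
    components become its children. *)
Definition bag_of Z : {set G} := if connectb Z then core (nb Z) (Z :|: nb Z) else set0.

Definition child : rel {set G} :=
  [rel Z W | [exists x in Z :\: bag_of Z, W == component (Z :\: bag_of Z) x]].

End Definitions.

Section CliqueFacts.
Variables (h : nat) (G : sgraph).
Implicit Types (K L S X Y Z : {set G}).

Lemma cliqueS K K' : K' \subset K -> clique h K -> clique h K'.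
Proof.
move=> sK /cliqueP[cK iK]; apply/cliqueP; split.
  exact: leq_ltn_trans (subset_leq_card sK) cK.
by move=> x y /(subsetP sK) xK /(subsetP sK) yK; apply: iK.
Qed.

Lemma clique_connect K L x y : clique h K -> #|L| < h -> x \in K :\: L -> y \in K :\: L ->
  connect (induced (~: L)) x y.
Proof.
move=> /cliqueP[_ iK] cL; rewrite !inE => /andP[xL xK] /andP[yL yK].
by have /inseparableP := iK x y xK yK; apply.
Qed.

Lemma clique_component K L x y : clique h K -> #|L| < h -> x \in K :\: L ->
  y \in K :\: L -> y \in component (~: L) x.
Proof. by move=> cK cL xK yK; rewrite inE; apply: clique_connect cK cL xK yK. Qed.

Lemma clique_card K : clique h K -> #|K| < h.
Proof. by case/cliqueP. Qed.

Lemma separatesP K X : reflect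
  (exists x y, [/\ x \in X, x \notin K, y \in X, y \notin K & y \notin component (~: K) x])
  (separates K X).
Proof.
apply: (iffP exists_inP) => [[x]|[x [y [xX xK yX yK n]]]].
  rewrite inE => /andP[xK xX] /exists_inP[y]; rewrite inE => /andP[yK yX] n.
  by exists x, y; rewrite inE.
exists x; first by rewrite inE xK.
by apply/exists_inP; exists y; rewrite ?inE ?yK // inE in n *.
Qed.

Lemma minsepsP K X : K \in minseps h X ->
  [/\ K \subset X, clique h K, separates K X &
      forall K', K' \subset X -> clique h K' -> separates K' X -> #|K| <= #|K'|].
Proof.
rewrite !inE => /andP[/and3P[sKX cK sepK] /forall_inP minK]; split=> //.
by move=> K' sK' cK' sep'; apply: minK; rewrite inE sK' cK'.
Qed.

Lemma minseps_n0 X K : K \in cliqueseps h X -> exists K', K' \in minseps h X.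
Proof.
move=> KX; case: (arg_minnP (fun K : {set G} => #|K|) KX) => K' K'X minK.
by exists K'; apply/setIdP; split=> //; apply/forall_inP.
Qed.

(* A component of G - K that meets X is attached to all of K: its
   neighbourhood is a clique that also separates X. *)
Lemma nb_minsep K X x : K \in minseps h X -> x \in X -> x \notin K ->
  nb (component (~: K) x) = K.
Proof.
move=> /minsepsP[sKX cK /separatesP[y [z [yX yK zX zK nz]]] minK] xX xK.
apply/eqP; rewrite eqEcard nb_compl_comp //=; apply: minK.
- exact: subset_trans (nb_compl_comp xK) sKX.
- exact: cliqueS (nb_compl_comp xK) cK.
have [w [wX wK nw]] : exists w, [/\ w \in X, w \notin K & w \notin component (~: K) x].
  have [yx|nyx] := boolP (y \in component (~: K) x); last by exists y.
  by exists z; split=> //; rewrite (comp_eq yx).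
have nbK u : u \notin K -> u \notin nb (component (~: K) x).
  by apply: contra; apply: (subsetP (nb_compl_comp xK)).
apply/separatesP; exists x, w; split; rewrite ?nbK //.
rewrite inE; apply: contra nw => c; apply: connect_stay c; first exact: comp_refl.
by rewrite setCK.
Qed.

Variables (K L X : {set G}).
Hypotheses (KX : K \in minseps h X) (LX : L \in minseps h X) (nKL : K != L).

Lemma minseps_diff : exists2 x, x \in K & x \notin L.
Proof.
apply/subsetPn; apply: contra nKL => sKL; rewrite eqEcard sKL.
have [_ _ _ ] := minsepsP LX; apply; have [] // := minsepsP KX.
Qed.

(* Two minimum separators do not cross. *)
Lemma minseps_side k l x : k \in K -> k \notin L -> l \in L -> l \notin K ->
  x \in X -> x \notin K -> x \notin component (~: K) l ->
  component (~: K) x \subset component (~: L) k.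
Proof.
move=> kK kL lL lK xX xK xl.
have [sLX cL _ _] := minsepsP LX; have [sKX cK _ _] := minsepsP KX.
set W := component (~: K) x.
have xK' : x \in ~: K by rewrite inE.
have WK u : u \in W -> u \notin K by move=> /(subsetP (comp_sub xK')); rewrite inE.
have WL : W \subset ~: L.
  apply/subsetP => u uW; rewrite inE; apply/negP => uL.
  have : u \in component (~: K) l.
    by apply: clique_component cL (clique_card cK) _ _; rewrite inE ?lK ?WK.
  by move=> ul; case/negP: xl; rewrite (comp_eq ul) comp_sym.
have kN : k \in nb W by rewrite (nb_minsep KX xX xK).
apply/subsetP => u uW; rewrite inE.
apply: connect_inducedS (connect_nb (comp_connectb xK') kN uW).
by rewrite subUset sub1set inE kL.
Qed.

End CliqueFacts.

(** * Orientation of the minimum separators *)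

Section Shrink.
Variables (h : nat) (G : sgraph) (S Z : {set G}).
Hypotheses (cZ : connectb Z) (SZ : S = nb Z) (cS : clique h S).
Implicit Types (K L X Y : {set G}).

(** The vertex in Z makes the children of a node proper subsets of it; the last condition makes them
    nodes with clique neighbourhoods again. *)
Definition bag_invariant X : Prop :=
  [/\ S \subset X, X \subset Z :|: S, exists2 x, x \in X & x \in Z &
      forall y, y \notin X -> clique h (nb (component (~: X) y))].

Lemma bag_invariant0 : bag_invariant (Z :|: S).
Proof.
split=> //; first exact: subsetUr.
  by have [z zZ] := connectb_n0 cZ; exists z; rewrite // inE zZ.
move=> y nyX; apply: cliqueS cS; apply/subsetP => x xN.
have := subsetP (nb_compl_comp nyX) x xN; rewrite inE => /orP[xZ|//].
have /nbP[_ [u uc ux]] := xN.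
have nyX' : y \in ~: (Z :|: S) by rewrite inE.
have := subsetP (comp_sub nyX') u uc; rewrite !inE negb_or => /andP[uZ uS].
by case/negP: uS; rewrite SZ; apply: (in_nb xZ); rewrite // adj_sym.
Qed.

Variable X : {set G}.
Hypothesis invX : bag_invariant X.

Let sSX : S \subset X. Proof. by case: invX. Qed.
Let sXZ : X \subset Z :|: S. Proof. by case: invX. Qed.

(** Z is connected and disjoint from S, and every vertex of S has a neighbour in Z; so no part of S
    separates X. *)
Lemma sep_not_sub K : separates K X -> ~~ (K \subset S).
Proof.
move=> /separatesP[x [y [xX xK yX yK nxy]]]; apply: contra nxy => sKS.
have [z zZ] := connectb_n0 cZ.
have ZK : Z \subset ~: K.
  apply/subsetP => u uZ; rewrite inE; apply/negP => /(subsetP sKS).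
  by rewrite SZ => /nb_disjoint; rewrite uZ.
have toz w : w \in X -> w \notin K -> connect (induced (~: K)) w z.
  move=> /(subsetP sXZ); rewrite inE => /orP[wZ|wS] wK.
    by apply: connect_inducedS ZK _; apply: connectb_connect.
  rewrite SZ in wS; apply: connect_inducedS (connect_nb cZ wS zZ).
  by rewrite subUset sub1set inE wK.
by rewrite inE; apply: connect_trans (toz x xX xK) _; rewrite connect_inducedC toz.
Qed.

Lemma minsep_meets K : K \in minseps h X -> exists2 x, x \in K & x \in Z.
Proof.
move=> /minsepsP[sKX _ /sep_not_sub /subsetPn[x xK xS] _]; exists x => //.
by have := subsetP sXZ x (subsetP sKX x xK); rewrite inE (negPf xS) orbF.
Qed.

Lemma side_sub K x : x \in X -> x \notin K ->
  X :&: component (~: K) x \subset X :\: K.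
Proof.
move=> xX xK; apply/subsetP => u; rewrite !inE => /andP[uX c]; rewrite uX andbT.
have xK' : x \in ~: K by rewrite inE.
by have := connect_induced_in c xK'; rewrite inE.
Qed.

(** At most one side outweighs all the others together, and at most one contains the non-empty set
    [S :\: K]. *)
Lemma big_unique K x y : x \in X -> x \notin K -> y \in X -> y \notin K ->
  big S X K (component (~: K) x) -> big S X K (component (~: K) y) ->
  y \in component (~: K) x.
Proof.
move=> xX xK yX yK; rewrite /big; case: ifP => [sSK|/negbT/subsetPn[s sS sK]].
  move=> bx by_; apply: contraT => nyx.
  have dis u : u \in component (~: K) x -> u \notin component (~: K) y.
    exact: comp_disjoint.
  have le1 : #|X :&: component (~: K) x| <= #|X :\: (K :|: component (~: K) y)|.
    apply/subset_leq_card/subsetP => u uX; have := subsetP (side_sub xX xK) u uX.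
    rewrite in_setD => /andP[uK uX']; move: uX; rewrite in_setI => /andP[_ ux].
    by rewrite in_setD in_setU negb_or uK dis.
  have le2 : #|X :&: component (~: K) y| <= #|X :\: (K :|: component (~: K) x)|.
    apply/subset_leq_card/subsetP => u uX; have := subsetP (side_sub yX yK) u uX.
    rewrite in_setD => /andP[uK uX']; move: uX; rewrite in_setI => /andP[_ uy].
    by rewrite in_setD in_setU negb_or uK uX' (contraL (@dis u)).
  by have := leq_trans bx le1; rewrite ltnNge (ltnW (leq_trans by_ le2)).
have sSK : s \in S :\: K by rewrite inE sK.
move=> /subsetP/(_ s sSK) sx /subsetP/(_ s sSK) sy.
by rewrite (comp_eq sx) comp_sym.
Qed.

Lemma big_S K s : #|K| < h -> s \in S :\: K -> big S X K (component (~: K) s).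
Proof.
move=> cK sSK; rewrite /big; case: ifP => [sub|_].
  by move: sSK; rewrite inE => /andP[/negP sK sS]; case: sK; apply: (subsetP sub).
by apply/subsetP => u uS; apply: clique_component cS cK sSK uS.
Qed.

Lemma balanced_sub K : #|K| < h -> balanced S X K -> S \subset K.
Proof.
move=> cK /forall_inP bal; apply/subsetP => s sS; apply: contraT => sK.
have sSK : s \in S :\: K by rewrite inE sK.
have : s \in X :\: K by rewrite inE sK (subsetP sSX).
by move/bal; rewrite big_S.
Qed.

(** Let l in L and k in K witness that the separators differ. Since they do not cross, the vertices
    of X outside K and outside the side of l lie on the side of L that contains k, and differ from
    k. Balance then makes the side of l smaller than that of k, and conversely. *)
Lemma balanced_unique K L : K \in minseps h X -> L \in minseps h X ->
  balanced S X K -> balanced S X L -> K = L.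
Proof.
move=> KX LX bK bL; apply/eqP; apply: contraT => nKL.
have nLK : L != K by rewrite eq_sym.
have [k kK kL] := minseps_diff KX LX nKL; have [l lL lK] := minseps_diff LX KX nLK.
have [sKX cK _ _] := minsepsP KX; have [sLX cL _ _] := minsepsP LX.
have sSK := balanced_sub (clique_card cK) bK.
have sSL := balanced_sub (clique_card cL) bL.
have lX := subsetP sLX l lL; have kX := subsetP sKX k kK.
have : ~~ big S X K (component (~: K) l).
  by move/forall_inP: bK; apply; rewrite inE lK.
have : ~~ big S X L (component (~: L) k).
  by move/forall_inP: bL; apply; rewrite inE kL.
rewrite /big sSK sSL -!leqNgt.
have sub1 : X :\: (K :|: component (~: K) l) \subset X :&: component (~: L) k :\ k.
  apply/subsetP => u; rewrite in_setD in_setU negb_or => /andP[/andP[uK ul] uX].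
  have uk : u \in component (~: L) k.
    exact: (subsetP (minseps_side KX LX kK kL lL lK uX uK ul)) _ (comp_refl _ _).
  by rewrite in_setD1 in_setI uX uk (contraNneq _ uK) // => ->.
have sub2 : X :\: (L :|: component (~: L) k) \subset X :&: component (~: K) l :\ l.
  apply/subsetP => u; rewrite in_setD in_setU negb_or => /andP[/andP[uL uk] uX].
  have ul : u \in component (~: K) l.
    exact: (subsetP (minseps_side LX KX lL lK kK kL uX uL uk)) _ (comp_refl _ _).
  by rewrite in_setD1 in_setI uX ul (contraNneq _ uL) // => ->.
have k_in : k \in X :&: component (~: L) k by rewrite in_setI kX comp_refl.
have l_in : l \in X :&: component (~: K) l by rewrite in_setI lX comp_refl.
have := subset_leq_card sub1; have := subset_leq_card sub2.
by have := cardsD1 k (X :&: component (~: L) k); have := cardsD1 l (X :&: component (~: K) l);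
  rewrite k_in l_in; clear; lia.
Qed.

(** If L points away from k, then K points towards L: the side to which L points does not contain k,
    hence lies inside the side of K that contains l. *)
Lemma big_nested K L k l x : K \in minseps h X -> L \in minseps h X ->
  k \in K -> k \notin L -> l \in L -> l \notin K ->
  x \in X -> x \notin L -> big S X L (component (~: L) x) ->
  ~~ big S X L (component (~: L) k) -> big S X K (component (~: K) l).
Proof.
move=> KX LX kK kL lL lK xX xL bx nbk.
have [sKX cK _ _] := minsepsP KX; have [sLX cL _ _] := minsepsP LX.
have nxk : x \notin component (~: L) k by apply: contra nbk => xk; rewrite (comp_eq xk).
have sxl : component (~: L) x \subset component (~: K) l.
  by have := minseps_side LX KX lL lK kK kL xX xL nxk.
have lside u : u \in L :\: K -> u \in component (~: K) l.
  by move=> uL; apply: clique_component cL (clique_card cK) _ uL; rewrite inE lK.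
move: (bx) nbk; rewrite /big; case: ifP => [sSL|/negbT/subsetPn[s sS sL]]; last first.
  move=> sSx _; have sl : s \in component (~: K) l.
    by apply: (subsetP sxl); apply: (subsetP sSx); rewrite inE sL.
  have sK : s \notin K.
    have lK' : l \in ~: K by rewrite inE.
    by have := subsetP (comp_sub lK') s sl; rewrite inE.
  have sSK : s \in S :\: K by rewrite inE sK.
  have := big_S (clique_card cK) sSK; rewrite /big (comp_eq sl).
  by case: ifP => // /subsetP/(_ s sS); rewrite (negPf sK).
move=> bx' _; case: ifP => [sSK|_]; last first.
  apply/subsetP => u; rewrite inE => /andP[uK uS].
  by apply: lside; rewrite inE uK (subsetP sSL).
apply: leq_ltn_trans (leq_trans bx' _); apply/subset_leq_card.
  apply/subsetP => u; rewrite in_setD in_setU negb_or => /andP[/andP[uK ul] uX].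
  have uk : u \in component (~: L) k.
    exact: (subsetP (minseps_side KX LX kK kL lL lK uX uK ul)) _ (comp_refl _ _).
  have uL : u \notin L by apply: contra ul => uL; apply: lside; rewrite inE uK.
  rewrite in_setD in_setU negb_or uL uX andbT /=.
  by apply: contra nxk => ux; rewrite (comp_eq uk) comp_sym.
by apply: setIS.
Qed.

End Shrink.

Section Core.
Variables (h : nat) (G : sgraph) (S Z : {set G}).
Hypotheses (cZ : connectb Z) (SZ : S = nb Z) (cS : clique h S).
Implicit Types (K L X Y : {set G}).

Lemma shrink_atom X : cliqueseps h X = set0 -> shrink h S X = X.
Proof.
move=> X0; have noK K : K \in minseps h X -> false.
  by case/setIdP; rewrite X0 inE.
rewrite /shrink; case: ifP => [/exists_inP[K /noK]//|_].
by apply/setP => x; rewrite inE; case: (x \in X) => //=; apply/forall_inP => K /noK.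
Qed.

Section Step.
Variable X : {set G}.
Hypothesis invX : bag_invariant h S Z X.

Let small K : {set G} := [set x in X :\: K | ~~ big S X K (component (~: K) x)].

Let notin_shrink : ~~ [exists K in minseps h X, balanced S X K] ->
  forall y, y \in X -> (y \notin shrink h S X) = [exists K in minseps h X, y \in small K].
Proof.
move=> /negPf nb y yX; rewrite /shrink nb inE yX /= negb_forall_in.
by apply: eq_existsb => K; rewrite !inE yX andbT negb_or.
Qed.

(** Among the separators that cut off y, one is taken that cuts off the most. If some L cut off a
    vertex k of it, then by [big_nested] L would cut off all that K cuts off and k in addition. *)
Lemma shrink_small y : ~~ [exists K in minseps h X, balanced S X K] ->
  y \in X -> y \notin shrink h S X ->
  exists K, [/\ K \in minseps h X, K \subset shrink h S X, y \notin K &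
                ~~ big S X K (component (~: K) y)].
Proof.
move=> nbal yX; rewrite notin_shrink // => /exists_inP[K0 K0X yK0].
pose P K := (K \in minseps h X) && (y \in small K).
have P0 : P K0 by rewrite /P K0X.
case: (arg_maxnP (fun K => #|small K|) P0) => K /andP[KX ysm] maxK.
have := ysm; rewrite inE in_setD => /andP[/andP[yK _] nbig].
exists K; split=> //; apply/subsetP => k kK.
have [sKX cK _ _] := minsepsP KX; have kX := subsetP sKX k kK.
apply: contraT; rewrite notin_shrink // => /exists_inP[L LX].
rewrite inE in_setD kX andbT => /andP[kL nbk].
have nLK : L != K by apply: contraNneq kL => ->.
have [l lL lK] := minseps_diff LX KX nLK.
have [x xX /andP[xL bx]] : exists2 x, x \in X & (x \notin L) && big S X L (component (~: L) x).
  have : ~~ balanced S X L.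
    by apply: contra nbal => bL; apply/exists_inP; exists L.
  rewrite negb_forall_in => /exists_inP[x]; rewrite in_setD negbK => /andP[xL xX] bx.
  by exists x; rewrite // xL.
have bl := big_nested cS KX LX kK kL lL lK xX xL bx nbk.
have sub : small K \subset small L :\ k.
  apply/subsetP => u; rewrite !inE => /andP[/andP[uK uX] nbu].
  have ul : u \notin component (~: K) l by apply: contra nbu => /comp_eq <-.
  have uk : u \in component (~: L) k.
    exact: (subsetP (minseps_side KX LX kK kL lL lK uX uK ul)) _ (comp_refl _ _).
  have kL' : k \in ~: L by rewrite inE.
  have uL : u \notin L by have := subsetP (comp_sub kL') u uk; rewrite inE.
  by rewrite uL uX -(comp_eq uk) nbk !andbT; apply: contraNneq uK => ->.
have kL' : k \in small L by rewrite inE in_setD kL kX.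
have /subsetD1P[/subsetP sub' _] := sub.
have : #|small L| <= #|small K| by apply: maxK; rewrite /P LX /= sub'.
by rewrite (cardsD1 k (small L)) kL' add1n ltnNge subset_leq_card.
Qed.

Lemma shrink_exists_small : ~~ [exists K in minseps h X, balanced S X K] ->
  cliqueseps h X != set0 -> exists2 y, y \in X & y \notin shrink h S X.
Proof.
move=> nbal /set0Pn[K0 /minseps_n0[K KX]].
have [_ _ /separatesP[x [y [xX xK yX yK nxy]]] _] := minsepsP KX.
have [bx|nbx] := boolP (big S X K (component (~: K) x)); last first.
  exists x => //; rewrite notin_shrink //; apply/exists_inP; exists K => //.
  by rewrite !inE xK xX.
exists y => //; rewrite notin_shrink //; apply/exists_inP; exists K => //.
rewrite inE in_setD yK yX; apply: contra nxy => by_.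
exact: (big_unique xX xK yX yK bx by_).
Qed.

Lemma shrink_balanced K : K \in minseps h X -> balanced S X K -> shrink h S X = K.
Proof.
move=> KX bK; rewrite /shrink ifT; last by apply/exists_inP; exists K.
apply/setP => x; apply/bigcupP/idP => [[L /andP[LX bL] xL]|xK]; last by exists K; rewrite ?KX.
by rewrite (balanced_unique cS invX KX LX bK bL).
Qed.

Lemma shrink_sub : shrink h S X \subset X.
Proof.
have [/exists_inP[K KX bK]|nbal] := boolP [exists K in minseps h X, balanced S X K].
  by rewrite (shrink_balanced KX bK); have [] := minsepsP KX.
by rewrite /shrink (negPf nbal); apply/subsetP => x; rewrite inE => /andP[].
Qed.

Lemma shrink_proper : cliqueseps h X != set0 -> shrink h S X \proper X.
Proof.
move=> X0; rewrite properE shrink_sub /=; apply/subsetPn.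
have [/exists_inP[K KX bK]|nbal] := boolP [exists K in minseps h X, balanced S X K].
  have [_ _ /separatesP[x [_ [xX xK _ _ _]]] _] := minsepsP KX.
  by exists x; rewrite // (shrink_balanced KX bK).
exact: shrink_exists_small.
Qed.

Lemma shrink_invariant : bag_invariant h S Z (shrink h S X).
Proof.
have [sSX sXZ [x0 x0X x0Z] compX] := invX.
have [/exists_inP[K KX bK]|nbal] := boolP [exists K in minseps h X, balanced S X K].
  rewrite (shrink_balanced KX bK); have [sKX cK sepK _] := minsepsP KX; split.
  - exact: (balanced_sub cS invX (clique_card cK) bK).
  - exact: subset_trans sKX sXZ.
  - exact (minsep_meets cZ SZ invX KX).
  - by move=> y yK; apply: cliqueS cK; apply: nb_compl_comp.
have [/eqP X0|X0] := boolP (cliqueseps h X == set0).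
  by rewrite shrink_atom.
set X' := shrink h S X; have sX'X : X' \subset X := shrink_sub.
split.
- apply/subsetP => s sS; rewrite /X' /shrink (negPf nbal) inE (subsetP sSX) //=.
  apply/forall_inP => K KX; have [_ cK _ _] := minsepsP KX.
  by case: (boolP (s \in K)) => //= sK; apply: big_S (clique_card cK) _ => //; rewrite inE sK.
- exact: subset_trans sX'X sXZ.
- have [y yX yX'] := shrink_exists_small nbal X0.
  have [K [KX sKX' _ _]] := shrink_small nbal yX yX'.
  have [x xK xZ] := minsep_meets cZ SZ invX KX.
  by exists x; rewrite // (subsetP sKX').
move=> y yX'; set Q := component (~: X') y.
have yX'c : y \in ~: X' by rewrite inE.
(* A component of G - X' that meets X is a side of a minimum separator kept in X'; any other one is
   already a component of G - X. *)
have [/exists_inP[y0 y0Q y0X]|/exists_inPn QX] := boolP [exists y0 in Q, y0 \in X].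
  have y0X' : y0 \notin X' by have := subsetP (comp_sub yX'c) y0 y0Q; rewrite inE.
  have [K [KX sKX' y0K nbig]] := shrink_small nbal y0X y0X'.
  have [_ cK _ _] := minsepsP KX.
  have y0Kc : y0 \in ~: K by rewrite inE.
  suff -> : Q = component (~: K) y0 by apply: cliqueS cK; apply: nb_compl_comp.
  rewrite /Q (comp_eq y0Q); apply/eqP; rewrite eqEsubset; apply/andP; split.
    apply/subsetP => u; rewrite !inE; apply: connect_inducedS.
    by rewrite setCS.
  apply: connectb_sub_comp (comp_refl _ _); first exact: comp_connectb.
  apply/subsetP => u uW; have := subsetP (comp_sub y0Kc) u uW; rewrite !inE => uK.
  apply: contra nbig; rewrite /X' /shrink (negPf nbal) inE => /andP[_ /forall_inP/(_ K KX)].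
  by rewrite (negPf uK) (comp_eq uW).
have yX : y \notin X by apply: QX; apply: comp_refl.
suff -> : Q = component (~: X) y by apply: compX.
apply/eqP; rewrite eqEsubset; apply/andP; split.
  apply: connectb_sub_comp (comp_refl _ _); first exact: comp_connectb.
  by apply/subsetP => u /QX; rewrite inE.
by apply/subsetP => u; rewrite !inE; apply: connect_inducedS; rewrite setCS.
Qed.

End Step.

(** If separators were left after #|G| rounds, every round would have removed a vertex and the set
    would be empty, whereas it still meets Z. *)
Lemma core_spec : bag_invariant h S Z (core h S (Z :|: S)) /\
  cliqueseps h (core h S (Z :|: S)) = set0.
Proof.
set X0 := Z :|: S.
have inv n : bag_invariant h S Z (iter n (shrink h S) X0).
  by elim: n => [|n IH]; [apply: bag_invariant0|apply: shrink_invariant].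
split; first exact: inv.
have main n : cliqueseps h (iter n (shrink h S) X0) = set0 \/
    #|iter n (shrink h S) X0| + n <= #|X0|.
  elim: n => [|n [IH|IH]] /=; first by right; rewrite addn0.
    by left; rewrite shrink_atom.
  have [e|ne] := eqVneq (cliqueseps h (iter n (shrink h S) X0)) set0.
    by left; rewrite shrink_atom.
  right; rewrite addnS; apply: leq_trans IH; rewrite ltn_add2r.
  exact: proper_card (shrink_proper (inv n) ne).
case: (main #|G|) => // le; have [_ _ [x xX _] _] := inv #|G|.
have /negP[] : ~~ (0 < #|iter #|G| (shrink h S) X0|).
  by rewrite -leqNgt -(leq_add2r #|G|) add0n (leq_trans le) ?max_card.
by apply/card_gt0P; exists x.
Qed.

End Core.

(** * The tree of nodes and its bags *)

Section Tree.
Variables (h : nat) (G : sgraph).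
Hypothesis h0 : 0 < h.
Implicit Types (W Z : {set G}) (x y : G).
Local Notation bagh := (@bag_of h G).
Local Notation child := (@child h G).

Definition node Z : bool := connect child [set: G] Z.

Lemma childP Z W : reflect
  (exists x, [/\ x \in Z, x \notin bagh Z & W = component (Z :\: bagh Z) x]) (child Z W).
Proof.
apply: (iffP exists_inP) => [[x]|[x [xZ xb ->]]].
  by rewrite inE => /andP[xb xZ] /eqP ->; exists x.
by exists x; rewrite ?inE ?xb ?eqxx.
Qed.

Lemma child_sub Z W : child Z W -> W \subset Z :\: bagh Z.
Proof. by case/childP => x [xZ xb ->]; apply: comp_sub; rewrite inE xb. Qed.

Lemma child_connectb Z W : child Z W -> connectb W.
Proof. by case/childP => x [xZ xb ->]; apply: comp_connectb; rewrite inE xb. Qed.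

Lemma child_eq Z W W' x : child Z W -> child Z W' -> x \in W -> x \in W' -> W = W'.
Proof. by move=> /childP[u [_ _ ->]] /childP[v [_ _ ->]] /comp_eq -> /comp_eq ->. Qed.

Lemma child_ex Z x : x \in Z -> x \notin bagh Z -> exists2 W, child Z W & x \in W.
Proof.
move=> xZ xb; exists (component (Z :\: bagh Z) x); last exact: comp_refl.
by apply/childP; exists x.
Qed.

Definition node_ok Z : Prop :=
  [/\ nb Z \subset bagh Z, bagh Z \subset Z :|: nb Z,
      forall y, y \notin bagh Z -> clique h (nb (component (~: bagh Z) y)) &
      (Z = [set: G] /\ ~~ connectb Z) \/
      [/\ connectb Z, clique h (nb Z), exists2 x, x \in bagh Z & x \in Z &
          cliqueseps h (bagh Z) = set0]].

Lemma connectb_ok Z : connectb Z -> clique h (nb Z) -> node_ok Z.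
Proof.
move=> cZ cN; have [[sS sb meet comps] atom] := core_spec cZ erefl cN.
by rewrite /node_ok /bag_of cZ; split=> //; right.
Qed.

Lemma clique0 : clique h (set0 : {set G}).
Proof. by apply/cliqueP; split=> [|x y]; rewrite ?cards0 ?inE. Qed.

Lemma nb_setT : nb [set: G] = set0.
Proof. by apply/setP => x; rewrite !inE. Qed.

Lemma root_ok : node_ok [set: G].
Proof.
have [cT|ncT] := boolP (connectb [set: G]).
  by apply: connectb_ok => //; rewrite nb_setT clique0.
have b0 : bagh [set: G] = set0 by rewrite /bag_of (negPf ncT).
split; rewrite ?nb_setT ?b0 ?sub0set //; last by left.
by move=> y _; apply: cliqueS (nb_compl_comp _) clique0; rewrite inE.
Qed.

Lemma child_nb Z W : node_ok Z -> child Z W -> nb W \subset bagh Z /\ node_ok W.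
Proof.
move=> [sN sb comps _] cW; have cbW := child_connectb cW.
have /childP[x [xZ xb E]] := cW.
have eW : W = component (~: bagh Z) x.
  rewrite E; apply/eqP; rewrite eqEsubset; apply/andP; split.
    by apply/subsetP => u; rewrite !inE; apply: connect_inducedS; rewrite setDE subsetIr.
  have xbc : x \in ~: bagh Z by rewrite inE.
  apply: connectb_sub_comp (comp_refl _ _); first exact: comp_connectb.
  apply/subsetP => u uc; rewrite inE.
  have := subsetP (comp_sub xbc) u uc; rewrite inE => -> /=.
  move: uc; rewrite inE => /connect_stay; apply=> //.
  by rewrite setCK.
split; first by rewrite eW; apply: nb_compl_comp.
by apply: connectb_ok => //; rewrite eW; apply: comps.
Qed.

Lemma node_ind (P : {set G} -> Prop) : P [set: G] ->
  (forall Z W, node Z -> child Z W -> P Z -> P W) -> forall Z, node Z -> P Z.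
Proof.
move=> PT Pc Z /connectP[p pth ->]; elim/last_ind: p pth => [//|p W IH].
rewrite rcons_path last_rcons => /andP[pth cW].
by apply: Pc cW (IH pth); apply/connectP; exists p.
Qed.

Lemma node_child Z W : node Z -> child Z W -> node W.
Proof. by move=> nZ cW; apply: connect_trans nZ (connect1 cW). Qed.

Lemma node_ok_node Z : node Z -> node_ok Z.
Proof.
move: Z; apply: node_ind; first exact: root_ok.
by move=> Z W _ cW /child_nb/(_ cW)[].
Qed.

Lemma child_proper Z W : node Z -> child Z W -> W \proper Z.
Proof.
move=> /node_ok_node[_ _ _ alt] cW; rewrite properE.
rewrite (subset_trans (child_sub cW) (subsetDl _ _)) /=.
case: alt => [[-> nc]|[_ _ [x xb xZ] _]].
  apply: contra nc => sW; suff <- : W = [set: G] by apply: child_connectb cW.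
  by apply/eqP; rewrite eqEsubset subsetT.
apply/subsetPn; exists x => //; apply/negP => /(subsetP (child_sub cW)).
by rewrite inE xb.
Qed.

(** Induction on the lengths of the paths from the root. The second node is replaced by its parent;
    if the first node lies inside this parent, the induction hypothesis is used once more with the
    roles exchanged. *)
Lemma nodes_laminar W Z : node W -> node Z ->
  [\/ [disjoint W & Z], W \subset Z | exists2 W', child W W' & Z \subset W'].
Proof.
move=> /connectP[p pth ->] /connectP[q qth ->].
have [n] := ubnP (size p + size q); elim: n p q pth qth => // n IH p q pth.
case/lastP: q => [|q Z'] /=; first by move=> _ _; apply: Or32; apply: subsetT.
rewrite rcons_path last_rcons size_rcons addnS ltnS => /andP[qth cZ'] ltn.
set W' := last _ p; set Z0 := last _ q in cZ' *.
have sZ' := subset_trans (child_sub cZ') (subsetDl _ _).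
have [dis|sW|[W1 cW1 sZ0]] := IH p q pth qth ltn.
- by apply: Or31; apply: disjointWr dis.
- rewrite addnC in ltn.
  have [dis|sZ0|[Z1 cZ1 sW1]] := IH q p qth pth ltn.
  + by apply: Or31; rewrite disjoint_sym; apply: disjointWl dis.
  + apply: Or33; exists Z' => //; suff -> : W' = Z0 by [].
    by apply/eqP; rewrite eqEsubset sW.
  + have [/eqP d0|] := boolP (Z1 :&: Z' == set0).
      by apply: Or31; apply: disjointWl sW1 _; rewrite -setI_eq0 d0.
    case/set0Pn => x; rewrite inE => /andP[x1 x2].
    by apply: Or32; rewrite -(child_eq cZ1 cZ' x1 x2).
- by apply: Or33; exists W1 => //; apply: subset_trans sZ0.
Qed.

Lemma parent_unique Z1 Z2 W : node Z1 -> node Z2 -> child Z1 W -> child Z2 W -> Z1 = Z2.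
Proof.
have main Z1' Z2' : node Z1' -> node Z2' -> child Z1' W -> child Z2' W -> Z1' \subset Z2'.
  move=> n1 n2 c1 c2; have [x xW] := connectb_n0 (child_connectb c1).
  have inZ Z' : child Z' W -> x \in Z'.
    by move=> /child_sub/subsetP/(_ x xW); rewrite inE => /andP[].
  have [dis|//|[W1 cW1 sZ2]] := nodes_laminar n1 n2.
    by have := disjointFr dis (inZ _ c1); rewrite (inZ _ c2).
  have eW : W = W1 by apply: child_eq c1 cW1 xW _; apply: (subsetP sZ2); apply: inZ.
  by have := child_proper n2 c2; rewrite properE eW sZ2 andbF.
by move=> n1 n2 c1 c2; apply/eqP; rewrite eqEsubset !main.
Qed.

(** Children avoid the bag of their parent, so along the nested nodes that contain x, only one has x
    in its bag: the home of x. Any other bag containing x has it through the neighbourhood of its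
    node. *)
Lemma home_unique Z1 Z2 x : node Z1 -> node Z2 -> x \in Z1 -> x \in bagh Z1 ->
  x \in Z2 -> x \in bagh Z2 -> Z1 = Z2.
Proof.
have main Z1' Z2' : node Z1' -> node Z2' -> x \in Z1' -> x \in bagh Z1' ->
    x \in Z2' -> Z1' \subset Z2'.
  move=> n1 n2 x1 b1 x2; have [dis|//|[W1 cW1 sZ2]] := nodes_laminar n1 n2.
    by have := disjointFr dis x1; rewrite x2.
  by have := subsetP (child_sub cW1) x (subsetP sZ2 x x2); rewrite inE b1.
by move=> n1 n2 x1 b1 x2 b2; apply/eqP; rewrite eqEsubset !main.
Qed.

Lemma home_ex x : exists Z, [/\ node Z, x \in Z & x \in bagh Z].
Proof.
pose P Z := node Z && (x \in Z).
have nT : P [set: G] by rewrite /P inE /node connect0.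
case: (arg_minnP (fun Z : {set G} => #|Z|) nT) => Z /andP[nZ xZ] minZ.
exists Z; split=> //; apply: contraT => xb; have [W cW xW] := child_ex xZ xb.
have /minZ : P W by rewrite /P xW (node_child nZ cW).
by rewrite leqNgt proper_card // child_proper.
Qed.

Definition tree_vertex : finType := {Z : {set G} | node Z}.
Definition tree_rel : rel tree_vertex :=
  [rel a b | child (val a) (val b) || child (val b) (val a)].

Lemma tree_rel_sym : symmetric tree_rel.
Proof. by move=> a b; rewrite /tree_rel /= orbC. Qed.

Lemma tree_rel_irr : irreflexive tree_rel.
Proof.
move=> a; apply/negP => /orP[]c;
  by have := child_proper (valP a) c; rewrite properxx.
Qed.

Definition bag_tree : sgraph := SGraph tree_rel_sym tree_rel_irr.

Lemma root_node : node [set: G]. Proof. exact: connect0. Qed.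
Definition tree_root : bag_tree := exist node [set: G] root_node.
Definition tree_bag (t : bag_tree) : {set G} := bagh (val t).

Lemma tree_ind (P : bag_tree -> Prop) : P tree_root ->
  (forall a b : bag_tree, child (val a) (val b) -> P a -> P b) -> forall t, P t.
Proof.
move=> Pr Pc [Z nZ]; move: Z nZ.
suff main Z : node Z -> forall nZ : node Z, P (exist node Z nZ) by move=> Z nZ; apply: main.
move: Z; apply: node_ind => [nT|Z W nZ cW PZ nW].
  by rewrite (bool_irrelevance nT root_node).
by apply: (Pc (exist node Z nZ)) => //; apply: PZ.
Qed.

Lemma bag_tree_connected : connected_graph bag_tree.
Proof.
have to_root (t : bag_tree) : connect (induced [set: bag_tree]) tree_root t.
  move: t; apply: tree_ind; first exact: connect0.
  move=> a b cab ca; apply: connect_trans ca (connect1 _).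
  by apply/and3P; split; rewrite ?inE //; apply/orP; left.
split; first by apply/set0Pn; exists tree_root; rewrite inE.
move=> a b _ _; apply: connect_trans (to_root b).
by rewrite connect_inducedC; apply: to_root.
Qed.

(* In a cycle, both neighbours of a smallest vertex set are its parent. *)
Lemma bag_tree_acyclic : acyclic bag_tree.
Proof.
move=> c /andP[cyc uc]; rewrite leqNgt; apply/negP => c3.
have [t0 t0c] : exists t0, t0 \in c by case: c c3 {cyc uc} => // t c _; exists t; rewrite mem_head.
case: (arg_minnP (fun t : tree_vertex => #|val t|) t0c) => t tc mint.
have [i c' E] := rot_to tc.
have memc a : a \in t :: c' -> #|val t| <= #|val a|.
  by rewrite -E mem_rot; apply: mint.
have := cyc; rewrite -(rot_cycle i) E; have := uc; rewrite -(rot_uniq i) E.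
have : size (t :: c') = size c by rewrite -E size_rot.
case: c' => [|a [|b c']] in E memc *; [by move=> s; rewrite -s in c3..|].
move=> _ /= /and3P[_ ac _]; rewrite rcons_path => /andP[ta /andP[_ /andP[_ lt]]].
have par (u : bag_tree) : u \in t :: a :: b :: c' -> adj u t -> child (val u) (val t).
  move=> /memc le /orP[//|ctu].
  by have := proper_card (child_proper (valP t) ctu); rewrite ltnNge le.
have lc : last b c' \in t :: a :: b :: c' by rewrite !inE -in_cons mem_last !orbT.
have aE : a = last b c'.
  apply: val_inj; apply: parent_unique (valP a) (valP (last b c')) (par a _ _) (par _ lc lt).
    by rewrite !inE eqxx orbT.
  by rewrite adj_sym.
by move: ac; rewrite aE mem_last.
Qed.

(** A smallest node Z that contains y, and x in itself or its neighbourhood, has y in its bag. If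
    the bag misses x, one descends through nodes that contain x: y stays in their neighbourhoods and
    thus in their bags, until x enters the bag. *)
Lemma tree_bag_edge x y : adj x y ->
  exists t : bag_tree, (x \in tree_bag t) && (y \in tree_bag t).
Proof.
move=> xy.
suff [Z [nZ xb yb]] : exists Z, [/\ node Z, x \in bagh Z & y \in bagh Z].
  by exists (exist node Z nZ); rewrite /tree_bag /= xb yb.
pose P x y Z := [&& node Z, y \in Z & x \in Z :|: nb Z].
have descend u v Z : adj u v -> P u v Z -> v \notin bagh Z -> exists2 W, P u v W & #|W| < #|Z|.
  move=> uv /and3P[nZ vZ uZ] vb; have [W cW vW] := child_ex vZ vb.
  exists W; last by rewrite proper_card ?child_proper.
  rewrite /P (node_child nZ cW) vW inE /=; case: (boolP (u \in W)) => //= uW.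
  by apply: in_nb uW; [exact: vW|rewrite adj_sym].
have atT : P x y [set: G] by rewrite /P root_node !inE.
case: (arg_minnP (fun Z : {set G} => #|Z|) atT) => Z PZ minZ.
have yb : y \in bagh Z.
  apply: contraT => yb; have [W PW ltW] := descend x y Z xy PZ yb.
  by have := minZ W PW; rewrite leqNgt ltW.
have /and3P[nZ yZ xZ] := PZ; have [xb|xb] := boolP (x \in bagh Z); first by exists Z.
have [sN _ _ _] := node_ok_node nZ.
have {}xZ : x \in Z.
  move: xZ; rewrite inE => /orP[//|/(subsetP sN)]; by rewrite (negPf xb).
have [W cW xW] := child_ex xZ xb.
pose P' Z := [&& node Z, x \in Z & y \in nb Z].
have yW : y \notin W.
  by apply/negP => /(subsetP (child_sub cW)); rewrite inE yb.
have P'W : P' W by rewrite /P' (node_child nZ cW) xW (in_nb xW xy yW).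
case: (arg_minnP (fun Z : {set G} => #|Z|) P'W) => Y /and3P[nY xY yY] minY.
have [sNY _ _ _] := node_ok_node nY.
exists Y; split=> //; last exact: (subsetP sNY).
apply: contraT => xbY; have [U cU xU] := child_ex xY xbY.
have yU : y \notin U.
  apply: contra (nb_disjoint yY); apply: subsetP.
  exact: subset_trans (child_sub cU) (subsetDl _ _).
have /minY : P' U by rewrite /P' (node_child nY cU) xU (in_nb xU xy yU).
by rewrite leqNgt proper_card ?child_proper.
Qed.

(** If x lies in the bag of a node that is not its home, then it lies in the neighbourhood of this
    node, hence in the bag of the parent. So one can climb to the home of x. *)
Lemma tree_bag_vertex x : connected_set [set t : bag_tree | x \in tree_bag t].
Proof.
have [Z [nZ xZ xb]] := home_ex x; set A := [set t | _].
pose home : bag_tree := exist node Z nZ.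
have homeA : home \in A by rewrite inE.
have is_home (t : bag_tree) : x \in tree_bag t -> x \in val t -> t = home.
  by move=> xt xv; apply: val_inj; apply: home_unique (valP t) nZ xv xt xZ xb.
have to_home (t : bag_tree) : x \in tree_bag t -> connect (induced A) t home.
  move: t; apply: tree_ind => [xr|a b cab IH xb'].
    by rewrite (is_home tree_root xr) ?connect0 ?inE.
  have [xv|xv] := boolP (x \in val b); first by rewrite (is_home b xb' xv) connect0.
  have [sN sb _ _] := node_ok_node (valP b).
  have xa : x \in tree_bag a.
    have [sNb _] := child_nb (node_ok_node (valP a)) cab; apply: (subsetP sNb).
    by have := subsetP sb x xb'; rewrite inE (negPf xv).
  apply: connect_trans (IH xa); apply: connect1; apply/and3P; split.
  - by apply/orP; right.
  - by rewrite inE.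
  - by rewrite inE.
split; first by apply/set0Pn; exists home.
move=> a b; rewrite !inE => xa xb'; apply: connect_trans (to_home a xa) _.
by rewrite connect_inducedC; apply: to_home.
Qed.

Definition bag_decomposition : tree_decomposition G :=
  @TreeDecomposition G bag_tree tree_root tree_bag
    (conj bag_tree_connected bag_tree_acyclic) tree_bag_edge tree_bag_vertex.

(** The bag of a parent meets that of a child b only in the neighbourhood of b, a clique with fewer
    than h vertices. *)
Lemma bag_decomposition_adhesion : adhesion_width bag_decomposition <= h - 1.
Proof.
apply/bigmax_leqP => -[a b] /= ab.
wlog cab : a b ab / child (val a) (val b).
  move=> wl; case/orP: (ab) => c; first exact: wl.
  by rewrite setIC; apply: wl => //; apply/orP; left.
have [sNb [_ sb _ alt]] := child_nb (node_ok_node (valP a)) cab.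
have cN : clique h (nb (val b)).
  case: alt => [[bT /negP[]]|[]//]; exact: child_connectb cab.
rewrite leq_subRL // add1n; apply: leq_trans (clique_card cN); rewrite ltnS.
apply/subset_leq_card/subsetP => x; rewrite inE => /andP[xa xb].
have := subsetP sb x xb; rewrite inE => /orP[/(subsetP (child_sub cab))|//].
by rewrite inE; rewrite /tree_bag in xa; rewrite xa.
Qed.

End Tree.

(** * The torso of a bag *)

Lemma handshake (T : finType) (X : {set T}) (E : {set {set T}}) :
  {in E, forall e : {set T}, e \subset X /\ #|e| = 2} ->
  \sum_(x in X) #|[set y in X | [set x; y] \in E]| = 2 * #|E|.
Proof.
move=> E2; have deg x : x \in X ->
    #|[set y in X | [set x; y] \in E]| = \sum_(e in E) (x \in e).
  move=> xX; rewrite -big_mkcondr /= sum1dep_card -(@card_in_imset _ _ (fun y => [set x; y])).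
    apply: eq_card => e; rewrite !inE; apply/imsetP/andP => [[y]|[eE xe]].
      by rewrite inE => /andP[_ eE] ->; rewrite eE !inE eqxx.
    have [sX c2] := E2 e eE; have /cards2P[u [v [uv euv]]] := introT eqP c2.
    have [y ey] : exists y, e = [set x; y].
      move: xe; rewrite euv !inE => /orP[]/eqP ->; first by exists v.
      by exists u; rewrite setUC.
    exists y => //; rewrite inE -ey eE andbT; apply: (subsetP sX).
    by rewrite ey !inE eqxx orbT.
  move=> y z; rewrite !inE => /andP[_ yE] _ /setP eyz.
  have nxy : x != y.
    have [_] := E2 _ yE; rewrite cards2; by case: eqP.
  by have := eyz y; rewrite !inE eqxx orbT eq_sym (negPf nxy) /= => /esym/eqP.
rewrite (eq_bigr _ deg) exchange_big /= mulnC -sum_nat_const; apply: eq_bigr => e eE.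
have [sX c2] := E2 e eE; rewrite -big_mkcondr /= sum1dep_card -c2.
apply: eq_card => x; rewrite !inE; case xe: (x \in e); rewrite ?andbF //.
by rewrite (subsetP sX).
Qed.

Lemma leq_card_bigcup (I T : finType) (P : pred I) (F : I -> {set T}) :
  #|\bigcup_(i | P i) F i| <= \sum_(i | P i) #|F i|.
Proof.
elim/big_rec2: _ => [|i n A _ leA]; first by rewrite cards0.
by apply: leq_trans (leq_card_setU _ _) _; rewrite leq_add2l.
Qed.

Section Torso.
Variables (h : nat) (G : sgraph) (X : {set G}).
Hypothesis cliqueX : forall y, y \notin X -> clique h (nb (component (~: X) y)).

(** The neighbours of a in the torso: the vertices of X joined to a by a path with all inner
    vertices outside X. *)
Definition torso_nb (a : G) : {set G} :=
  [set y in X | (y != a) && connect (induced (a |: (y |: ~: X))) a y].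

Let comps : {set {set G}} := [set component (~: X) y | y in ~: X].
Let adjacent (p : {set G}) := [exists x in p, exists y in p, adj x y].
Let through (p Y : {set G}) := (Y \in comps) && (p \subset nb Y).
Let pairs : {set {set G}} := [set p : {set G} | (p \subset X) && (#|p| == 2)].
Let near := [set p in pairs | adjacent p].
Let far := [set p in pairs | ~~ adjacent p && [exists Y, through p Y]].

Lemma torso_pair a y : a \in X -> y \in torso_nb a -> [set a; y] \in near :|: far.
Proof.
move=> aX; rewrite inE => /andP[yX /andP[nya cay]].
have pp : [set a; y] \in pairs.
  by rewrite inE cards2 (eq_sym a) nya andbT subUset !sub1set aX.
have [adjp|nadj] := boolP (adjacent [set a; y]); first by rewrite !in_set in pp *; rewrite pp adjp.
apply/setUP; right; apply/setIdP; split=> //; rewrite nadj /=.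
have nay : ~~ adj a y.
  apply: contra nadj => ay; apply/exists_inP; exists a; first by rewrite !inE eqxx.
  by apply/exists_inP; exists y; rewrite // !inE eqxx orbT.
have nay' : a != y by rewrite eq_sym.
have [u au /andP[uA cuy]] := connect_first_step cay nay'.
have nua : u != a by apply: contraTneq au => ->; rewrite adj_irr.
have nuy : y != u by apply: contraNneq nay => ->.
have uX : u \in ~: X by move: uA; rewrite !inE (negPf nua) eq_sym (negPf nuy).
rewrite connect_inducedC in cuy.
have [w yw /andP[wA cwu]] := connect_first_step cuy nuy.
have sub : ((a |: (y |: ~: X)) :\ a) :\ y \subset ~: X.
  by apply/subsetP => v; rewrite !inE => /and3P[/negPf -> /negPf ->].
apply/existsP; exists (component (~: X) u); apply/andP; split; first exact: imset_f.
have notin v : v \in X -> v \notin component (~: X) u.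
  by move=> vX; apply/negP => /(subsetP (comp_sub uX)); rewrite inE vX.
apply/subsetP => v; rewrite in_set2 => /orP[]/eqP ->.
  by apply: in_nb (comp_refl _ _) _ (notin a aX); rewrite adj_sym.
apply: (@in_nb _ _ w); rewrite ?notin // 1?adj_sym //.
by rewrite inE connect_inducedC; apply: connect_inducedS cwu.
Qed.

(** A function m assigns one pair to each component; the pairs of the image are those for which some
    component is reserved. *)
Let image (m : {ffun {set G} -> {set G}}) :=
  [set p in far | [exists Y, (m Y == p) && through p Y]].

(* If the image is as large as possible, every far pair lies in the neighbourhood
   of a component that realises a pair of the image. *)
Lemma max_image : exists2 m, #|far| <= #|image m| * h ^ 2 &
  forall p, p \in image m -> exists2 Y, m Y = p & through p Y.
Proof.
have [m _ maxm] := @arg_maxnP _ [ffun=> set0] xpredT (fun m => #|image m|) isT.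
have real p : p \in image m -> exists2 Y, m Y = p & through p Y.
  by move=> /setIdP[_ /existsP[Y /andP[/eqP mY tY]]]; exists Y.
exists m => //.
pose Yof q := odflt set0 [pick Y | (m Y == q) && through q Y].
have sub : far \subset \bigcup_(q in image m)
    [set p : {set G} | p \subset nb (Yof q) & #|p| == 2].
  apply/subsetP => p pfar; have /setIdP[pp /andP[_ /existsP[Y tY]]] := pfar.
  have p2 : #|p| == 2 by move: pp; rewrite inE => /andP[].
  have [pim|npim] := boolP (p \in image m).
    apply/bigcupP; exists p => //; rewrite inE p2 andbT /Yof.
    case: pickP => [Y' /andP[_ /andP[]]//|none].
    by have [Y' mY' tY'] := real p pim; have := none Y'; rewrite mY' eqxx tY'.
  pose m' := [ffun Y' => if Y' == Y then p else m Y'].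
  have pm' : p \in image m'.
    by apply/setIdP; split=> //; apply/existsP; exists Y; rewrite ffunE !eqxx.
  (* Otherwise redirecting Y to p would add p to the image without losing a pair. So [m Y] is
     realised by Y alone, and p is charged to [m Y]. *)
  have [qim uq] : m Y \in image m /\ forall Y', m Y' = m Y -> through (m Y) Y' -> Y' = Y.
    have [/andP[qi /forallP u]|n] := boolP ((m Y \in image m) &&
        [forall Y', (m Y' == m Y) && through (m Y) Y' ==> (Y' == Y)]).
      split=> // Y' mY' tY'; apply/eqP; have /implyP := u Y'; apply.
      by rewrite mY' eqxx.
    have sub' : image m \subset image m' :\ p.
      apply/subsetP => q qim; rewrite in_setD1; apply/andP; split.
        by apply: contraNneq npim => <-.
      have [Y' mY' tY'] := real q qim; have /setIdP[qfar _] := qim.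
      apply/setIdP; split=> //; apply/existsP.
      have [YY|nYY] := eqVneq Y' Y; last by exists Y'; rewrite ffunE (negPf nYY) mY' eqxx.
      move: n; rewrite -YY mY' qim /= negb_forall => /existsP[Y2].
      rewrite negb_imply => /andP[/andP[/eqP mY2 tY2] nY2].
      by exists Y2; rewrite ffunE -YY (negPf nY2) mY2 eqxx.
    have := maxm m' isT; rewrite /= (cardsD1 p (image m')) pm' add1n.
    by rewrite leqNgt ltnS subset_leq_card.
  apply/bigcupP; exists (m Y) => //; rewrite inE p2 andbT /Yof.
  case: pickP => [Y' /andP[/eqP mY' tY']|none].
    by rewrite /= (uq Y' mY' tY'); case/andP: tY.
  by have [Y' mY' tY'] := real _ qim; have := none Y'; rewrite mY' eqxx tY'.
apply: leq_trans (subset_leq_card sub) _; apply: leq_trans (leq_card_bigcup _ _) _.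
rewrite -sum_nat_const; apply: leq_sum => q qim; rewrite cards_draws bin2.
have cY : #|nb (Yof q)| <= h.
  rewrite /Yof; case: pickP => [Y /andP[_ /andP[/imsetP[y yX ->] _]]|none] /=.
    have nyX : y \notin X by move: yX; rewrite inE.
    by have /cliqueP[/ltnW] := cliqueX nyX.
  by have [Y mY tY] := real q qim; have := none Y; rewrite mY eqxx tY.
rewrite -divn2; apply: leq_trans (leq_div _ _) _.
by apply: leq_trans (leq_mul cY (leq_trans (leq_pred _) cY)) _; rewrite mulnn.
Qed.

Section TorsoGraph.
Variable E : {set {set G}}.
Hypothesis E2 : {in E, forall e : {set G}, e \subset X /\ #|e| = 2}.

Let vertex : finType := {x : G | x \in X}.
Let edge : rel vertex := [rel u v | [set val u; val v] \in E].

Lemma edge_sym : symmetric edge.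
Proof. by move=> u v; rewrite /edge /= setUC. Qed.

Lemma edge_irr : irreflexive edge.
Proof.
move=> u; apply/negP => /E2[_]; by rewrite setUid cards1.
Qed.

Definition graph_on : sgraph := SGraph edge_sym edge_irr.

Lemma card_graph_on : #|graph_on| = #|X|.
Proof. by rewrite /= card_sig; apply: eq_card => x. Qed.

Lemma graph_on_degrees :
  \sum_(x : graph_on) #|[set y : graph_on | adj x y]| = 2 * #|E|.
Proof.
rewrite -(handshake E2) [RHS]big_sub /=; apply: eq_bigr => x _.
rewrite -(card_imset _ val_inj); apply: eq_card => y; rewrite inE.
apply/imsetP/andP => [[z zE ->]|[yX yE]].
  by split; [exact: valP | rewrite inE in zE].
by exists (exist _ y yX); rewrite ?inE.
Qed.
End TorsoGraph.

(** Since m is a function, different pairs use different and hence disjoint components. So the graph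
    with edge set E is a topological subgraph of G, and the bound on the average degree applies to
    it. *)
Lemma sparse (R : realType) (a : R) (E : {set {set G}}) (m : {ffun {set G} -> {set G}}) :
  (forall G' : sgraph, ~ topological_subgraph (complete h) G' ->
     (average_degree R G' <= a * h%:R ^+ 2)%R) ->
  ~ topological_subgraph (complete h) G ->
  {in E, forall e : {set G}, [/\ e \subset X, #|e| = 2 &
     adjacent e \/ exists2 Y, m Y = e & through e Y]} ->
  ((2 * #|E|)%:R <= a * h%:R ^+ 2 * #|X|%:R :> R)%R.
Proof.
move=> aP noK Ep; have E2 : {in E, forall e : {set G}, e \subset X /\ #|e| = 2}.
  by move=> e /Ep[].
have top : topological_subgraph (graph_on E2) G.
  pose Yof e := odflt set0 [pick Y | (m Y == e) && through e Y].
  pose D (e : {set graph_on E2}) : {set G} := let e' := [set val x | x in e] in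
    if (e' \in E) && ~~ adjacent e' then Yof e' else set0.
  have DP (e : {set graph_on E2}) u : u \in D e ->
      [/\ m (D e) = [set val x | x in e], D e \in comps & [set val x | x in e] \subset nb (D e)].
    rewrite /D; case: ifP => [/andP[eE nadj] uY|_]; last by rewrite inE.
    have [_ _ [adje|[Y mY tY]]] := Ep _ eE; first by rewrite adje in nadj.
    rewrite /Yof; case: pickP => [Y' /andP[/eqP mY' /andP[cY' nY']]|none] //=.
    by have := none Y; rewrite mY eqxx tY.
  apply: (@topological_model G (graph_on E2) val D (~: X)); first exact: val_inj.
  - by move=> x; rewrite inE negbK; apply: valP.
  - move=> e; apply/subsetP => u uD; have [_ /imsetP[y yX eD] _] := DP e u uD.
    by move: uD; rewrite eD; apply: (subsetP (comp_sub yX)).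
  - move=> e e' u uD uD'; have [mD /imsetP[y _ eD] _] := DP e u uD.
    have [mD' /imsetP[y' _ eD'] _] := DP e' u uD'.
    apply: (imset_inj val_inj); rewrite -mD -mD'; congr (m _).
    move: uD uD'; rewrite eD eD' => /comp_eq -> /comp_eq -> //.
  - move=> x y xyE; have e' : [set val z | z in [set x; y]] = [set val x; val y].
      by rewrite imsetU !imset_set1.
    have [_ c2 alt] := Ep _ xyE.
    have [adjxy|nadj] := boolP (adjacent [set val x; val y]).
      have axy : adj (val x) (val y).
        move/exists_inP: adjxy => [u + /exists_inP[v + uv]].
        rewrite !in_set2 => /orP[]/eqP eu /orP[]/eqP ev; move: uv; rewrite eu ev ?adj_irr //.
        by rewrite adj_sym.
      by apply: connect1; apply/and3P; split; rewrite ?axy // in_setU1 ?eqxx // in_setU1 eqxx orbT.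
    case: alt => [adje|[Y mY tY]]; first by rewrite adje in nadj.
    have DE : D [set x; y] = Yof [set val x; val y] by rewrite /D /= e' nadj [_ \in E]xyE.
    rewrite DE /Yof; case: pickP => [Y' /andP[_ /andP[/imsetP[z zX ->] sN]]|none] /=; last first.
      by have := none Y; rewrite mY eqxx tY.
    have [xN yN] : val x \in nb (component (~: X) z) /\ val y \in nb (component (~: X) z).
      by split; apply: (subsetP sN); rewrite !inE eqxx ?orbT.
    by apply: connect_nb2 => //; apply: comp_connectb.
have := aP _ (fun t => noK (topological_subgraph_trans t top)).
rewrite /average_degree graph_on_degrees card_graph_on.
have [X0|Xp] := posnP #|X|; last by rewrite ler_pdivrMr ?ltr0n.
suff -> : #|E| = 0 by rewrite X0 muln0 !mulr0.
apply/eqP; rewrite cards_eq0; apply/set0Pn => -[e /E2[sX c2]].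
by have := subset_leq_card sX; rewrite X0 c2.
Qed.

(** The exponent 5 collects a factor h^2 for passing from the realised pairs to all torso edges, h^2
    from the average degree, and h for averaging over [X :&: Z] instead of X. *)
Lemma torso_low (R : realType) (a : R) (Z : {set G}) : 0 < h -> (0 <= a)%R ->
  (forall G' : sgraph, ~ topological_subgraph (complete h) G' ->
     (average_degree R G' <= a * h%:R ^+ 2)%R) ->
  ~ topological_subgraph (complete h) G ->
  X \subset Z :|: nb Z -> #|nb Z| < h -> (exists2 x, x \in X & x \in Z) ->
  exists x, [/\ x \in X, x \in Z & (#|torso_nb x|%:R <= a * h%:R ^+ 5 :> R)%R].
Proof.
move=> h0 a0 aP noK sXZ cN [z zX zZ].
have [m mfar mimage] := max_image.
have pairsP p : p \in pairs -> p \subset X /\ #|p| = 2.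
  by rewrite inE => /andP[sp /eqP].
have E2 : {in near :|: far, forall e : {set G}, e \subset X /\ #|e| = 2}.
  by move=> e /setUP[]/setIdP[/pairsP].
have sp : ((2 * #|near :|: image m|)%:R <= a * h%:R ^+ 2 * #|X|%:R :> R)%R.
  apply: (sparse (m := m) aP noK) => e /setUP[/setIdP[/pairsP[sX c2] adje]|eim].
    by split=> //; left.
  have /setIdP[/setIdP[/pairsP[sX c2] _] _] := eim.
  by split=> //; right; apply: mimage.
have disj : #|near :|: image m| = #|near| + #|image m|.
  apply/eqP; rewrite (leq_card_setU _ _) disjoints_subset; apply/subsetP => e.
  move=> /setIdP[_ adje]; rewrite inE; apply/negP => /setIdP[/setIdP[_]].
  by rewrite adje.
have degs : \sum_(x in X) #|torso_nb x| <= h ^ 2 * (2 * #|near :|: image m|).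
  apply: leq_trans (_ : 2 * #|near :|: far| <= _).
    rewrite -(handshake E2); apply: leq_sum => x xX; apply: subset_leq_card.
    apply/subsetP => y yx; apply/setIdP; split; first by move: yx; rewrite inE => /andP[].
    exact: torso_pair.
  rewrite mulnCA leq_mul2l /= disj mulnDr; apply: leq_trans (leq_card_setU _ _) _.
  by apply: leq_add; [apply: leq_pmull; rewrite expn_gt0 h0 | rewrite mulnC].
have cX : #|X| <= h * #|X :&: Z|.
  have XZ0 : 0 < #|X :&: Z| by apply/card_gt0P; exists z; rewrite inE zX.
  have : #|X| <= #|X :&: Z| + #|nb Z|.
    apply: leq_trans (leq_card_setU _ _); apply: subset_leq_card; apply/subsetP => x xX.
    by have := subsetP sXZ x xX; rewrite !in_setU in_setI xX.
  by move: XZ0 cN; clear; nia.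
have [/exists_inP[x /setIP[xX xZ] le]|] := boolP
    [exists x in X :&: Z, (#|torso_nb x|%:R <= a * h%:R ^+ 5 :> R)%R]; first by exists x.
rewrite negb_exists_in => /forall_inP none.
have : (\sum_(x in X :&: Z) a * h%:R ^+ 5 < \sum_(x in X :&: Z) #|torso_nb x|%:R :> R)%R.
  apply: ltr_sum => [|x xXZ]; last by rewrite ltNge none.
  by apply/hasP; exists z; rewrite ?mem_index_enum // inE zX.
rewrite sumr_const -[(_ *+ #|_|)%R]mulr_natr -natr_sum ltNge => /negP[].
apply: le_trans (_ : (h ^ 2 * (2 * #|near :|: image m|))%:R <= _)%R.
  rewrite ler_nat; apply: leq_trans degs; rewrite [leqRHS](big_setID Z) /=; exact: leq_addr.
rewrite natrM natrX.
apply: le_trans (_ : h%:R ^+ 2 * (a * h%:R ^+ 2 * (h * #|X :&: Z|)%:R) <= _)%R; last first.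
  by rewrite natrM le_eqVlt; apply/orP; left; apply/eqP; ring.
rewrite ler_wpM2l ?exprn_ge0 //; apply: le_trans sp _.
by rewrite ler_wpM2l ?ler_nat // mulr_ge0 // exprn_ge0.
Qed.
End Torso.

(** * Atoms and the small closure *)

Section Atom.
Variables (h : nat) (G : sgraph) (X : {set G}).
Hypothesis cliqueX : forall y, y \notin X -> clique h (nb (component (~: X) y)).
Hypothesis atomX : cliqueseps h X = set0.

Lemma comp_stay (N Y : {set G}) x y : nb Y \subset N -> x \in Y ->
  connect (induced (~: N)) x y -> y \in Y.
Proof.
by move=> sN xY; apply: connect_stay xY _; rewrite setCK.
Qed.

(** A clique with a vertex outside X lies in a component Y of G - X together with [nb Y]. As
    [K :&: X] does not separate x from y, they are connected in G - K or each of them is connected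
    there to [nb Y], which is itself a clique. *)
Lemma atom_unseparated K x y : clique h K -> x \in X -> x \notin K ->
  y \in X -> y \notin K -> connect (induced (~: K)) x y.
Proof.
have sub L x' y' : clique h L -> L \subset X -> x' \in X -> x' \notin L ->
    y' \in X -> y' \notin L -> connect (induced (~: L)) x' y'.
  move=> cL sL x'X x'L y'X y'L; apply: contraT => n.
  suff : L \in cliqueseps h X by rewrite atomX inE.
  rewrite inE sL cL /=; apply/separatesP; exists x', y'; split=> //.
  by rewrite inE.
move=> cK xX xK yX yK; have [sK|/subsetPn[k kK kX]] := boolP (K \subset X); first exact: sub.
set Y := component (~: X) k.
have kY : k \in Y by apply: comp_refl.
have YX u : u \in Y -> u \notin X.
  have kX' : k \in ~: X by rewrite inE.
  by move=> /(subsetP (comp_sub kX')); rewrite inE.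
have cN := cliqueX kX; have sN : nb Y \subset X by apply: nb_compl_comp.
have KY u : u \in K -> u \notin nb Y -> u \in Y.
  move=> uK uN; apply: (comp_stay (subxx _) kY).
  have /cliqueP[_ iK] := cK; have /inseparableP := iK k u kK uK; apply=> //.
    exact: clique_card cN.
  by apply/negP => /nb_disjoint; rewrite kY.
have cKX : clique h (K :&: X) by apply: cliqueS cK; apply: subsetIl.
have meet x' y' : x' \in X -> x' \notin K -> y' \in X -> y' \notin K ->
    connect (induced (~: K)) x' y' \/
    exists n, [/\ n \in nb Y, n \notin K & connect (induced (~: K)) x' n].
  move=> x'X x'K y'X y'K; set A := component (~: K) x'.
  have x'K' : x' \in ~: K by rewrite inE.
  have [/exists_inP[n nN nA]|] := boolP [exists n in nb Y, n \in A].
    right; exists n; split=> //; last by rewrite inE in nA.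
    by have := subsetP (comp_sub x'K') n nA; rewrite inE.
  (* If A avoids [nb Y], it avoids Y as well; then no vertex of K in Y is a neighbour of A, and
     [nb A] lies in [K :&: X]. *)
  rewrite negb_exists_in => /forall_inP AN; left.
  have AY u : u \in A -> u \notin Y.
    move=> uA; apply/negP => uY; suff /YX : x' \in Y by rewrite x'X.
    apply: (connect_stay uY _ (connect_comp x'K' uA (comp_refl _ _))).
    by apply/subsetP => w wN; rewrite inE AN.
  have : connect (induced (~: (K :&: X))) x' y'.
    by apply: sub; rewrite ?subsetIr // inE ?(negPf x'K) ?(negPf y'K).
  move=> c; suff : y' \in A by rewrite inE.
  apply: connect_stay (comp_refl _ _) _ c; rewrite setCK; apply/subsetP => v vN.
  have vK := subsetP (nb_compl_comp x'K) v vN; rewrite inE vK /=.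
  apply: contraT => vX; have /nbP[_ [u uA uv]] := vN.
  have vY : v \in Y by apply: KY => //; apply: contra vX; apply: (subsetP sN).
  have uN : u \in nb Y by apply: (in_nb vY _ (AY u uA)); rewrite adj_sym uv.
  by have := AN u uN; rewrite uA.
have [//|[n [nN nK cn]]] := meet x y xX xK yX yK.
have [|[n' [n'N n'K cn']]] := meet y x yX yK xX xK; first by rewrite connect_inducedC.
apply: connect_trans cn _; rewrite connect_inducedC; apply: connect_trans cn' _.
by have /cliqueP[_ iN] := cN; have /inseparableP := iN n' n n'N nN; apply=> //; apply: clique_card cK.
Qed.

Lemma atom_sub (C : {set G}) a : a \in C -> a \in X -> torso_nb X a \subset C ->
  (forall x, x \notin C -> clique h (nb (component (~: C) x))) -> X \subset C.
Proof.
move=> aC aX sT cliqueC; apply/subsetP => x xX; apply: contraT => xC.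
set Q := component (~: C) x; have cN := cliqueC x xC.
have xQ : x \in Q by apply: comp_refl.
have QC u : u \in Q -> u \notin C.
  have xC' : x \in ~: C by rewrite inE.
  by move=> /(subsetP (comp_sub xC')); rewrite inE.
have xN : x \notin nb Q by apply/negP => /nb_disjoint; rewrite xQ.
have inN u : u \in X -> u \in C -> u \in nb Q.
  move=> uX uC; apply: contraT => uN.
  have /QC : u \in Q by apply: (comp_stay (subxx _) xQ); apply: atom_unseparated.
  by rewrite uC.
pose K := (nb Q :&: X) :\ a.
have cK : clique h K by apply: cliqueS cN; apply: subset_trans (subsetDl _ _) (subsetIl _ _).
have aK : a \notin K by rewrite !in_setD1 eqxx.
have xK : x \notin K by rewrite in_setD1 in_setI (negPf xN) andbF.
have := atom_unseparated cK aX aK xX xK.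
(* The set reached from a through vertices outside X has all its neighbours among the torso
   neighbours of a. These lie in C, hence in [nb Q] and in K, so a connection in G - K cannot leave
   the set. *)
move=> c; have : x \in component (a |: ~: X) a.
  apply: connect_stay (comp_refl _ _) _ c; rewrite setCK.
  have aW : a \in a |: ~: X by rewrite setU11.
  apply/subsetP => v vN; have := subsetP (nb_comp aW) v vN.
  rewrite in_setC in_setU1 in_setC negb_or negbK => /andP[nva vX].
  have vT : v \in torso_nb X a.
    have /nbP[_ [u uW uv]] := vN; have uA := subsetP (comp_sub aW) u uW.
    have sW : a |: ~: X \subset a |: (v |: ~: X) by rewrite setUS ?subsetUr.
    rewrite inE vX nva /=; rewrite inE in uW.
    apply: connect_trans (connect_inducedS sW uW) (connect1 _).
    by apply/and3P; rewrite uv (subsetP sW) // !inE eqxx orbT.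
  by rewrite in_setD1 in_setI nva vX inN // (subsetP sT).
move/(subsetP (comp_sub (setU11 _ _))); rewrite in_setU1 in_setC xX orbF => /eqP exa.
by move: xC; rewrite exa aC.
Qed.
End Atom.

(** * Naturality and stabilisers *)

Lemma connect_bij (T T' : finType) (f : T -> T') (e : rel T) (e' : rel T') :
  bijective f -> (forall x y, e' (f x) (f y) = e x y) ->
  forall x y, connect e' (f x) (f y) = connect e x y.
Proof.
move=> [g fK gK] ee x y; have path_map z p : path e' (f z) (map f p) = path e z p.
  by elim: p z => //= u p IH z; rewrite ee IH.
apply/connectP/connectP => -[p pth ep].
  exists (map g p); last by apply: (can_inj fK); rewrite ep -[in RHS](last_map f) mapK.
  by rewrite -path_map mapK.
by exists (map f p); rewrite ?path_map // ep last_map.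
Qed.

Lemma forall_bij (T T' : finType) (f : T -> T') (P : pred T') :
  bijective f -> [forall y, P y] = [forall x, P (f x)].
Proof.
move=> [g fK gK]; apply/forallP/forallP => [Pf x|Pf y]; first exact: Pf.
by rewrite -[y]gK.
Qed.

Lemma exists_bij (T T' : finType) (f : T -> T') (P : pred T') :
  bijective f -> [exists y, P y] = [exists x, P (f x)].
Proof.
move=> [g fK gK]; apply/existsP/existsP => -[x Px]; last by exists (f x).
by exists (g x); rewrite gK.
Qed.

Lemma imset_bij (T T' : finType) (f : T -> T') :
  bijective f -> bijective (fun A : {set T} => f @: A).
Proof.
move=> [g fK gK]; exists (fun A : {set T'} => g @: A) => A /=.
  by rewrite -imset_comp (eq_imset _ fK) imset_id.
by rewrite -imset_comp (eq_imset _ gK) imset_id.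
Qed.

Section Iso.
Variables (h : nat) (G H : sgraph) (f : G -> H).
Hypothesis f_iso : graph_iso f.
Implicit Types (A B K L S X Y Z W : {set G}) (x y a : G).

Let bij : bijective f. Proof. by case: f_iso. Qed.
Let inj : injective f. Proof. exact: bij_inj bij. Qed.
Let sbij : bijective (fun A : {set G} => f @: A). Proof. exact: imset_bij. Qed.
Let mem x A : (f x \in f @: A) = (x \in A). Proof. exact: mem_imset. Qed.
Let sub A B : (f @: A \subset f @: B) = (A \subset B).
Proof.
apply/subsetP/subsetP => s x; first by rewrite -!mem; apply: s.
by move=> /imsetP[y yA ->]; rewrite mem s.
Qed.
Let eqset A B : (f @: A == f @: B) = (A == B). Proof. exact: (inj_eq (imset_inj inj)). Qed.
Let card A : #|f @: A| = #|A|. Proof. exact: card_imset. Qed.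
Let ext (B : {set H}) A : (forall x, (f x \in B) = (x \in A)) -> B = f @: A.
Proof. by move=> E; apply/setP => y; have [g _ gK] := bij; rewrite -[y]gK E mem. Qed.
Let setCf A : ~: (f @: A) = f @: (~: A). Proof. by apply: ext => x; rewrite !inE mem. Qed.
Let setDf A B : f @: A :\: f @: B = f @: (A :\: B). Proof. by apply: ext => x; rewrite !inE !mem. Qed.
Let setIf A B : f @: A :&: f @: B = f @: (A :&: B). Proof. by apply: ext => x; rewrite !inE !mem. Qed.
Let setUf A B : f @: A :|: f @: B = f @: (A :|: B). Proof. by rewrite imsetU. Qed.
Let set1f x : [set f x] = f @: [set x]. Proof. by rewrite imset_set1. Qed.
Let set0f A : (f @: A == set0) = (A == set0). Proof. by rewrite -!cards_eq0 card. Qed.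

Let setE := (setCf, setDf, setIf, setUf, mem, sub, eqset, card, set0f).

Lemma connect_iso A x y : connect (induced (f @: A)) (f x) (f y) = connect (induced A) x y.
Proof.
apply: (@connect_bij _ _ f) => // u v; have [_ adjf] := f_iso.
by rewrite /induced /= adjf !mem.
Qed.

Lemma component_iso A x : component (f @: A) (f x) = f @: component A x.
Proof. by apply: ext => y; rewrite !inE connect_iso. Qed.

Lemma nb_iso Z : nb (f @: Z) = f @: nb Z.
Proof.
apply: ext => y; rewrite !inE mem; congr (_ && _); rewrite (exists_bij _ bij).
by have [_ adjf] := f_iso; apply: eq_existsb => x; rewrite mem adjf.
Qed.

Lemma connectb_iso Z : connectb (f @: Z) = connectb Z.
Proof.
rewrite /connectb set0f; congr (_ && _); rewrite (forall_bij _ bij).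
apply: eq_forallb => x; rewrite mem (forall_bij _ bij); congr (_ ==> _).
by apply: eq_forallb => y; rewrite mem connect_iso.
Qed.

Lemma inseparable_iso x y : inseparable h (f x) (f y) = inseparable h x y.
Proof.
rewrite /inseparable (forall_bij _ sbij); apply: eq_forallb => S /=.
by rewrite !setE connect_iso.
Qed.

Lemma clique_iso K : clique h (f @: K) = clique h K.
Proof.
rewrite /clique card; congr (_ && _); rewrite (forall_bij _ bij).
apply: eq_forallb => x; rewrite mem (forall_bij _ bij); congr (_ ==> _).
by apply: eq_forallb => y; rewrite mem inseparable_iso.
Qed.

Lemma separates_iso K X : separates (f @: K) (f @: X) = separates K X.
Proof.
rewrite /separates (exists_bij _ bij); apply: eq_existsb => x; rewrite !setE; congr (_ && _).
by rewrite (exists_bij _ bij); apply: eq_existsb => y; rewrite !setE connect_iso.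
Qed.

Lemma cliqueseps_iso K X : (f @: K \in cliqueseps h (f @: X)) = (K \in cliqueseps h X).
Proof. by rewrite !inE !setE clique_iso separates_iso. Qed.

Lemma minseps_iso K X : (f @: K \in minseps h (f @: X)) = (K \in minseps h X).
Proof.
rewrite /minseps [LHS]in_set [RHS]in_set cliqueseps_iso; congr (_ && _).
rewrite (forall_bij _ sbij); apply: eq_forallb => L /=.
by rewrite cliqueseps_iso !setE.
Qed.

Lemma big_iso S X K Y : big (f @: S) (f @: X) (f @: K) (f @: Y) = big S X K Y.
Proof. by rewrite /big !setE. Qed.

Lemma balanced_iso S X K : balanced (f @: S) (f @: X) (f @: K) = balanced S X K.
Proof.
rewrite /balanced (forall_bij _ bij); apply: eq_forallb => x.
by rewrite !setE component_iso big_iso.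
Qed.

Lemma shrink_iso S X : shrink h (f @: S) (f @: X) = f @: shrink h S X.
Proof.
rewrite /shrink (exists_bij _ sbij) /=.
under eq_existsb => K do rewrite minseps_iso balanced_iso.
case: ifP => _; apply: ext => x.
  apply/bigcupP/bigcupP => [[L]|[K cK xK]]; last first.
    by exists (f @: K); rewrite ?mem ?minseps_iso ?balanced_iso.
  have [g _ gK] := sbij; rewrite -(gK L) /= minseps_iso balanced_iso mem.
  by exists (g L).
rewrite !inE mem; congr (_ && _); rewrite (forall_bij _ sbij); apply: eq_forallb => K /=.
by rewrite minseps_iso !setE component_iso big_iso.
Qed.

Lemma core_iso S X : core h (f @: S) (f @: X) = f @: core h S X.
Proof.
rewrite /core -(bij_eq_card bij); elim: #|G| => //= n ->; exact: shrink_iso.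
Qed.

Lemma bag_of_iso Z : bag_of h (f @: Z) = f @: bag_of h Z.
Proof.
rewrite /bag_of connectb_iso; case: ifP => _; last by rewrite imset0.
by rewrite nb_iso setUf core_iso.
Qed.

Lemma child_iso Z W : child h (f @: Z) (f @: W) = child h Z W.
Proof.
rewrite /child /= (exists_bij _ bij); apply: eq_existsb => x.
by rewrite bag_of_iso !setE component_iso eqset.
Qed.

Lemma setT_iso : f @: [set: G] = [set: H].
Proof. by apply/esym/ext => x; rewrite !inE. Qed.

Lemma node_iso Z : node h (f @: Z) = node h Z.
Proof.
rewrite /node -setT_iso.
exact: (connect_bij (f := fun A : {set G} => f @: A) sbij child_iso).
Qed.

Lemma torso_nb_iso X a : torso_nb (f @: X) (f a) = f @: torso_nb X a.
Proof.
apply: ext => x; rewrite !inE mem (inj_eq inj); congr [&& _, _ & _].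
by rewrite !set1f !setE connect_iso.
Qed.
End Iso.

Lemma bag_decomposition_invariant h (h0 : 0 < h) :
  isomorphism_invariant (fun G => bag_decomposition G h0).
Proof.
move=> G H f fiso; have [[f' fK f'K] adjf] := fiso.
have f'iso : graph_iso f'.
  by split; [exists f | move=> x y; rewrite -adjf !f'K].
have nodef (t : bag_tree G h0) : node h (f @: val t) by rewrite node_iso // (valP t).
have nodef' (t : bag_tree H h0) : node h (f' @: val t) by rewrite node_iso // (valP t).
pose g (t : bag_tree G h0) : bag_tree H h0 := exist _ (f @: val t) (nodef t).
pose g' (t : bag_tree H h0) : bag_tree G h0 := exist _ (f' @: val t) (nodef' t).
exists g; split.
- split.
    exists g' => t; apply: val_inj => /=.
      by rewrite -imset_comp (eq_imset _ fK) imset_id.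
    by rewrite -imset_comp (eq_imset _ f'K) imset_id.
  by move=> a b; congr (_ || _); exact: child_iso.
- by apply: val_inj; rewrite /= setT_iso.
- by move=> t; rewrite /= /tree_bag /= bag_of_iso.
Qed.

Section Stabiliser.
Variables (h : nat) (G : sgraph) (a : G).
Local Notation stab := ('C_(graph_aut G)[a | 'P])%g.

Lemma graph_aut_iso (p : {perm G}) : p \in graph_aut G -> graph_iso p.
Proof.
rewrite inE => /forallP adjp; split; first by exists (p^-1)%g; [apply: permK | apply: permKV].
by move=> x y; apply/eqP/(forallP (adjp x)).
Qed.

Lemma stabP (p : {perm G}) : p \in stab -> graph_iso p /\ p a = a.
Proof. by case/setIP => /graph_aut_iso pi /astab1P. Qed.

Lemma stab_acts (X : {set G}) : (forall p : {perm G}, p \in stab -> p @: X = X) ->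
  [acts stab, on X | 'P]%g.
Proof.
move=> fixX; apply/subsetP => p ps; rewrite !inE /=; apply/subsetP => x xX.
by have := imset_f p xX; rewrite fixX // inE /=.
Qed.

(** Z is the home of a, hence preserved by every automorphism that fixes a. This is why a is chosen
    in Z and not merely in the bag. *)
Lemma stab_bag Z : node h Z -> a \in Z -> a \in bag_of h Z ->
  forall p : {perm G}, p \in stab -> p @: bag_of h Z = bag_of h Z.
Proof.
move=> nZ aZ ab p /stabP[pi pa].
have pZ : p @: Z = Z.
  apply: (@home_unique h G _ _ a) => //; first by rewrite node_iso.
  - by rewrite -[X in X \in _]pa imset_f.
  - by rewrite bag_of_iso // -[X in X \in _]pa imset_f.
by rewrite -bag_of_iso // pZ.
Qed.

Lemma stab_torso_nb (X : {set G}) : (forall p : {perm G}, p \in stab -> p @: X = X) ->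
  forall p : {perm G}, p \in stab -> p @: torso_nb X a = torso_nb X a.
Proof.
by move=> fixX p ps; have [pi pa] := stabP ps; rewrite -torso_nb_iso // pa fixX.
Qed.

Lemma stab_restriction d (X : {set G}) : 0 < h -> 16 * h ^ 4 <= d ->
  ~ topological_subgraph (complete h) G ->
  (forall y, y \notin X -> clique h (nb (component (~: X) y))) ->
  cliqueseps h X = set0 -> a \in X -> #|torso_nb X a| <= d ->
  (forall p : {perm G}, p \in stab -> p @: X = X) ->
  restriction_in_Gamma d [group of stab] X.
Proof.
move=> h0 hd noK cliqueX atomX aX cT fixX.
have d1 : 1 <= d by apply: leq_trans hd; rewrite muln_gt0 expn_gt0 h0.
set A := [group of stab]; set C := small_closure d A.
have aC : a \in C.
  rewrite -sub1set; apply: sub_small_closure; rewrite ?cards1 //.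
  by apply: stab_acts => p /stabP[_ pa]; rewrite imset_set1 pa.
have TC : torso_nb X a \subset C.
  by apply: sub_small_closure => //; apply/stab_acts/stab_torso_nb.
apply: small_orbits_in_Gamma (small_closure_small d A) _ (stab_acts fixX).
apply: (atom_sub cliqueX atomX aC aX TC) => x xC.
pose Gam := [group of 'C_A(C | 'P)%g].
have xC' : x \in ~: C by rewrite inE.
apply: (@nb_closed_clique G h d Gam C) => //.
- exact: subset_trans (subsetIl _ _) (subsetIl _ _).
- by move=> b bC p /setIP[_ /astabP]; apply.
- move=> y; rewrite inE => /orbit_outside_small_closure/ltnW; exact.
- exact: comp_connectb.
- exact: comp_sub.
- exact: nb_compl_comp.
Qed.
End Stabiliser.

Theorem theorem6p2 (R : realType) (a_deg : R)
    (a_deg_ge2 : (2 <= a_deg)%R)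
    (a_degP : forall (h : nat) (G : sgraph), 1 <= h ->
       ~ topological_subgraph (complete h) G ->
       (average_degree R G <= a_deg * h%:R ^+ 2)%R)
    (h : nat) (h_ge1 : 1 <= h) :
  exists D : forall G : sgraph, tree_decomposition G,
    isomorphism_invariant D /\
    forall G : sgraph, ~ topological_subgraph (complete h) G ->
      adhesion_width (D G) <= h - 1 /\
      forall t : td_tree (D G),
        (exists2 v : G, v \in bag t &
           restriction_in_Gamma
             (Num.truncn (144 * a_deg ^+ 2 * h%:R ^+ 5)%R)
             [group of ('C_(graph_aut G)[v | 'P])%g] (bag t))
        \/ [/\ ~ connected_graph G, t = td_root (D G) & bag t = set0].
Proof.
exists (fun G => bag_decomposition G h_ge1); split; first exact: bag_decomposition_invariant.
move=> G noK; split=> [|t]; first exact: bag_decomposition_adhesion.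
set d := Num.truncn _.
have h1 : (1 <= h%:R :> R)%R by rewrite ler1n.
have d_ge n : (n%:R <= 144 * a_deg ^+ 2 * h%:R ^+ 5)%R -> n <= d.
  by move=> le; rewrite /d truncn_ge_nat //; apply: le_trans le; apply: ler0n.
have h5 : (h%:R ^+ 4 <= h%:R ^+ 5 :> R)%R by rewrite ler_weXn2l.
have h4 : (0 <= h%:R ^+ 4 :> R)%R by rewrite exprn_ge0.
(* 16 is at most 144 a_deg^2. *)
have hd : 16 * h ^ 4 <= d.
  by apply: d_ge; rewrite natrM natrX; apply: ler_pM => //; nra.
(* A node that is not connected can only be the root of a disconnected or empty graph. *)
have [cZ|ncZ] := boolP (connectb (val t)); last first.
  right; have b0 : tree_bag t = set0 by rewrite /tree_bag /bag_of (negPf ncZ).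
  have [_ _ _ [[tT _]|[cZ _ _ _]]] := node_ok_node h_ge1 (valP t); last by rewrite cZ in ncZ.
  split=> //; last exact: val_inj.
  rewrite tT in ncZ; move=> conG; case/negP: ncZ; exact/connectbP.
left; have [sN sb cliqueX [[_ ncZ]|[_ cN meet atomX]]] := node_ok_node h_ge1 (valP t).
  by rewrite cZ in ncZ.
have a0 : (0 <= a_deg)%R by lra.
have [a [aX aZ aT]] :=
  torso_low cliqueX h_ge1 a0 (a_degP h ^~ h_ge1) noK sb (clique_card cN) meet.
exists a => //; apply: (stab_restriction h_ge1 hd noK cliqueX atomX aX); last first.
  exact: stab_bag (valP t) aZ aX.
(* a_deg is at most 144 a_deg^2 because a_deg is at least 2. *)
apply: d_ge; apply: le_trans aT _; rewrite ler_wpM2r ?exprn_ge0 //.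
nra.
Qed.
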